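(* Let $\varphi$ be an entire function, $p>0$ and $\alpha>-1$, such that $p-2<\alpha<p-1$. Then: (a) $S_\varphi(\mathcal{B})\subset\mathcal{D}^p_\alpha$ if and only if $\varphi$ is constant. (b) If $p\le2$ and $\alpha>\frac p2-1$, then $S_\varphi(\mathcal{D})\subset\mathcal{D}^p_\alpha$ if and only if $\varphi$ is of order less than $2$, or of order $2$ and finite type. (c) If $p>2$, then $S_\varphi(\mathcal{D})\subset\mathcal{D}^p_\alpha$ if and only if $\varphi$ is of order less than $2$, or of order $2$ and finite type.
   Context: $\mathbb{D}=\{z\in\mathbb{C}:|z|<1\}$, $\mathcal{H}ol(\mathbb{D})$ is the space of analytic functions in $\mathbb{D}$, and $dA(z)=\frac1\pi\,dx\,dy$. Superposition operator: for an entire function $\varphi$, $S_\varphi(f)=\varphi\circ f$ for $f\in\mathcal{H}ol(\mathbb{D})$. For $X,Y\subset\mathcal{H}ol(\mathbb{D})$, $S_\varphi(X)\subset Y$ means $\varphi\circ f\in Y$ for every $f\in X$. Spaces: for $0<p<\infty$ and $\alpha>-1$, $\mathcal{D}^p_\alpha$ is the set of $f\in\mathcal{H}ol(\mathbb{D})$ with $\int_{\mathbb{D}}(1-|z|^2)^\alpha|f'(z)|^p\,dA(z)<\infty$. The classical Dirichlet space is $\mathcal{D}=\mathcal{D}^2_0$. The Bloch space $\mathcal{B}$ is the set of $f\in\mathcal{H}ol(\mathbb{D})$ with $\sup_{z\in\mathbb{D}}(1-|z|^2)|f'(z)|<\infty$. Order and type: with $M(r,\varphi)=\max_{|z|=r}|\varphi(z)|$,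 the order of a non-constant entire function $\varphi$ is $\rho=\limsup_{r\to\infty}\frac{\log\log M(r,\varphi)}{\log r}$, and if $0<\rho<\infty$ its type is $\tau=\limsup_{r\to\infty}\frac{\log M(r,\varphi)}{r^\rho}$. Constant functions are regarded as having order $0$. *)

(* Defs.v *)
From HB Require Import structures.
From mathcomp Require Import all_boot all_order all_algebra.
From mathcomp Require Import complex.
From mathcomp Require Import all_classical all_reals all_analysis.

Set Implicit Arguments.
Unset Strict Implicit.
Unset Printing Implicit Defensive.
Import Order.TTheory GRing.Theory Num.Theory.
Import numFieldNormedType.Exports.

Local Open Scope classical_set_scope.
Local Open Scope ring_scope.
Local Open Scope complex_scope.

(* The norm `|z| of z : R[i] is an element of R[i]; the modulus used below is
   the R-valued [Normc.normc z].  Functions on the disc are represented by total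
   functions R[i] -> R[i] whose values off the disc play no role. *)

Definition unit_disc (R : realType) : set R[i] :=
  [set z | Normc.normc z < 1].

(* The scalar field is R[i], so [derivable _ z 1] is complex
   differentiability at z. *)
Definition complex_differentiable (R : realType) (f : R[i] -> R[i]) (z : R[i]) :
    Prop :=
  derivable (f : R[i]^o -> R[i]^o) z 1.

Definition cderiv (R : realType) (f : R[i] -> R[i]) : R[i] -> R[i] :=
  derive1 (f : R[i] -> R[i]^o).

Definition entire (R : realType) (phi : R[i] -> R[i]) : Prop :=
  forall z, complex_differentiable phi z.

Definition holD (R : realType) : set (R[i] -> R[i]) :=
  [set f | forall z, unit_disc z -> complex_differentiable f z].

(* Integral over the unit disc against dA = pi^-1 dx dy. *)
Definition disc_integral (R : realType) (g : R[i] -> \bar R) : \bar R :=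
  ((pi^-1)%:E *
   \int[(@lebesgue_measure R \x @lebesgue_measure R)%E]_(w in
     [set w : measurableTypeR R * measurableTypeR R | @unit_disc R (w.1 +i* w.2)])
     g (w.1 +i* w.2))%E.

Definition weighted_dirichlet (R : realType) (p alpha : R) :
    set (R[i] -> R[i]) :=
  [set f | holD f /\
    (disc_integral (fun z =>
       ((1 - Normc.normc z ^+ 2) `^ alpha
        * Normc.normc (cderiv f z) `^ p)%:E) < +oo)%E].

Definition dirichlet (R : realType) : set (R[i] -> R[i]) :=
  weighted_dirichlet 2 0.

Definition bloch (R : realType) : set (R[i] -> R[i]) :=
  [set f | holD f /\
    (ereal_sup [set ((1 - Normc.normc z ^+ 2) * Normc.normc (cderiv f z))%:E
               | z in @unit_disc R] < +oo)%E].

Definition superposition (R : realType) (phi f : R[i] -> R[i]) : R[i] -> R[i] :=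
  phi \o f.

Definition is_constant (R : realType) (phi : R[i] -> R[i]) : Prop :=
  exists c, forall z, phi z = c.

Definition max_modulus (R : realType) (phi : R[i] -> R[i]) (r : R) : R :=
  sup [set Normc.normc (phi z) | z in [set z | Normc.normc z = r]].

(* For non-constant entire phi, max_modulus phi r tends to infinity with r, so
   the convention that ln vanishes on nonpositive reals does not affect the
   limits superior below. *)
Definition growth_order (R : realType) (phi : R[i] -> R[i]) : \bar R :=
  if `[< is_constant phi >] then 0%E
  else limf_esup (fun r : R => (ln (ln (max_modulus phi r)) / ln r)%:E)
         (pinfty_nbhs R).

(* Meaningful only when 0 < growth_order phi < +oo. *)
Definition growth_type (R : realType) (phi : R[i] -> R[i]) : \bar R :=
  limf_esup
    (fun r : R => (ln (max_modulus phi r) / r `^ fine (growth_order phi))%:E)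
    (pinfty_nbhs R).

(* Main.v *)
Require Import Defs.
From mathcomp Require Import all_boot all_order all_algebra.
From mathcomp Require Import complex.
From mathcomp Require Import all_classical all_reals all_analysis.
From mathcomp Require Import measurable_realfun.
From mathcomp Require Import ring lra zify.
Import Order.TTheory GRing.Theory Num.Theory.
Import numFieldNormedType.Exports.
Set Implicit Arguments.
Unset Strict Implicit.
Unset Printing Implicit Defensive.
Local Open Scope classical_set_scope.
Local Open Scope ring_scope.

(** A function of the Dirichlet space satisfies |f(z)|^2 = o(log 1/(1-|z|)), as one
    sees by adding up the oscillations over dyadic annuli, whose energies are
    summable.  Hence if |phi(w)| <= A exp(A|w|^2), then |phi'(f)|^p is smaller than any
    negative power of 1-|z|, and phi o f lies in D^p_alpha.  Conversely, membership in
    D^p_alpha forces growth at most polynomial in 1/(1-|z|), because |g'|^q is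
    dominated by its area means for every q > 0.  If phi violates every Gaussian
    bound, a gliding hump of functions peaking at 1 - 2^-N, with Dirichlet energy
    O(1/N), produces f in D for which phi o f grows too fast along these points.  For
    the Bloch space, a lacunary series sum 2^-k z^(n_k), scaled into a small disc on which phi'
    does not vanish, has |f'| of size 2^-k n_k on an annulus of area 1/n_k, so the
    integral diverges since alpha < p - 1.

    Goursat's theorem and Cauchy's formula are proved on rectangles; only the
    nonvanishing of the integral of 1/(z-w) along a rectangle is used, never its
    value. *)

(** The exponents in the humps come from one trade-off. A peak of height |w| at 1 - 2^-N costs
    Dirichlet energy of order |w|^2 / N, while a function of D^p_alpha is at most C + C B^N there.
    Without a Gaussian bound there are, for each j, arbitrarily large w with log |phi(w)| > 16^j
    |w|^2. Taking N close to 8^j |w|^2 makes the energy of the j-th hump O(8^-j), which survives the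
    factor 2^(j+1) lost in Cauchy-Schwarz, while log |phi(w)| exceeds 2^j N up to a constant factor,
    more than any C + C B^N allows.

    In the other direction phi' costs a factor (1-|z|^2)^-eps with eps as small as desired, so a
    strict inequality between exponents leaves enough room: alpha > p - 2 when p >= 2, where
    (1-|z|^2)|f'| is bounded, and alpha > p/2 - 1 when p < 2, where |f'|^p is split between |f'|^2
    and a power of the weight with exponent above -1. *)

Local Notation normc := Normc.normc.
Local Notation cplx x y := (Complex x y).

(** * Complex differentiability *)

Section ComplexBasics.
Context {R : realType}.
Implicit Types (z w : R[i]) (f g : R[i] -> R[i]).

Lemma norm_normc z : `|z| = (normc z)%:C%C.
Proof. by case: z => a b; rewrite normc_def. Qed.

Lemma normc_ge0 z : 0 <= normc z.
Proof. by case: z => a b; exact: sqrtr_ge0. Qed.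

Lemma normc_sqr z : normc z ^+ 2 = complex.Re z ^+ 2 + complex.Im z ^+ 2.
Proof. by case: z => a b /=; rewrite sqr_sqrtr// addr_ge0 ?sqr_ge0. Qed.

Lemma normc_eq0 z : (normc z == 0) = (z == 0).
Proof.
apply/eqP/eqP => [/Normc.eq0_normc//|->]; exact: Normc.normc0.
Qed.

Lemma normc_gt0 z : (0 < normc z) = (z != 0).
Proof. by rewrite lt_def normc_ge0 andbT normc_eq0. Qed.

Lemma normcB z w : normc (z - w) = normc (w - z).
Proof. by rewrite -normcN opprB. Qed.

Lemma normcX z n : normc (z ^+ n) = normc z ^+ n.
Proof.
elim: n => [|n IH]; first by rewrite !expr0 Normc.normc1.
by rewrite !exprS Normc.normcM IH.
Qed.

Lemma normc_real (x : R) : normc (x%:C)%C = `|x|.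
Proof. by rewrite /= expr0n /= addr0 sqrtr_sqr. Qed.

Lemma normc_triangle z w u : normc (z - w) <= normc (z - u) + normc (u - w).
Proof.
have -> : z - w = (z - u) + (u - w) by rewrite subrKA.
exact: le_normcD.
Qed.

Lemma normc_sub_le z w : normc z - normc w <= normc (z - w).
Proof. by rewrite lerBlDr -{1}(subrK w z) le_normcD. Qed.

Lemma le_Re_normc z : `|complex.Re z| <= normc z.
Proof.
by rewrite -sqrtr_sqr; case: z => a b /=; rewrite ler_wsqrtr// lerDl sqr_ge0.
Qed.

Lemma le_Im_normc z : `|complex.Im z| <= normc z.
Proof.
by rewrite -sqrtr_sqr; case: z => a b /=; rewrite ler_wsqrtr// lerDr sqr_ge0.
Qed.

Lemma le_normc_ReIm z : normc z <= `|complex.Re z| + `|complex.Im z|.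
Proof.
rewrite -(@ler_pXn2r _ 2)// ?nnegrE ?normc_ge0 ?addr_ge0//.
rewrite normc_sqr -(real_normK (num_real (complex.Re z))).
rewrite -(real_normK (num_real (complex.Im z))).
by rewrite sqrrD addrAC lerDl mulrn_wge0// mulr_ge0.
Qed.

Lemma cReD z w : complex.Re (z + w) = complex.Re z + complex.Re w.
Proof. by case: z w => ? ? []. Qed.
Lemma cImD z w : complex.Im (z + w) = complex.Im z + complex.Im w.
Proof. by case: z w => ? ? []. Qed.
Lemma cReN z : complex.Re (- z) = - complex.Re z.
Proof. by case: z. Qed.
Lemma cImN z : complex.Im (- z) = - complex.Im z.
Proof. by case: z. Qed.
Lemma cReB z w : complex.Re (z - w) = complex.Re z - complex.Re w.
Proof. by rewrite cReD cReN. Qed.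
Lemma cImB z w : complex.Im (z - w) = complex.Im z - complex.Im w.
Proof. by rewrite cImD cImN. Qed.
Lemma cReM z w : complex.Re (z * w) =
  complex.Re z * complex.Re w - complex.Im z * complex.Im w.
Proof. by case: z w => ? ? []. Qed.
Lemma cImM z w : complex.Im (z * w) =
  complex.Re z * complex.Im w + complex.Im z * complex.Re w.
Proof. by case: z w => ? ? []. Qed.
Lemma cplxK z : cplx (complex.Re z) (complex.Im z) = z.
Proof. by case: z. Qed.
Lemma cplx_eq z w : complex.Re z = complex.Re w -> complex.Im z = complex.Im w -> z = w.
Proof. by case: z w => ? ? [? ?] /= -> ->. Qed.

Definition ccont f z := forall e : R, 0 < e -> exists2 d : R, 0 < d &
  forall w, normc (w - z) < d -> normc (f w - f z) < e.

(** Balls of [R[i]] have their radius in [R[i]]; positivity of the radius forces its imaginary part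
    to vanish, so real radii suffice. *)
Lemma nbhs_normc z (P : set R[i]) : nbhs (z : R[i]^o) P <->
  exists2 d : R, 0 < d & forall w, normc (w - z) < d -> P w.
Proof.
rewrite nbhs_ballP; split => [[e e0 H]|[d d0 H]].
  have [Ie Re0] : complex.Im e = 0 /\ 0 < complex.Re e.
    by move: e0; rewrite /= ltcE => /andP[/eqP -> ->].
  exists (complex.Re e) => // w wz; apply: H.
  rewrite -ball_normE /= distrC norm_normc -(cplxK e) Ie.
  by rewrite ltcR.
exists (d%:C)%C; first by rewrite /= ltcR.
by move=> w; rewrite -ball_normE /= distrC norm_normc ltcR => /H.
Qed.

Lemma ccontP f z : ccont f z <->
  (f : R[i]^o -> R[i]^o) @ (z : R[i]^o) --> (f z : R[i]^o).
Proof.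
split.
  move=> H A /nbhs_normc[e e0 HA]; have [d d0 Hd] := H e e0.
  by apply/nbhs_normc; exists d => // w /Hd /HA.
move=> H e e0.
have : nbhs (f z : R[i]^o) [set u | normc (u - f z) < e].
  by apply/nbhs_normc; exists e.
by move=> /H /nbhs_normc[d d0 Hd]; exists d.
Qed.

Local Notation FF z := (nbhs_filter (z : R[i]^o)).

Lemma ccont_cst c z : ccont (fun=> c) z.
Proof. by apply/ccontP; exact: (@cvg_cst _ (c : R[i]^o) _ _ (FF z)). Qed.

Lemma ccont_id z : ccont (fun w => w) z.
Proof. by apply/ccontP; exact: cvg_id. Qed.

Lemma ccontD f g z : ccont f z -> ccont g z -> ccont (fun w => f w + g w) z.
Proof.
move=> cf cg e e0; have e20 : 0 < e / 2 by lra.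
have [d d0 Hd] := cf _ e20; have [d' d'0 Hd'] := cg _ e20.
exists (Num.min d d'); first by rewrite lt_min d0.
move=> w; rewrite lt_min => /andP[/Hd fw /Hd' gw].
have -> : f w + g w - (f z + g z) = (f w - f z) + (g w - g z) by ring.
by apply: le_lt_trans (le_normcD _ _) _; lra.
Qed.

Lemma ccontN f z : ccont f z -> ccont (fun w => - f w) z.
Proof. by move=> /ccontP ?; apply/ccontP; exact: (@cvgN R[i] R[i]^o _ _ (FF z)). Qed.

Lemma ccontB f g z : ccont f z -> ccont g z -> ccont (fun w => f w - g w) z.
Proof. by move=> cf cg; apply: ccontD => //; exact: ccontN. Qed.

Lemma ccontM f g z : ccont f z -> ccont g z -> ccont (fun w => f w * g w) z.
Proof.
move=> cf cg e e0.
have nf := normc_ge0 (f z); have ng := normc_ge0 (g z).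
pose K := normc (f z) + normc (g z) + 1; have K0 : 0 < K by rewrite /K; lra.
(* With both errors below [e1 <= 1], the three terms of the expansion below add up to at most
   [e1 * K]. *)
pose e1 := Num.min 1 (e / (2 * K)).
have e10 : 0 < e1 by rewrite lt_min ltr01 divr_gt0// mulr_gt0.
have e11 : e1 <= 1 by rewrite ge_min lexx.
have e1K : e1 * K <= e / 2.
  have : e1 <= e / (2 * K) by rewrite ge_min lexx orbT.
  rewrite ler_pdivlMr ?mulr_gt0// => H; lra.
have [d d0 Hd] := cf _ e10; have [d' d'0 Hd'] := cg _ e10.
exists (Num.min d d'); first by rewrite lt_min d0.
move=> w; rewrite lt_min => /andP[/Hd fw /Hd' gw].
have -> : f w * g w - f z * g z = (f w - f z) * (g w - g z) +
  ((f w - f z) * g z + f z * (g w - g z)) by ring.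
apply: le_lt_trans (le_normcD _ _) _; rewrite Normc.normcM.
apply: (@le_lt_trans _ _ (e1 * 1 + (e1 * normc (g z) + normc (f z) * e1))); last first.
  by apply: le_lt_trans (_ : e / 2 < e); [move: e1K; rewrite /K; lra|lra].
apply: lerD; first by apply: ler_pM; rewrite ?normc_ge0//; lra.
apply: le_trans (le_normcD _ _) _; rewrite !Normc.normcM.
by apply: lerD; [apply: ler_wpM2r|apply: ler_wpM2l]; rewrite // ltW.
Qed.

Lemma ccontX f n z : ccont f z -> ccont (fun w => f w ^+ n) z.
Proof.
move=> cf; elim: n => [|n IH].
  by under eq_fun do rewrite expr0; exact: ccont_cst.
by under eq_fun do rewrite exprS; exact: ccontM.
Qed.

Lemma ccontV f z : f z != 0 -> ccont f z -> ccont (fun w => (f w)^-1) z.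
Proof. by move=> fz /ccontP ?; apply/ccontP; exact: (@cvgV R[i] _ _ (FF z)). Qed.

Lemma ccont_comp f g z : ccont f z -> ccont g (f z) -> ccont (fun w => g (f w)) z.
Proof.
by move=> /ccontP cf /ccontP cg; apply/ccontP; exact: (@cvg_comp _ _ _ (f : R[i]^o -> R[i]^o) (g : R[i]^o -> R[i]^o) _ _ _ cf cg).
Qed.

Lemma ccont_near f g z : (exists2 d : R, 0 < d & forall w, normc (w - z) < d -> f w = g w) ->
  ccont f z -> ccont g z.
Proof.
move=> [d d0 fg] cf e /cf[d' d'0 Hf].
have nz : normc (z - z) < d by rewrite subrr Normc.normc0.
exists (Num.min d d'); first by rewrite lt_min d0.
by move=> w; rewrite lt_min => /andP[wd wd']; rewrite -!fg// Hf.
Qed.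

(* Caratheodory's form of the derivative: the calculus rules become algebra. *)
Definition cdiff f z l := exists q, [/\ forall w, f w - f z = q w * (w - z),
  ccont q z & q z = l].

Lemma cdiff_ccont f z l : cdiff f z l -> ccont f z.
Proof.
move=> [q [fE cq _]].
have -> : f = (fun w => f z + q w * (w - z)).
  by apply/funext => w; rewrite -fE addrC subrK.
apply: ccontD; first exact: ccont_cst.
by apply: ccontM => //; apply: ccontB; [exact: ccont_id|exact: ccont_cst].
Qed.

Lemma cdiffP f z l : cdiff f z l <-> forall e : R, 0 < e -> exists2 d : R, 0 < d &
  forall w, normc (w - z) < d -> normc (f w - f z - l * (w - z)) <= e * normc (w - z).
Proof.
split.
  move=> [q [fE cq qz]] e /cq[d d0 Hd]; exists d => // w wz.
  rewrite fE -mulrBl Normc.normcM ler_wpM2r ?normc_ge0//.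
  by rewrite -qz ltW// Hd.
move=> H; pose q w := if w == z then l else (f w - f z) / (w - z).
exists q; split; last by rewrite /q eqxx.
  move=> w; rewrite /q; case: eqVneq => [->|wz]; first by rewrite !subrr mulr0.
  by rewrite divfK// subr_eq0.
move=> e e0; have [d d0 Hd] := H (e / 2) (divr_gt0 e0 (ltr0Sn _ _)).
exists d => // w wd; rewrite /q eqxx; case: (eqVneq w z) => [wz|wz].
  by rewrite subrr Normc.normc0.
have wz0 : w - z != 0 by rewrite subr_eq0.
have nwz : 0 < normc (w - z) by rewrite normc_gt0.
have -> : (f w - f z) / (w - z) - l = (f w - f z - l * (w - z)) / (w - z).
  by rewrite [RHS]mulrBl mulfK.
rewrite Normc.normcM Normc.normcV ltr_pdivrMr//.
apply: le_lt_trans (Hd _ wd) _; rewrite ltr_pM2r//; lra.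
Qed.

Lemma cdiff_near f g z l :
  (exists2 d : R, 0 < d & forall w, normc (w - z) < d -> f w = g w) ->
  cdiff f z l -> cdiff g z l.
Proof.
move=> [d d0 fg] /cdiffP df; apply/cdiffP => e /df[d' d'0 Hf].
have nz : normc (z - z) < d by rewrite subrr Normc.normc0.
exists (Num.min d d'); first by rewrite lt_min d0.
by move=> w; rewrite lt_min => /andP[wd wd']; rewrite -!fg// Hf.
Qed.

Lemma cdiff_ext f g z l : f =1 g -> cdiff f z l -> cdiff g z l.
Proof. by move=> /funext ->. Qed.

Lemma cdiff_eq f z l m : l = m -> cdiff f z l -> cdiff f z m.
Proof. by move=> ->. Qed.

Lemma cdiff_cst c z : cdiff (fun=> c) z 0.
Proof.
exists (fun=> 0); split => //; first by move=> w; rewrite subrr mul0r.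
exact: ccont_cst.
Qed.

Lemma cdiff_id z : cdiff (fun w => w) z 1.
Proof.
exists (fun=> 1); split => //; first by move=> w; rewrite mul1r.
exact: ccont_cst.
Qed.

Lemma cdiffD f g z l m : cdiff f z l -> cdiff g z m ->
  cdiff (fun w => f w + g w) z (l + m).
Proof.
move=> [p [fE cp pz]] [q [gE cq qz]]; exists (fun w => p w + q w); split.
- by move=> w; rewrite mulrDl -fE -gE; ring.
- exact: ccontD.
- by rewrite pz qz.
Qed.

Lemma cdiffM f g z l m : cdiff f z l -> cdiff g z m ->
  cdiff (fun w => f w * g w) z (l * g z + f z * m).
Proof.
move=> df dg; have cg := cdiff_ccont dg.
case: df dg => [p [fE cp pz]] [q [gE cq qz]].
exists (fun w => p w * g w + f z * q w); split.
- by move=> w; rewrite mulrDl mulrAC -fE -mulrA -gE; ring.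
- apply: ccontD; apply: ccontM => //; exact: ccont_cst.
- by rewrite pz qz.
Qed.

Lemma cdiffZ c f z l : cdiff f z l -> cdiff (fun w => c * f w) z (c * l).
Proof.
by move=> df; apply: cdiff_eq (cdiffM (cdiff_cst c z) df); rewrite mul0r add0r.
Qed.

Lemma cdiffN f z l : cdiff f z l -> cdiff (fun w => - f w) z (- l).
Proof.
move=> /(cdiffZ (-1)); rewrite mulN1r; apply: cdiff_ext => w.
by rewrite mulN1r.
Qed.

Lemma cdiffB f g z l m : cdiff f z l -> cdiff g z m ->
  cdiff (fun w => f w - g w) z (l - m).
Proof. by move=> df dg; apply: cdiffD => //; exact: cdiffN. Qed.

Lemma cdiffX f z l n : cdiff f z l ->
  cdiff (fun w => f w ^+ n) z (n%:R * f z ^+ n.-1 * l).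
Proof.
move=> df; elim: n => [|n IH].
  rewrite !mul0r; apply: cdiff_ext (cdiff_cst 1 z) => w.
  by rewrite expr0.
apply: (cdiff_ext (f := fun w => f w * f w ^+ n)); first by move=> w; rewrite exprS.
apply: cdiff_eq (cdiffM df IH); case: n {IH} => [|n] /=.
  by rewrite !expr0; ring.
by rewrite exprS -[n.+2%:R]natr1; ring.
Qed.

Lemma cdiffV f z l : f z != 0 -> cdiff f z l ->
  cdiff (fun w => (f w)^-1) z (- l / f z ^+ 2).
Proof.
move=> fz df; have cf := cdiff_ccont df.
have [d d0 Hd] : exists2 d, 0 < d & forall w, normc (w - z) < d -> f w != 0.
  have : 0 < normc (f z) by rewrite normc_gt0.
  move=> /cf[d d0 Hd]; exists d => // w /Hd; apply: contraTneq => ->.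
  by rewrite sub0r normcN ltxx.
case: df => [p [fE cp pz]].
(* Caratheodory's identity is required at every [w], also at zeros of [f], so the inverse is first
   modified outside the disc on which [f] does not vanish. *)
pose h w := if normc (w - z) < d then (f w)^-1 else (f z)^-1.
have nz : normc (z - z) < d by rewrite subrr Normc.normc0.
apply: (cdiff_near (f := h)).
  by exists d => // w wd; rewrite /h wd.
exists (fun w => if normc (w - z) < d then - p w / (f w * f z) else 0); split.
- move=> w; rewrite /h nz; case: ifPn => [/Hd fw|_]; last by rewrite subrr mul0r.
  by rewrite mulrAC mulNr -fE; field; rewrite fw fz.
- apply: (ccont_near (f := fun w => - p w / (f w * f z))).
    by exists d => // w ->.
  apply: ccontM; first exact: ccontN.
  apply: ccontV; first by rewrite mulf_neq0.
  by apply: ccontM => //; exact: ccont_cst.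
- by rewrite nz pz expr2.
Qed.

Lemma cdiff_comp f g z l m : cdiff f z l -> cdiff g (f z) m ->
  cdiff (fun w => g (f w)) z (m * l).
Proof.
move=> df; have cf := cdiff_ccont df.
case: df => [p [fE cp pz]] [q [gE cq qz]].
exists (fun w => q (f w) * p w); split.
- by move=> w; rewrite gE fE mulrA.
- by apply: ccontM => //; exact: ccont_comp cq.
- by rewrite qz pz.
Qed.

Lemma cdiff_derivable f z l : cdiff f z l ->
  complex_differentiable f z /\ cderiv f z = l.
Proof.
move=> /cdiffP H.
have cvgl : (fun h : R[i] => h^-1 *: ((f : R[i] -> R[i]^o) (h + z) - f z)) @ (0 : R[i]^o)^' --> (l : R[i]^o).
  apply/cvgrPdist_le => /= e e0.
  have [Ie Re0] : complex.Im e = 0 /\ 0 < complex.Re e.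
    by move: e0; rewrite /= ltcE => /andP[/eqP -> ->].
  have [d d0 Hd] := H _ Re0.
  rewrite /at_right; apply/nbhs_normc; exists d => // h hd h0.
  rewrite distrC norm_normc -(cplxK e) Ie.
  rewrite lecR.
  have := Hd (h + z); rewrite addrK; rewrite subr0 in hd => /(_ hd).
  have -> : h^-1 *: (f (h + z) - f z) - l = h^-1 * (f (h + z) - f z - l * h).
    by rewrite mulrBr (mulrC l) mulKf.
  by rewrite Normc.normcM Normc.normcV ler_pdivrMl ?normc_gt0// (mulrC (normc h)).
split; last first.
  exact: (@cvg_lim R[i]^o (@norm_hausdorff R[i] R[i]^o) _ _ (Proper_dnbhs_numFieldType (0 : R[i])) _ _ cvgl).
rewrite /complex_differentiable /derivable.
apply/cvg_ex; exists l.
apply: cvg_trans cvgl; apply: near_eq_cvg; near=> h; congr (_ *: (f (_ + _) - _)).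
by rewrite /GRing.scale /= mulr1.
Unshelve. all: by end_near. Qed.

Lemma derivable_cdiff f z : complex_differentiable f z -> cdiff f z (cderiv f z).
Proof.
rewrite /cderiv => df; rewrite derive1E.
have H : (fun h : R[i] => h^-1 *: ((f : R[i]^o -> R[i]^o) (h *: (1 : R[i]^o) + z) - f z)) @ (0 : R[i]^o)^'
   --> ('D_1 (f : R[i]^o -> R[i]^o) z : R[i]^o) by exact: df.
set l := derive _ _ _ in H *.
apply/cdiffP => e e0.
have : \forall h \near (0 : R[i]^o)^', `|h^-1 *: ((f : R[i]^o -> R[i]^o) (h *: (1 : R[i]^o) + z) - f z) - l| < (e%:C)%C.
  move/cvgrPdist_lt : H => /(_ (e%:C)%C); rewrite ltcR => /(_ e0).
  by apply: filterS => h; rewrite distrC.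
move=> /nbhs_normc[d d0 Hd]; exists d => // w wd.
have [->|wz] := eqVneq w z.
  by rewrite !subrr mulr0 subrr Normc.normc0 mulr0.
have wz0 : w - z != 0 by rewrite subr_eq0.
have := Hd (w - z); rewrite /= subr0 => /(_ wd wz0).
rewrite norm_normc ltcR /GRing.scale /= mulr1 subrK => /ltW Hn.
have -> : f w - f z - l * (w - z) = ((w - z)^-1 * (f w - f z) - l) * (w - z).
  by rewrite mulrBl mulrAC mulVf// mul1r.
by rewrite Normc.normcM ler_wpM2r// normc_ge0.
Qed.

Lemma cdiff_unique f z l m : cdiff f z l -> cdiff f z m -> l = m.
Proof. by move=> /cdiff_derivable[_ <-] /cdiff_derivable[_ <-]. Qed.

Lemma cdiff_cderiv f z l : cdiff f z l -> cdiff f z (cderiv f z).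
Proof. by move=> /cdiff_derivable[/derivable_cdiff]. Qed.

End ComplexBasics.

(** * Mean value inequality and quartering of rectangles *)

Section RealTools.
Context {R : realType}.

Lemma is_derive_eps (F : R -> R) (x l : R) :
  (forall e : R, 0 < e -> exists2 d : R, 0 < d &
     forall y, `|y - x| < d -> `|F y - F x - l * (y - x)| <= e * `|y - x|) ->
  is_derive x 1 F l.
Proof.
move=> H.
have cvgl : (fun h : R => h^-1 *: (F (h *: 1 + x) - F x)) @ 0^' --> l.
  apply/cvgrPdist_le => /= e e0; have [d d0 Hd] := H _ e0.
  near=> h; have h0 : h != 0 by near: h; exact: nbhs_dnbhs_neq.
  have := Hd (h + x); rewrite addrK => /(_ _) Hh.
  rewrite distrC /GRing.scale /= mulr1.
  have -> : h^-1 * (F (h + x) - F x) - l = h^-1 * (F (h + x) - F x - l * h).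
    by rewrite [RHS]mulrBr; congr (_ - _); rewrite mulrCA mulVf// mulr1.
  rewrite normrM normfV ler_pdivrMl ?normr_gt0// (mulrC `|h|); apply: Hh.
  by near: h; exact: dnbhs0_lt.
apply: DeriveDef; last by apply: cvg_lim.
by apply/cvg_ex; exists l.
Unshelve. all: by end_near. Qed.

Lemma continuous_eps (F : R -> R) (x : R) :
  (forall e : R, 0 < e -> exists2 d : R, 0 < d &
     forall y, `|y - x| < d -> `|F y - F x| < e) -> {for x, continuous F}.
Proof.
move=> H; apply/cvgrPdist_lt => /= e e0; have [d d0 Hd] := H _ e0.
near=> y; rewrite distrC; apply: Hd; rewrite distrC.
by near: y; exists d.
Unshelve. all: by end_near. Qed.

Lemma MVI_real (F dF : R -> R) (a b M : R) : a <= b ->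
  (forall x, a <= x <= b -> is_derive x 1 F (dF x)) ->
  (forall x, a <= x <= b -> `|dF x| <= M) ->
  `|F b - F a| <= M * (b - a).
Proof.
move=> ab dE dM.
have [c] : exists2 c, c \in `[a, b] & F b - F a = dF c * (b - a).
  apply: MVT_segment => //.
    by move=> x; rewrite in_itv /= => /andP[/ltW ax /ltW xb]; apply: dE; rewrite ax.
  apply/continuous_in_subspaceT => x; rewrite inE /= in_itv /= => /dE [dx _].
  exact/differentiable_continuous/derivable1_diffP.
rewrite in_itv /= => cab ->; rewrite normrM (@ger0_norm _ (b - a)) ?subr_ge0//.
by rewrite ler_wpM2r ?subr_ge0// dM.
Qed.

(** The mean value theorem fails for complex values, so it is applied to the real and imaginary
    parts along the segment; adding the two bounds gives the factor 2. *)
Lemma cdiff_MVI (f g : R[i] -> R[i]) (z0 h : R[i]) (M : R) :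
  (forall t : R, 0 <= t <= 1 -> cdiff f (z0 + (t%:C)%C * h) (g (z0 + (t%:C)%C * h))) ->
  (forall t : R, 0 <= t <= 1 -> normc (g (z0 + (t%:C)%C * h)) <= M) ->
  normc (f (z0 + h) - f z0) <= 2 * M * normc h.
Proof.
move=> df gM.
have segE (t y : R) : z0 + (y%:C)%C * h - (z0 + (t%:C)%C * h) = ((y - t)%:C)%C * h.
  by rewrite rmorphB /=; ring.
(* [P] stands for either coordinate: a real-linear functional bounded by the modulus. *)
have dRI (P : R[i] -> R) : (forall u v, P (u - v) = P u - P v) ->
    (forall (a : R) v, P ((a%:C)%C * v) = a * P v) -> (forall v, `|P v| <= normc v) ->
    forall t : R, 0 <= t <= 1 ->
    is_derive t 1 (fun t : R => P (f (z0 + (t%:C)%C * h))) (P (g (z0 + (t%:C)%C * h) * h)).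
  move=> PB PZ Pn t /df /cdiffP H; apply: is_derive_eps => e e0.
  (* Adding 1 keeps the denominator positive when [h = 0]. *)
  pose k := normc h + 1.
  have k0 : 0 < k by rewrite /k; have := normc_ge0 h; lra.
  have [d d0 Hd] := H _ (divr_gt0 e0 k0); exists (d / k); first exact: divr_gt0.
  move=> y yt; have nh := normc_ge0 h.
  have hk : normc h <= k by rewrite /k; lra.
  have Hn : normc (z0 + (y%:C)%C * h - (z0 + (t%:C)%C * h)) = `|y - t| * normc h.
    by rewrite segE Normc.normcM normc_real.
  have le1 : `|y - t| * normc h <= `|y - t| * k by rewrite ler_wpM2l.
  have := Hd (z0 + (y%:C)%C * h); rewrite Hn => /(_ _) Hy.
  have {}Hy := Hy (le_lt_trans le1 _).
  rewrite segE in Hy.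
  have {}Hy := Hy (_ : `|y - t| * k < d).
  rewrite ltr_pdivlMr// in yt.
  have {}Hy := Hy yt.
  have -> : P (g (z0 + (t%:C)%C * h) * h) * (y - t) =
      P (g (z0 + (t%:C)%C * h) * (((y - t)%:C)%C * h)) by rewrite mulrCA PZ mulrC.
  rewrite -!PB; apply: le_trans (Pn _) _; apply: le_trans Hy _.
  apply: le_trans (_ : e / k * (`|y - t| * k) <= _).
    by rewrite ler_wpM2l// divr_ge0// ltW.
  by rewrite mulrA mulrAC divfK ?lt0r_neq0// lexx.
have bnd (P : R[i] -> R) : (forall u v, P (u - v) = P u - P v) ->
    (forall (a : R) v, P ((a%:C)%C * v) = a * P v) -> (forall v, `|P v| <= normc v) ->
    `|P (f (z0 + h) - f z0)| <= M * normc h.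
  move=> PB PZ Pn.
  have /(_ ler01) := @MVI_real (fun t : R => P (f (z0 + (t%:C)%C * h)))
    (fun t => P (g (z0 + (t%:C)%C * h) * h)) 0 1 (M * normc h).
  have -> : (1%:C)%C = 1 :> R[i] by [].
  have -> : (0%:C)%C = 0 :> R[i] by [].
  rewrite mul1r mul0r addr0 subr0 mulr1 PB; apply.
    by move=> x x01; exact: dRI.
  move=> x x01; apply: le_trans (Pn _) _.
  by rewrite Normc.normcM ler_wpM2r ?normc_ge0// gM.
apply: le_trans (le_normc_ReIm _) _.
have -> : 2 * M * normc h = M * normc h + M * normc h by ring.
apply: lerD; apply: bnd.
- exact: cReB.
- by move=> a [u v] /=; rewrite mul0r subr0.
- exact: le_Re_normc.
- exact: cImB.
- by move=> a [u v] /=; rewrite mul0r addr0.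
- exact: le_Im_normc.
Qed.

Lemma nested_bisection (s : nat -> (R * R)) :
  (forall n, (s n).1 <= (s n).2) ->
  (forall n, let m := ((s n).1 + (s n).2) / 2 in
     s n.+1 = ((s n).1, m) \/ s n.+1 = (m, (s n).2)) ->
  exists x, forall e, 0 < e -> exists n0, forall n, (n0 <= n)%N ->
   [/\ (s 0%N).1 <= (s n).1, (s n).1 <= x, x <= (s n).2, (s n).2 <= (s 0%N).2
     & (s n).2 - (s n).1 < e].
Proof.
move=> s12 sS.
have mono n m : (n <= m)%N -> (s n).1 <= (s m).1 /\ (s m).2 <= (s n).2.
  elim: m => [|m IH]; first by rewrite leqn0 => /eqP ->.
  rewrite leq_eqVlt => /predU1P[->//|/IH[H1 H2]].
  by have := s12 m; case: (sS m) => -> /=; lra.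
have cross n m : (s n).1 <= (s m).2.
  have [/mono[H1 H2]|/ltnW/mono[H1 H2]] := leqP n m.
    exact: le_trans H1 (s12 m).
  exact: le_trans (s12 n) H2.
have width n : (s n).2 - (s n).1 = ((s 0%N).2 - (s 0%N).1) * 2^-1 ^+ n.
  elim: n => [|n IH]; first by rewrite expr0 mulr1.
  by rewrite exprS; case: (sS n) => -> /=; move: IH; rewrite mulrCA => <-; lra.
pose A := [set (s n).1 | n in [set: nat]].
have hsA : has_sup A.
  split; first by exists (s 0%N).1; exists 0%N.
  by exists (s 0%N).2 => _ [n _ <-]; exact: cross.
exists (sup A) => e e0.
have [n0 Hn0] : exists n0, forall n, (n0 <= n)%N -> (s n).2 - (s n).1 < e.
  pose w := (s 0%N).2 - (s 0%N).1 + 1.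
  have w0 : 0 < w by have := s12 0%N; rewrite /w; lra.
  have : (2^-1 : R) ^+ n @[n --> \oo] --> (0 : R).
    by apply: cvg_expr; rewrite gtr0_norm ?invr_gt0// invf_lt1// ltr1n.
  move=> /cvgrPdist_lt/(_ _ (divr_gt0 e0 w0))[n0 _ Hn0]; exists n0 => n n0n.
  have := Hn0 n n0n; rewrite sub0r normrN gtr0_norm ?exprn_gt0 ?invr_gt0//.
  rewrite ltr_pdivlMr// width => H.
  have q0 : 0 < (2^-1 : R) ^+ n by rewrite exprn_gt0 ?invr_gt0.
  by move: H; rewrite /w; set q := _ ^+ n in q0 *; nra.
exists n0 => n n0n; have [m1 m2] := mono 0%N n (leq0n _); split=> //.
- by apply: sup_upper_bound => //; exists n.
- by apply: sup_le_ub; [case: hsA|move=> _ [m _ <-]; exact: cross].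
- exact: Hn0.
Qed.

(** Takes the place of compactness in Goursat's theorem and in the boundedness of continuous
    functions on rectangles: a failure is inherited by some quarter, and the nested quarters shrink
    to a point. *)
Lemma bisection2 (P : R -> R -> R -> R -> Prop) :
  (forall a b c d, a <= b -> c <= d -> P a b c d ->
     let m := (a + b) / 2 in let n := (c + d) / 2 in
     [\/ P a m c n, P m b c n, P a m n d | P m b n d]) ->
  forall a b c d, a <= b -> c <= d -> P a b c d ->
  exists x y, forall e, 0 < e -> exists a' b' c' d',
    [/\ a <= a' <= x, x <= b' <= b, c <= c' <= y, y <= d' <= d &
    [/\ b' - a' < e, d' - c' < e & P a' b' c' d']].
Proof.
move=> HP a b c d ab cd Pabcd.
pose st := ((R * R) * (R * R))%type.
pose good (s : st) := [/\ s.1.1 <= s.1.2, s.2.1 <= s.2.2 & P s.1.1 s.1.2 s.2.1 s.2.2].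
pose half (s t : R * R) := let m := (s.1 + s.2) / 2 in t = (s.1, m) \/ t = (m, s.2).
(* Rectangles together with their property form a subtype, so that choice turns the existence of a
   quarter into a successor function. *)
have step (s : {s | good s}) : exists t : {s | good s},
    half (proj1_sig s).1 (proj1_sig t).1 /\ half (proj1_sig s).2 (proj1_sig t).2.
  case: s => -[[a0 b0] [c0 d0]] [/= ab0 cd0 P0].
  set m := (a0 + b0) / 2; set n := (c0 + d0) / 2.
  have am : a0 <= m <= b0 by rewrite /m; lra.
  have cn : c0 <= n <= d0 by rewrite /n; lra.
  case/andP: am => am mb; case/andP: cn => cn nd.
  case: (HP _ _ _ _ ab0 cd0 P0) => Pn.
  - have g : good ((a0, m), (c0, n)) by split.
    by exists (exist _ _ g); split; left.
  - have g : good ((m, b0), (c0, n)) by split.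
    by exists (exist _ _ g); split; [right|left].
  - have g : good ((a0, m), (n, d0)) by split.
    by exists (exist _ _ g); split; [left|right].
  - have g : good ((m, b0), (n, d0)) by split.
    by exists (exist _ _ g); split; right.
have [nxt Hnxt] := choice step.
have g0 : good ((a, b), (c, d)) by split.
pose u := fix u n := if n is m.+1 then nxt (u m) else exist good _ g0.
have [x Hx] : exists x, forall e, 0 < e -> exists n0, forall n, (n0 <= n)%N ->
   [/\ a <= (proj1_sig (u n)).1.1, (proj1_sig (u n)).1.1 <= x, x <= (proj1_sig (u n)).1.2,
    (proj1_sig (u n)).1.2 <= b & (proj1_sig (u n)).1.2 - (proj1_sig (u n)).1.1 < e].
  apply: (nested_bisection (s := fun n => (proj1_sig (u n)).1)).
    by move=> n; case: (u n) => s [].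
  by move=> n /=; case: (Hnxt (u n)).
have [y Hy] : exists x, forall e, 0 < e -> exists n0, forall n, (n0 <= n)%N ->
   [/\ c <= (proj1_sig (u n)).2.1, (proj1_sig (u n)).2.1 <= x, x <= (proj1_sig (u n)).2.2,
    (proj1_sig (u n)).2.2 <= d & (proj1_sig (u n)).2.2 - (proj1_sig (u n)).2.1 < e].
  apply: (nested_bisection (s := fun n => (proj1_sig (u n)).2)).
    by move=> n; case: (u n) => s [].
  by move=> n /=; case: (Hnxt (u n)).
exists x, y => e e0; have [n1 Hn1] := Hx e e0; have [n2 Hn2] := Hy e e0.
pose n := maxn n1 n2.
have [h1 h2 h3 h4 h5] := Hn1 n (leq_maxl _ _).
have [k1 k2 k3 k4 k5] := Hn2 n (leq_maxr _ _).
case: (u n) h1 h2 h3 h4 h5 k1 k2 k3 k4 k5 => s [/= _ _ Ps] h1 h2 h3 h4 h5 k1 k2 k3 k4 k5.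
by exists s.1.1, s.1.2, s.2.1, s.2.2; split => //; apply/andP; split.
Qed.

End RealTools.

(** * Integrals along rectangles *)

Section Integrals.
Context {R : realType}.
Implicit Types (u v : R -> R) (f g : R[i] -> R[i]).
Local Notation mu := (@lebesgue_measure R).

Definition J (a b : R) (u : R -> R) : R := (\int[mu]_(x in `[a, b]) u x)%R.

Definition cts_on (a b : R) u := forall x, a <= x <= b -> {for x, continuous u}.

Lemma cts_within a b u : cts_on a b u -> {within `[a, b], continuous u}.
Proof.
move=> cu; apply/continuous_in_subspaceT => x; rewrite inE /= in_itv /=.
exact: cu.
Qed.

Lemma J_integrable a b u : cts_on a b u -> mu.-integrable `[a, b] (EFin \o u).
Proof.
by move=> /cts_within; apply: continuous_compact_integrable; exact: segment_compact.
Qed.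

Lemma JD a b u v : cts_on a b u -> cts_on a b v ->
  J a b (fun x => u x + v x) = J a b u + J a b v.
Proof. by move=> cu cv; rewrite /J RintegralD//; exact: J_integrable. Qed.

Lemma JZ a b k u : cts_on a b u -> J a b (fun x => k * u x) = k * J a b u.
Proof. by move=> cu; rewrite /J RintegralZl//; exact: J_integrable. Qed.

Lemma JN a b u : cts_on a b u -> J a b (fun x => - u x) = - J a b u.
Proof.
move=> cu; rewrite -mulN1r -JZ//; congr (J a b _).
by apply/funext => x; rewrite mulN1r.
Qed.

Lemma J_eq a b u v : (forall x, a <= x <= b -> u x = v x) -> J a b u = J a b v.
Proof.
move=> uv; apply: eq_Rintegral => x; rewrite inE /= in_itv /=; exact: uv.
Qed.

Lemma J_split a m b u : a <= m <= b -> cts_on a b u ->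
  J a b u = J a m u + J m b u.
Proof.
move=> /andP[am mb] cu.
have iu := J_integrable cu.
apply/eqP; rewrite addrC -subr_eq; apply/eqP.
rewrite /J Rintegral_itvB ?bnd_simp// Rintegral_itv_obnd_cbnd//.
apply: integrableS iu => //.
by apply: subset_itv; rewrite bnd_simp.
Qed.

Lemma J_cst a b k : a <= b -> J a b (fun=> k) = k * (b - a).
Proof.
move=> ab; rewrite /J Rintegral_cst//; congr (_ * _).
transitivity (fine (if a < b then (b - a)%:E else 0%E)).
  by congr fine; rewrite -lte_fin; exact: (lebesgue_measure_itv `[a, b]).
by move: ab; rewrite le_eqVlt => /predU1P[->|->//]; rewrite ltxx subrr.
Qed.

Lemma cts_cst a b (k : R) : cts_on a b (fun=> k).
Proof. by move=> x _; exact: cvg_cst. Qed.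

Lemma le_J a b u v : cts_on a b u -> cts_on a b v ->
  (forall x, a <= x <= b -> u x <= v x) -> J a b u <= J a b v.
Proof.
move=> cu cv uv; apply: le_Rintegral => //; try exact: J_integrable.
Qed.

Lemma J_bound a b u M : a <= b -> cts_on a b u ->
  (forall x, a <= x <= b -> `|u x| <= M) -> `|J a b u| <= M * (b - a).
Proof.
move=> ab cu uM; rewrite ler_norml -mulNr -!J_cst//; apply/andP; split;
  apply: le_J => //; try exact: cts_cst; move=> x xab.
  by have := uM x xab; rewrite ler_norml => /andP[].
by have := uM x xab; rewrite ler_norml => /andP[].
Qed.

Lemma J_FTC a b u (U : R -> R) : a <= b -> cts_on a b u ->
  (forall x, a <= x <= b -> is_derive x 1 U (u x)) -> J a b u = U b - U a.
Proof.
rewrite le_eqVlt => /predU1P[<-|ab] cu dU.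
  by rewrite /J set_itv1 Rintegral_set1 subrr.
have cU x : a <= x <= b -> {for x, continuous U}.
  by move=> /dU [dx _]; exact/differentiable_continuous/derivable1_diffP.
rewrite /J /Rintegral (@continuous_FTC2 _ _ U)//.
- exact: cts_within.
- split.
  + by move=> x; rewrite in_itv /= => /andP[/ltW ax /ltW xb]; apply: ex_derive; apply: dU; rewrite ax.
  + by apply: cvg_at_right_filter; apply: cU; rewrite lexx ltW.
  + by apply: cvg_at_left_filter; apply: cU; rewrite lexx ltW.
- move=> x; rewrite in_itv /= => /andP[/ltW ax /ltW xb].
  by rewrite derive1E; apply: derive_val; apply: dU; rewrite ax.
Qed.

Definition rcont (a b : R) (u : R -> R[i]) := forall x, a <= x <= b ->
  forall e : R, 0 < e -> exists2 d : R, 0 < d &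
    forall y, `|y - x| < d -> normc (u y - u x) < e.

Lemma rcont_Re a b (u : R -> R[i]) : rcont a b u -> cts_on a b (fun x => complex.Re (u x)).
Proof.
move=> cu x xab; apply: continuous_eps => e /(cu x xab)[d d0 Hd]; exists d => // y /Hd.
by rewrite -cReB; apply: le_lt_trans; exact: le_Re_normc.
Qed.

Lemma rcont_Im a b (u : R -> R[i]) : rcont a b u -> cts_on a b (fun x => complex.Im (u x)).
Proof.
move=> cu x xab; apply: continuous_eps => e /(cu x xab)[d d0 Hd]; exists d => // y /Hd.
by rewrite -cImB; apply: le_lt_trans; exact: le_Im_normc.
Qed.

Definition cint (a b : R) (u : R -> R[i]) : R[i] :=
  cplx (J a b (fun x => complex.Re (u x))) (J a b (fun x => complex.Im (u x))).

Lemma cint_eq a b (u v : R -> R[i]) : (forall x, a <= x <= b -> u x = v x) ->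
  cint a b u = cint a b v.
Proof. by move=> uv; congr Complex; apply: J_eq => x /uv ->. Qed.

Lemma cintD a b (u v : R -> R[i]) : rcont a b u -> rcont a b v ->
  cint a b (fun x => u x + v x) = cint a b u + cint a b v.
Proof.
move=> cu cv; apply: cplx_eq => /=; rewrite -JD;
  try exact: rcont_Re; try exact: rcont_Im; apply: J_eq => x _.
  exact: cReD.
exact: cImD.
Qed.

Lemma cts_Z a b k u : cts_on a b u -> cts_on a b (fun x => k * u x).
Proof. by move=> cu x /cu H; apply: cvgM => //; exact: cvg_cst. Qed.

Lemma cts_N a b u : cts_on a b u -> cts_on a b (fun x => - u x).
Proof.
have -> : (fun x => - u x) = (fun x => -1 * u x).
  by apply/funext => y; rewrite mulN1r.
exact: cts_Z.
Qed.

Lemma cintZ a b k (u : R -> R[i]) : rcont a b u ->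
  cint a b (fun x => k * u x) = k * cint a b u.
Proof.
move=> cu; have cR := rcont_Re cu; have cI := rcont_Im cu.
apply: cplx_eq; [rewrite [RHS]cReM|rewrite [RHS]cImM].
  rewrite [complex.Re (cint _ _ _)]/= [complex.Im (cint _ _ _)]/=.
  rewrite -(JZ _ cR) -(JZ _ cI) -JN; last exact: cts_Z.
  rewrite -JD; [|exact: cts_Z|by apply: cts_N; exact: cts_Z].
  by apply: J_eq => x _; exact: cReM.
rewrite [complex.Re (cint _ _ _)]/= [complex.Im (cint _ _ _)]/=.
rewrite -(JZ _ cR) -(JZ _ cI) -JD; [|exact: cts_Z|exact: cts_Z].
by apply: J_eq => x _; exact: cImM.
Qed.

Lemma cint_split a m b (u : R -> R[i]) : a <= m <= b -> rcont a b u ->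
  cint a b u = cint a m u + cint m b u.
Proof.
move=> amb cu; apply: cplx_eq => /=; apply: J_split => //.
  exact: rcont_Re.
exact: rcont_Im.
Qed.

Lemma cint_bound a b (u : R -> R[i]) M : a <= b -> rcont a b u ->
  (forall x, a <= x <= b -> normc (u x) <= M) ->
  normc (cint a b u) <= 2 * M * (b - a).
Proof.
move=> ab cu uM; apply: le_trans (le_normc_ReIm _) _ => /=.
have -> : 2 * M * (b - a) = M * (b - a) + M * (b - a) by ring.
apply: lerD; apply: J_bound => //; try exact: rcont_Re; try exact: rcont_Im.
  by move=> x xab; exact: le_trans (le_Re_normc _) (uM x xab).
by move=> x xab; exact: le_trans (le_Im_normc _) (uM x xab).
Qed.

(** The contour integral of f dz, counterclockwise; on the vertical sides dz is i dy, whence the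
    factors [cplx 0 1]. *)
Definition rint (a b c d : R) f : R[i] :=
  cint a b (fun x => f (cplx x c)) + cplx 0 1 * cint c d (fun y => f (cplx b y))
  - cint a b (fun x => f (cplx x d)) - cplx 0 1 * cint c d (fun y => f (cplx a y)).

Definition bd (a b c d : R) (z : R[i]) :=
  (a <= complex.Re z <= b /\ (complex.Im z = c \/ complex.Im z = d)) \/
  (c <= complex.Im z <= d /\ (complex.Re z = a \/ complex.Re z = b)).

Definition rect (a b c d : R) (z : R[i]) :=
  (a <= complex.Re z <= b) /\ (c <= complex.Im z <= d).

Lemma bd_rect a b c d z : a <= b -> c <= d -> bd a b c d z -> rect a b c d z.
Proof.
by move=> ab cd [[h1 [h2|h2]]|[h1 [h2|h2]]]; split=> //; rewrite h2; rewrite lexx ?ab ?cd.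
Qed.

Lemma bd_hc a b c d x : a <= x <= b -> bd a b c d (cplx x c).
Proof. by left; split => //; left. Qed.
Lemma bd_hd a b c d x : a <= x <= b -> bd a b c d (cplx x d).
Proof. by left; split => //; right. Qed.
Lemma bd_va a b c d y : c <= y <= d -> bd a b c d (cplx a y).
Proof. by right; split => //; left. Qed.
Lemma bd_vb a b c d y : c <= y <= d -> bd a b c d (cplx b y).
Proof. by right; split => //; right. Qed.

Lemma hline_cont a b c f : (forall x, a <= x <= b -> ccont f (cplx x c)) ->
  rcont a b (fun x => f (cplx x c)).
Proof.
move=> cf x /cf H e /H[d d0 Hd]; exists d => // y yx; apply: Hd.
have -> : cplx y c - cplx x c = ((y - x)%:C)%C.
  by apply: cplx_eq; rewrite ?cReB ?cImB //= subrr.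
by rewrite normc_real.
Qed.

Lemma vline_cont a c d f : (forall y, c <= y <= d -> ccont f (cplx a y)) ->
  rcont c d (fun y => f (cplx a y)).
Proof.
move=> cf x /cf H e /H[r r0 Hd]; exists r => // y yx; apply: Hd.
have -> : cplx a y - cplx a x = cplx 0 (y - x).
  by apply: cplx_eq; rewrite ?cReB ?cImB //= subrr.
by rewrite /= expr0n /= add0r sqrtr_sqr.
Qed.

Section OnBoundary.
Context (a b c d : R) (ab : a <= b) (cd : c <= d).

Definition bcont f := forall z, bd a b c d z -> ccont f z.

Lemma bcont_lines f : bcont f ->
  [/\ rcont a b (fun x => f (cplx x c)), rcont a b (fun x => f (cplx x d)),
      rcont c d (fun y => f (cplx a y)) & rcont c d (fun y => f (cplx b y))].
Proof.
move=> cf; split.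
- by apply: hline_cont => x xab; apply: cf; exact: bd_hc.
- by apply: hline_cont => x xab; apply: cf; exact: bd_hd.
- by apply: vline_cont => x xab; apply: cf; exact: bd_va.
- by apply: vline_cont => x xab; apply: cf; exact: bd_vb.
Qed.

Lemma rint_eq f g : (forall z, bd a b c d z -> f z = g z) ->
  rint a b c d f = rint a b c d g.
Proof.
move=> fg; rewrite /rint.
congr (_ + _ * _ - _ - _ * _); apply: cint_eq => x xab; apply: fg.
- exact: bd_hc.
- exact: bd_vb.
- exact: bd_hd.
- exact: bd_va.
Qed.

Lemma rintD f g : bcont f -> bcont g ->
  rint a b c d (fun z => f z + g z) = rint a b c d f + rint a b c d g.
Proof.
move=> /bcont_lines[? ? ? ?] /bcont_lines[? ? ? ?]; rewrite /rint.
by rewrite !cintD//; ring.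
Qed.

Lemma rintZ k f : bcont f -> rint a b c d (fun z => k * f z) = k * rint a b c d f.
Proof.
move=> /bcont_lines[? ? ? ?]; rewrite /rint.
by rewrite !cintZ//; ring.
Qed.

Lemma rintB f g : bcont f -> bcont g ->
  rint a b c d (fun z => f z - g z) = rint a b c d f - rint a b c d g.
Proof.
move=> cf cg; rewrite -mulN1r -rintZ// -rintD//; last first.
  by move=> z bz; apply: ccontM; [exact: ccont_cst|exact: cg].
by apply: rint_eq => z _; rewrite mulN1r.
Qed.

Lemma normc_i (z : R[i]) : normc (cplx 0 1 * z) = normc z.
Proof. by rewrite Normc.normcM /= expr0n expr1n add0r sqrtr1 mul1r. Qed.

(** Each side contributes 2M times its length, the 2 from bounding real and imaginary parts apart,
    and opposite sides are equal. *)
Lemma rint_bound f M : bcont f -> (forall z, bd a b c d z -> normc (f z) <= M) ->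
  normc (rint a b c d f) <= 4 * M * ((b - a) + (d - c)).
Proof.
move=> /bcont_lines[h1 h2 h3 h4] fM.
have B1 := cint_bound ab h1 (fun x xab => fM _ (bd_hc c d xab)).
have B2 := cint_bound ab h2 (fun x xab => fM _ (bd_hd c d xab)).
have B3 := cint_bound cd h3 (fun x xab => fM _ (bd_va a b xab)).
have B4 := cint_bound cd h4 (fun x xab => fM _ (bd_vb a b xab)).
rewrite /rint.
apply: le_trans (le_normcD _ _) _; rewrite normcN normc_i.
apply: le_trans (lerD (le_normcD _ _) (lexx _)) _; rewrite normcN.
apply: le_trans (lerD (lerD (le_normcD _ _) (lexx _)) (lexx _)) _; rewrite normc_i.
lra.
Qed.

End OnBoundary.

Lemma rint_vcut a m b c d f : a <= m <= b -> c <= d ->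
  bcont a b c d f -> (forall y, c <= y <= d -> ccont f (cplx m y)) ->
  rint a b c d f = rint a m c d f + rint m b c d f.
Proof.
move=> amb cd /bcont_lines[h1 h2 h3 h4] cm.
by rewrite /rint (cint_split amb h1) (cint_split amb h2); ring.
Qed.

Lemma rint_hcut a b c m d f : a <= b -> c <= m <= d ->
  bcont a b c d f -> (forall x, a <= x <= b -> ccont f (cplx x m)) ->
  rint a b c d f = rint a b c m f + rint a b m d f.
Proof.
move=> ab cmd /bcont_lines[h1 h2 h3 h4] cm.
by rewrite /rint (cint_split cmd h3) (cint_split cmd h4); ring.
Qed.

End Integrals.

(** * Goursat's theorem on rectangles *)

Section Goursat.
Context {R : realType}.
Implicit Types (f g : R[i] -> R[i]) (z w : R[i]).

Lemma J_id (a b : R) : a <= b -> J a b (fun x => x) = (b ^+ 2 - a ^+ 2) / 2.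
Proof.
move=> ab.
have H x : a <= x <= b -> is_derive x 1 (fun x : R => x ^+ 2 / 2) x.
  move=> _; apply: is_derive_eps => e e0; exists e => // y yx.
  have -> : y ^+ 2 / 2 - x ^+ 2 / 2 - x * (y - x) = (y - x) * (y - x) / 2 by field.
  rewrite !normrM [ `|2^-1|]gtr0_norm ?invr_gt0//.
  have := normr_ge0 (y - x); nra.
rewrite (J_FTC ab _ H); first by rewrite mulrBl.
by move=> x _; exact: cvg_id.
Qed.

Lemma rint_cst a b c d k : a <= b -> c <= d -> rint a b c d (fun=> k : R[i]) = 0.
Proof. by move=> ab cd; rewrite /rint; ring. Qed.

Lemma rint_id a b c d : a <= b -> c <= d -> rint a b c d (fun z : R[i] => z) = 0.
Proof.
move=> ab cd; rewrite /rint /cint /= !J_cst// !J_id//.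
by apply: cplx_eq; rewrite /= ?(cReD, cImD, cReN, cImN, cReM, cImM) /=; field.
Qed.

Lemma rint_affine a b c d p q : a <= b -> c <= d ->
  rint a b c d (fun z : R[i] => p + q * z) = 0.
Proof.
move=> ab cd; rewrite rintD//.
- rewrite rint_cst// rintZ ?rint_id ?mulr0 ?addr0//.
  by move=> z _; exact: ccont_id.
- by move=> z _; exact: ccont_cst.
- by move=> z _; apply: ccontM; [exact: ccont_cst|exact: ccont_id].
Qed.

Lemma rect_sub a b c d a' b' c' d' z : a <= a' -> b' <= b -> c <= c' -> d' <= d ->
  rect a' b' c' d' z -> rect a b c d z.
Proof.
move=> aa bb cc dd [/andP[h1 h2] /andP[h3 h4]]; split; apply/andP; split; lra.
Qed.

Lemma holo_bcont (a b c d : R) f : a <= b -> c <= d ->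
  (forall z, rect a b c d z -> exists l, cdiff f z l) -> bcont a b c d f.
Proof. by move=> ab cd df z /(bd_rect ab cd)/df[l]; exact: cdiff_ccont. Qed.

(** If the bound failed for a rectangle of half-perimeter s, it would fail for a quarter, since e
    s^2 = 4 e (s/2)^2 and the four integrals add up to the whole. The nested quarters then
    contradict differentiability at their limit point. *)
Lemma goursat_small (e a b c d : R) f : 0 < e -> a <= b -> c <= d ->
  (forall z, rect a b c d z -> exists l, cdiff f z l) ->
  0 < (b - a) + (d - c) ->
  normc (rint a b c d f) < e * ((b - a) + (d - c)) ^+ 2.
Proof.
move=> e0 ab cd df s0; rewrite ltNge; apply/negP => big.
pose P a' b' c' d' := [/\ a <= a' <= b', b' <= b, c <= c' <= d', d' <= d &
  0 < (b' - a') + (d' - c') /\ e * ((b' - a') + (d' - c')) ^+ 2 <= normc (rint a' b' c' d' f)].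
have hol a' b' c' d' : a <= a' -> b' <= b -> c <= c' -> d' <= d ->
    forall z, rect a' b' c' d' z -> exists l, cdiff f z l.
  by move=> aa bb cc dd z /(rect_sub aa bb cc dd)/df.
have step a' b' c' d' : a' <= b' -> c' <= d' -> P a' b' c' d' ->
     let m := (a' + b') / 2 in let n := (c' + d') / 2 in
     [\/ P a' m c' n, P m b' c' n, P a' m n d' | P m b' n d'].
  move=> ab' cd' [/andP[aa _] bb /andP[cc _] dd [s'0 big']] m n.
  have [am mb] : a' <= m /\ m <= b' by rewrite /m; split; lra.
  have [cn nd] : c' <= n /\ n <= d' by rewrite /n; split; lra.
  have E : rint a' b' c' d' f = rint a' m c' n f + rint m b' c' n f +
      (rint a' m n d' f + rint m b' n d' f).
    have ccf x y : a' <= x <= b' -> c' <= y <= d' -> ccont f (cplx x y).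
      move=> /andP[? ?] /andP[? ?].
      have [|l] := @hol a' b' c' d' aa bb cc dd (cplx x y); last exact: cdiff_ccont.
      by split => /=; apply/andP; split.
    rewrite (@rint_hcut _ a' b' c' n d')//; last 3 first.
    - by rewrite cn nd.
    - by apply: holo_bcont => //; exact: hol.
    - by move=> x xab; apply: ccf => //; rewrite cn nd.
    rewrite (@rint_vcut _ a' m b' c' n)//; last 3 first.
    - by rewrite am mb.
    - by apply: holo_bcont => //; apply: hol => //; lra.
    - by move=> y /andP[y1 y2]; apply: ccf => //; [rewrite am mb|rewrite y1 (le_trans y2 nd)].
    rewrite (@rint_vcut _ a' m b' n d')//.
    - by rewrite am mb.
    - by apply: holo_bcont => //; apply: hol => //; lra.
    - by move=> y /andP[y1 y2]; apply: ccf => //; [rewrite am mb|rewrite (le_trans cn y1) y2].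
  set s := (b' - a') + (d' - c') in s'0 big'.
  have sm1 : (m - a') + (n - c') = s / 2 by rewrite /m /n /s; field.
  have sm2 : (b' - m) + (n - c') = s / 2 by rewrite /m /n /s; field.
  have sm3 : (m - a') + (d' - n) = s / 2 by rewrite /m /n /s; field.
  have sm4 : (b' - m) + (d' - n) = s / 2 by rewrite /m /n /s; field.
  have s20 : 0 < s / 2 by lra.
  have [H1|H1] := leP (e * (s / 2) ^+ 2) (normc (rint a' m c' n f)).
    by constructor 1; rewrite /P sm1; split; rewrite ?aa ?am ?cc ?cn//; lra.
  have [H2|H2] := leP (e * (s / 2) ^+ 2) (normc (rint m b' c' n f)).
    by constructor 2; rewrite /P sm2; split; rewrite ?mb ?cc ?cn//; lra.
  have [H3|H3] := leP (e * (s / 2) ^+ 2) (normc (rint a' m n d' f)).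
    by constructor 3; rewrite /P sm3; split; rewrite ?aa ?am ?nd//; lra.
  have [H4|H4] := leP (e * (s / 2) ^+ 2) (normc (rint m b' n d' f)).
    by constructor 4; rewrite /P sm4; split; rewrite ?mb ?nd//; lra.
  exfalso; move: big'; rewrite E => big'.
  have := le_normcD (rint a' m c' n f + rint m b' c' n f) (rint a' m n d' f + rint m b' n d' f).
  have := le_normcD (rint a' m c' n f) (rint m b' c' n f).
  have := le_normcD (rint a' m n d' f) (rint m b' n d' f).
  have es : e * s ^+ 2 = 4 * (e * (s / 2) ^+ 2) by field.
  lra.
have P0 : P a b c d by rewrite /P !lexx ab cd; split.
have [x [y Hxy]] := bisection2 step ab cd P0.
have rz : rect a b c d (cplx x y).
  have [a' [b' [c' [d' [/andP[? ?] /andP[? ?] /andP[? ?] /andP[? ?] _]]]]] := Hxy 1 ltr01.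
  by split => /=; apply/andP; split; lra.
have [l /cdiffP Hl] := df _ rz.
(* Near the limit point [f] differs from an affine map, whose integral is 0, by at most e/16 times
   the half-perimeter s; the boundary estimate gives e s^2 / 4, below the e s^2 that the nested
   rectangles retain. *)
have e160 : 0 < e / 16 by lra.
have [r r0 Hr] := Hl _ e160.
have r20 : 0 < r / 2 by lra.
have [a' [b' [c' [d' [/andP[aa ax] /andP[xb bb] /andP[cc cy] /andP[yd dd] [wb wd]]]]]] := Hxy _ r20.
move=> [_ _ _ _ [s'0 big']].
have ab' : a' <= b' by lra.
have cd' : c' <= d' by lra.
set s := (b' - a') + (d' - c') in s'0 big'.
set z0 := cplx x y in Hr.
have bf : bcont a' b' c' d' f by apply: holo_bcont => //; exact: hol.
have baff : bcont a' b' c' d' (fun z => (f z0 - l * z0) + l * z).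
  move=> z _; apply: ccontD; first exact: ccont_cst.
  by apply: ccontM; [exact: ccont_cst|exact: ccont_id].
have E : rint a' b' c' d' f = rint a' b' c' d' (fun z => f z - ((f z0 - l * z0) + l * z)).
  by rewrite rintB// rint_affine// subr0.
have bnd : forall z, bd a' b' c' d' z -> normc (f z - ((f z0 - l * z0) + l * z)) <= e / 16 * s.
  move=> z /(bd_rect ab' cd') [/andP[h1 h2] /andP[h3 h4]].
  have nz : normc (z - z0) <= s.
    apply: le_trans (le_normc_ReIm _) _; rewrite cReB cImB /=.
    by apply: lerD; rewrite ler_norml; apply/andP; split; lra.
  have -> : f z - ((f z0 - l * z0) + l * z) = f z - f z0 - l * (z - z0) by ring.
  apply: le_trans (Hr _ _) _; first by apply: le_lt_trans nz _; rewrite /s; lra.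
  by rewrite ler_wpM2l// ltW.
have := rint_bound ab' cd' _ bnd; rewrite -E -/s.
move=> /(_ _) B.
have {}B : normc (rint a' b' c' d' f) <= 4 * (e / 16 * s) * s.
  by apply: B => z bz; apply: ccontB; [exact: bf|exact: baff].
have es2 : 0 < e * s ^+ 2 by rewrite mulr_gt0// exprn_gt0.
move: B big' es2; rewrite expr2; lra.
Qed.

Lemma goursat a b c d f : a <= b -> c <= d ->
  (forall z, rect a b c d z -> exists l, cdiff f z l) -> rint a b c d f = 0.
Proof.
move=> ab cd df; apply/eqP; rewrite -normc_eq0 eq_le normc_ge0 andbT.
have [s0|s0] := ltP 0 ((b - a) + (d - c)); last first.
  have E1 : b = a by lra.
  have E2 : d = c by lra.
  by rewrite E1 E2 /rint (_ : _ - _ = 0) ?Normc.normc0//; ring.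
apply/ler_addgt0Pr => e e0; rewrite add0r; set s := (b - a) + (d - c) in s0 *.
have s20 : 0 < s ^+ 2 by rewrite exprn_gt0.
have := goursat_small (divr_gt0 e0 s20) ab cd df s0.
by rewrite -/s divfK ?gt_eqF// => /ltW.
Qed.

End Goursat.

(** * Cauchy's formula up to the kernel integral *)

Section Cauchy.
Context {R : realType}.
Implicit Types (f g : R[i] -> R[i]) (z w : R[i]).

Definition inside (a b c d : R) w :=
  (a < complex.Re w < b) /\ (c < complex.Im w < d).

Lemma inside_bd (a b c d : R) w z : inside a b c d w -> bd a b c d z -> z != w.
Proof.
move=> [/andP[h1 h2] /andP[h3 h4]] bz; apply/eqP => zw; subst z.
by case: bz => -[_ [H|H]]; move: h1 h2 h3 h4; rewrite H; lra.
Qed.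

Lemma inside_le (a b c d : R) w : inside a b c d w -> a <= b /\ c <= d.
Proof. by move=> [/andP[h1 h2] /andP[h3 h4]]; split; lra. Qed.

(** Two vertical and two horizontal cuts leave four rectangles that miss [w], and Goursat's theorem
    kills the integral over each of them. *)
Lemma rint_shrink (a b c d s : R) w f : 0 < s ->
  a <= complex.Re w - s -> complex.Re w + s <= b ->
  c <= complex.Im w - s -> complex.Im w + s <= d ->
  (forall z, rect a b c d z -> z != w -> exists l, cdiff f z l) ->
  rint a b c d f = rint (complex.Re w - s) (complex.Re w + s)
                        (complex.Im w - s) (complex.Im w + s) f.
Proof.
move: w => [x y] /= s0 ax xb cy yd df.
have hol a' b' c' d' : a' <= b' -> c' <= d' -> a <= a' -> b' <= b -> c <= c' -> d' <= d ->
    (b' < x) || (x < a') || (d' < y) || (y < c') -> rint a' b' c' d' f = 0.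
  move=> ab' cd' aa bb cc dd out; apply: goursat => // z rz; apply: df.
    exact: rect_sub rz.
  apply/eqP => zw; subst z; move: rz => [/= /andP[h1 h2] /andP[h3 h4]].
  by case/orP: out => [/orP[/orP[]|]|]; lra.
have ccf z : rect a b c d z -> z != cplx x y -> ccont f z.
  by move=> rz /(df _ rz)[l]; exact: cdiff_ccont.
have bcf a' b' c' d' : a <= a' -> b' <= b -> c <= c' -> d' <= d ->
  a' < x < b' -> c' < y < d' -> bcont a' b' c' d' f.
  move=> aa bb cc dd xab ycd z bz; apply: ccf.
    apply: (@rect_sub _ a b c d a' b' c' d') => //.
    by apply: bd_rect bz; case/andP: xab; case/andP: ycd; lra.
  by apply: inside_bd bz; split.
have vc m y' : a <= m <= b -> c <= y' <= d -> m != x -> ccont f (cplx m y').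
  move=> mab yab mx; apply: ccf => //.
  by apply: contra_neq mx => -[].
have hc m y' : a <= m <= b -> c <= y' <= d -> y' != y -> ccont f (cplx m y').
  move=> mab yab mx; apply: ccf => //.
  by apply: contra_neq mx => -[].
have e1 : rint a (x - s) c d f = 0 by apply: hol; [lra..|rewrite gtrBl s0].
have e2 : rint (x + s) b c d f = 0 by apply: hol; [lra..|rewrite ltrDl s0 orbT].
have e3 : rint (x - s) (x + s) c (y - s) f = 0.
  by apply: hol; [lra..|rewrite gtrBl s0 !orbT].
have e4 : rint (x - s) (x + s) (y + s) d f = 0.
  by apply: hol; [lra..|apply/orP; right; lra].
rewrite (@rint_vcut _ a (x - s) b)//; first last.
- by move=> y' hy'; apply: vc => //; [lra|rewrite lt_eqF//; lra].
- by apply: bcf; lra.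
- lra.
- lra.
rewrite e1 add0r (@rint_vcut _ (x - s) (x + s) b)//; first last.
- by move=> y' hy'; apply: vc => //; [lra|rewrite gt_eqF//; lra].
- by apply: bcf; lra.
- lra.
- lra.
rewrite e2 addr0 (@rint_hcut _ (x - s) (x + s) c (y - s) d)//; first last.
- by move=> x' hx'; apply: hc => //; [lra|lra|rewrite lt_eqF//; lra].
- by apply: bcf; lra.
- lra.
- lra.
rewrite e3 add0r (@rint_hcut _ (x - s) (x + s) (y - s) (y + s) d)//; first last.
- by move=> x' hx'; apply: hc => //; [lra|lra|rewrite gt_eqF//; lra].
- by apply: bcf; lra.
- lra.
- lra.
by rewrite e4 addr0.
Qed.

Lemma inside_margin (a b c d : R) w : inside a b c d w -> exists2 m, 0 < m &
  [/\ a + m <= complex.Re w, complex.Re w + m <= b,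
      c + m <= complex.Im w & complex.Im w + m <= d].
Proof.
case: w => x y [/= /andP[h1 h2] /andP[h3 h4]].
exists (Num.min (Num.min (x - a) (b - x)) (Num.min (y - c) (d - y))).
  by rewrite !lt_min !subr_gt0 h1 h2 h3 h4.
set m := Num.min _ _.
have : m <= m by []. rewrite {2}/m !le_min => /andP[/andP[? ?] /andP[? ?]].
by split; lra.
Qed.

Lemma margin_bd (a b c d m : R) w z : 0 < m ->
  a + m <= complex.Re w -> complex.Re w + m <= b ->
  c + m <= complex.Im w -> complex.Im w + m <= d -> bd a b c d z ->
  m <= normc (z - w).
Proof.
move=> m0 h1 h2 h3 h4 [[_ [E|E]]|[_ [E|E]]].
- by apply: le_trans (le_Im_normc _); rewrite cImB E ler0_norm; lra.
- by apply: le_trans (le_Im_normc _); rewrite cImB E ger0_norm; lra.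
- by apply: le_trans (le_Re_normc _); rewrite cReB E ler0_norm; lra.
- by apply: le_trans (le_Re_normc _); rewrite cReB E ger0_norm; lra.
Qed.

Lemma ccont_kernel w z n : z != w -> ccont (fun z => ((z - w) ^+ n)^-1) z.
Proof.
move=> zw; apply: ccontV; first by rewrite expf_neq0// subr_eq0.
by apply: ccontX; apply: ccontB; [exact: ccont_id|exact: ccont_cst].
Qed.

Lemma ccont_kernel1 w z : z != w -> ccont (fun z => (z - w)^-1) z.
Proof.
move=> zw; apply: ccontV; first by rewrite subr_eq0.
by apply: ccontB; [exact: ccont_id|exact: ccont_cst].
Qed.

(** Mere continuity at [w] is assumed because [cauchy_deriv] applies this to a difference quotient.
    It suffices: on small squares around [w] the integral of (g z - g w)/(z - w) is small. *)
Lemma cauchy_formula (a b c d : R) w g : inside a b c d w -> ccont g w ->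
  (forall z, rect a b c d z -> z != w -> exists l, cdiff g z l) ->
  rint a b c d (fun z => g z * (z - w)^-1) = g w * rint a b c d (fun z => (z - w)^-1).
Proof.
move=> iw cg dg; have [ab cd] := inside_le iw.
have [m m0 [am mb cm md]] := inside_margin iw.
have dq z : rect a b c d z -> z != w -> exists l, cdiff (fun z => (g z - g w) * (z - w)^-1) z l.
  move=> rz zw; have [l dl] := dg z rz zw.
  have d1 := cdiffB dl (cdiff_cst (g w) z).
  have d2 := cdiffB (cdiff_id z) (cdiff_cst w z).
  have zw0 : z - w != 0 by rewrite subr_eq0.
  by eexists; exact: (cdiffM d1 (@cdiffV _ (fun z => z - w) _ _ zw0 d2)).
have bq : bcont a b c d (fun z => (g z - g w) * (z - w)^-1).
  move=> z bz; have [l] := dq z (bd_rect ab cd bz) (inside_bd iw bz); exact: cdiff_ccont.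
have bk : bcont a b c d (fun z => (z - w)^-1).
  by move=> z bz; apply: ccont_kernel1; exact: inside_bd bz.
have bc : bcont a b c d (fun z => g w * (z - w)^-1).
  by move=> z bz; apply: ccontM; [exact: ccont_cst|exact: bk].
suff E : rint a b c d (fun z => (g z - g w) * (z - w)^-1) = 0.
  rewrite -rintZ// -[RHS]add0r -E -rintD//; apply: rint_eq => z _; ring.
apply/eqP; rewrite -normc_eq0 eq_le normc_ge0 andbT.
apply/ler_addgt0Pr => e e0; rewrite add0r.
have e160 : 0 < e / 16 by lra.
have [r r0 Hr] := cg _ e160.
(* [s <= m] keeps the square inside the rectangle, [s <= r / 3] keeps it within distance 2s < r of
   [w]; its boundary is at distance at least s from [w]. *)
pose s := Num.min m (r / 3).
have s0 : 0 < s by rewrite lt_min m0; lra.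
have sm : s <= m by rewrite ge_min lexx.
have sr : s <= r / 3 by rewrite ge_min lexx orbT.
rewrite (@rint_shrink a b c d s w)//; try lra.
set a' := _ - s; set b' := _ + s; set c' := _ - s; set d' := _ + s.
have ab' : a' <= b' by rewrite /a' /b'; lra.
have cd' : c' <= d' by rewrite /c' /d'; lra.
have sub z : rect a' b' c' d' z -> rect a b c d z.
  by apply: rect_sub; rewrite /a' /b' /c' /d'; lra.
have iw' : inside a' b' c' d' w by split; rewrite /a' /b' /c' /d'; lra.
have bq' : bcont a' b' c' d' (fun z => (g z - g w) * (z - w)^-1).
  move=> z bz; have [l] := dq z (sub _ (bd_rect ab' cd' bz)) (inside_bd iw' bz).
  exact: cdiff_ccont.
have bnd z : bd a' b' c' d' z -> normc ((g z - g w) * (z - w)^-1) <= e / 16 / s.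
  move=> bz; have sz : s <= normc (z - w).
    by apply: margin_bd bz; rewrite /a' /b' /c' /d'; lra.
  have zr : normc (z - w) < r.
    move: (bd_rect ab' cd' bz); rewrite /rect /a' /b' /c' /d' => -[/andP[? ?] /andP[? ?]].
    apply: le_lt_trans (_ : s + s < _); last by lra.
    apply: le_trans (le_normc_ReIm _) _; rewrite cReB cImB.
    by apply: lerD; rewrite ler_norml; apply/andP; split; lra.
  rewrite Normc.normcM Normc.normcV ler_pM ?invr_ge0 ?normc_ge0//.
    exact/ltW/Hr.
  by rewrite lef_pV2 ?posrE//; apply: lt_le_trans sz.
have := rint_bound ab' cd' bq' bnd.
have -> : 4 * (e / 16 / s) * (b' - a' + (d' - c')) = e.
  by rewrite /a' /b' /c' /d'; field; rewrite gt_eqF.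
by [].
Qed.

(** The imaginary part of dz/(z - w) is the change of argument: on each side it is the distance from
    [w] to that side divided by |z - w|^2, at least m/S. There are four sides, each of length at
    least 2m. *)
Lemma kernel_lower (a b c d m S : R) w : 0 < m ->
  a + m <= complex.Re w -> complex.Re w + m <= b ->
  c + m <= complex.Im w -> complex.Im w + m <= d ->
  (forall z, bd a b c d z -> normc (z - w) ^+ 2 <= S) ->
  8 * m ^+ 2 / S <= complex.Im (rint a b c d (fun z => (z - w)^-1)).
Proof.
move: w => [x y] m0 ax xb cy yd HS; simpl in ax, xb, cy, yd.
have iw : inside a b c d (cplx x y) by split => /=; lra.
have [ab cd] := inside_le iw.
have bk : bcont a b c d (fun z => (z - cplx x y)^-1).
  by move=> z bz; apply: ccont_kernel1; exact: inside_bd bz.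
have [/rcont_Im h1 /rcont_Im h2 /rcont_Re h3 /rcont_Re h4] := bcont_lines bk.
have n2 z : bd a b c d z -> 0 < normc (z - cplx x y) ^+ 2.
  by move=> bz; rewrite exprn_gt0// normc_gt0 subr_eq0; exact: inside_bd bz.
have S0 : 0 < S.
  have bz := bd_hc c d (_ : a <= a <= b); rewrite lexx ab in bz.
  by apply: lt_le_trans (n2 _ (bz isT)) (HS _ (bz isT)).
have ReV (u v : R) : complex.Re (cplx u v)^-1 = u / normc (cplx u v) ^+ 2.
  by rewrite normc_sqr.
have ImV (u v : R) : complex.Im (cplx u v)^-1 = - v / normc (cplx u v) ^+ 2.
  by rewrite normc_sqr /= mulNr.
have sub (u v : R) : cplx u v - cplx x y = cplx (u - x) (v - y) by [].
have low (u v k : R) : bd a b c d (cplx u v) -> m <= k ->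
    m / S <= k / normc (cplx u v - cplx x y) ^+ 2.
  move=> bz mk; apply: ler_pM; rewrite ?invr_ge0 ?(ltW m0) ?(ltW S0)//.
  by rewrite lef_pV2 ?posrE ?n2// HS.
rewrite /rint cImB cImB cImD.
have ImI z : complex.Im (cplx 0 1 * z) = complex.Re z by case: z => p q /=; ring.
rewrite !ImI /=.
have J1 : m / S * (b - a) <= J a b (fun t => complex.Im (cplx t c - cplx x y)^-1).
  rewrite -J_cst//; apply: le_J => //; first exact: cts_cst.
  move=> t tab; rewrite sub ImV -sub; apply: low; first exact: bd_hc.
  by rewrite opprB; lra.
have J2 : m / S * (d - c) <= J c d (fun t => complex.Re (cplx b t - cplx x y)^-1).
  rewrite -J_cst//; apply: le_J => //; first exact: cts_cst.
  by move=> t tab; rewrite sub ReV -sub; apply: low; [exact: bd_vb|lra].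
have J3 : J a b (fun t => complex.Im (cplx t d - cplx x y)^-1) <= - (m / S) * (b - a).
  rewrite -J_cst//; apply: le_J => //; first exact: cts_cst.
  move=> t tab; rewrite sub ImV -sub mulNr lerN2; apply: low; first exact: bd_hd.
  by lra.
have J4 : J c d (fun t => complex.Re (cplx a t - cplx x y)^-1) <= - (m / S) * (d - c).
  rewrite -J_cst//; apply: le_J => //; first exact: cts_cst.
  move=> t tab; rewrite sub ReV -sub -[a - x]opprB mulNr lerN2.
  by apply: low; [exact: bd_va|lra].
have mS : 0 < m / S by rewrite divr_gt0.
have -> : 8 * m ^+ 2 / S = m / S * (8 * m) by field; rewrite gt_eqF.
move: J1 J2 J3 J4; set q := m / S in mS *.
set j1 := J _ _ _; set j2 := J _ _ _; set j3 := J _ _ _; set j4 := J _ _ _.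
have : q * (2 * m) <= q * (b - a) by rewrite ler_pM2l//; lra.
have : q * (2 * m) <= q * (d - c) by rewrite ler_pM2l//; lra.
rewrite !mulNr; lra.
Qed.

Lemma kernel_neq0 (a b c d : R) w : inside a b c d w ->
  rint a b c d (fun z => (z - w)^-1) != 0.
Proof.
move=> iw; have [ab cd] := inside_le iw; have [m m0 [am mb cm md]] := inside_margin iw.
have := @kernel_lower a b c d m (((b - a) + (d - c)) ^+ 2) w m0 am mb cm md.
move=> /(_ _) H; have {}H := H _.
apply/eqP => E; rewrite E /= in H.
have : 8 * m ^+ 2 / (b - a + (d - c)) ^+ 2 <= 0.
  apply: H => z bz; rewrite ler_pXn2r ?nnegrE ?normc_ge0//; last lra.
  apply: le_trans (le_normc_ReIm _) _; rewrite cReB cImB.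
  move: (bd_rect ab cd bz) => -[/andP[? ?] /andP[? ?]].
  by apply: lerD; rewrite ler_norml; apply/andP; split; lra.
have s0 : 0 < b - a + (d - c) by lra.
by rewrite leNgt divr_gt0 ?mulr_gt0 ?exprn_gt0.
Qed.

(** This is Cauchy's formula for the difference quotient of [f] at [w], which is continuous there
    with value [g w]. *)
Lemma cauchy_deriv (a b c d : R) w f g : inside a b c d w ->
  (forall z, rect a b c d z -> cdiff f z (g z)) ->
  rint a b c d (fun z => (f z - f w) * ((z - w) ^+ 2)^-1) =
    g w * rint a b c d (fun z => (z - w)^-1).
Proof.
move=> iw df; have [ab cd] := inside_le iw.
have rw : rect a b c d w by case: iw => /andP[? ?] /andP[? ?]; split; apply/andP; split; exact: ltW.
have [q [qE cq qw]] := df _ rw.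
rewrite -qw -cauchy_formula//.
  apply: rint_eq => z bz; rewrite qE; have zw := inside_bd iw bz.
  by field; rewrite subr_eq0.
move=> z rz zw; have d1 := cdiffB (df z rz) (cdiff_cst (f w) z).
have d2 := cdiffB (cdiff_id z) (cdiff_cst w z).
have zw0 : z - w != 0 by rewrite subr_eq0.
have d3 := cdiffM d1 (@cdiffV _ (fun z => z - w) _ _ zw0 d2).
eexists; apply: (cdiff_near _ d3).
exists (normc (z - w)); first by rewrite normc_gt0.
move=> u uz; rewrite qE mulfK// subr_eq0.
by apply: contraTneq uz => ->; rewrite normcB ltxx.
Qed.

End Cauchy.

(** * Holomorphy of derivatives and Cauchy estimates *)

Section CauchyDeriv.
Context {R : realType}.
Implicit Types (f g : R[i] -> R[i]) (z w : R[i]).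

Lemma normc_nat n : normc (n%:R : R[i]) = n%:R.
Proof. by rewrite normcMn Normc.normc1. Qed.

(** A function unbounded on a rectangle is unbounded on one of its quarters, which continuity at the
    limit point of the quarters excludes. *)
Lemma rect_bounded (a b c d : R) f : a <= b -> c <= d ->
  (forall z, rect a b c d z -> ccont f z) ->
  exists M, forall z, rect a b c d z -> normc (f z) <= M.
Proof.
move=> ab cd cf; apply: contrapT => nb.
pose P a' b' c' d' := ~ exists M, forall z, rect a b c d z -> rect a' b' c' d' z -> normc (f z) <= M.
have step a' b' c' d' : a' <= b' -> c' <= d' -> P a' b' c' d' ->
     let m := (a' + b') / 2 in let n := (c' + d') / 2 in
     [\/ P a' m c' n, P m b' c' n, P a' m n d' | P m b' n d'].
  move=> ab' cd' nP m n; apply: contrapT => H; apply: nP.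
  have [M1 H1] : exists M, forall z, rect a b c d z -> rect a' m c' n z -> normc (f z) <= M.
    by apply: contrapT => K; apply: H; constructor 1.
  have [M2 H2] : exists M, forall z, rect a b c d z -> rect m b' c' n z -> normc (f z) <= M.
    by apply: contrapT => K; apply: H; constructor 2.
  have [M3 H3] : exists M, forall z, rect a b c d z -> rect a' m n d' z -> normc (f z) <= M.
    by apply: contrapT => K; apply: H; constructor 3.
  have [M4 H4] : exists M, forall z, rect a b c d z -> rect m b' n d' z -> normc (f z) <= M.
    by apply: contrapT => K; apply: H; constructor 4.
  exists (Num.max (Num.max M1 M2) (Num.max M3 M4)) => z rz [/andP[h1 h2] /andP[h3 h4]].
  rewrite !le_max.
  have [xm|xm] := leP (complex.Re z) m; have [yn|yn] := leP (complex.Im z) n.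
  - by rewrite H1//; split; apply/andP; split.
  - by rewrite H3 ?orbT//; split; apply/andP; split => //; exact: ltW.
  - by rewrite H2 ?orbT//; split; apply/andP; split => //; exact: ltW.
  - by rewrite H4 ?orbT//; split; apply/andP; split => //; exact: ltW.
have P0 : P a b c d by move=> [M HM]; apply: nb; exists M => z rz; exact: HM.
have [x [y Hxy]] := bisection2 step ab cd P0.
have rz : rect a b c d (cplx x y).
  have [a' [b' [c' [d' [/andP[? ?] /andP[? ?] /andP[? ?] /andP[? ?] _]]]]] := Hxy 1 ltr01.
  by split => /=; apply/andP; split; lra.
have [r r0 Hr] := cf _ rz _ ltr01.
have r20 : 0 < r / 2 by lra.
have [a' [b' [c' [d' [/andP[? ?] /andP[? ?] /andP[? ?] /andP[? ?] [? ? nP]]]]]] := Hxy _ r20.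
apply: nP; exists (normc (f (cplx x y)) + 1) => z _ [/andP[? ?] /andP[? ?]].
have nz : normc (z - cplx x y) < r.
  apply: le_lt_trans (le_normc_ReIm _) _; rewrite cReB cImB /=.
  apply: lt_le_trans (_ : r / 2 + r / 2 <= _); last by lra.
  by apply: ltrD; rewrite ltr_norml; apply/andP; split; lra.
rewrite -lerBlDl; apply: le_trans (normc_sub_le _ _) _; exact/ltW/Hr.
Qed.

(** Differentiation under the integral sign: a remainder quadratic in h, uniform along the boundary,
    survives integration with a constant factor. *)
Lemma rint_param_diff (a b c d : R) w F (K : R[i] -> R[i] -> R[i]) (K' : R[i] -> R[i])
  (d0 B M : R) : a <= b -> c <= d -> 0 < d0 -> 0 <= B -> 0 <= M ->
  (forall z, bd a b c d z -> normc (F z) <= M) ->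
  (forall z h, bd a b c d z -> normc h < d0 ->
     normc (K z (w + h) - K z w - K' z * h) <= B * normc h ^+ 2) ->
  (forall v, normc (v - w) < d0 -> bcont a b c d (fun z => F z * K z v)) ->
  bcont a b c d (fun z => F z * K' z) ->
  cdiff (fun v => rint a b c d (fun z => F z * K z v)) w (rint a b c d (fun z => F z * K' z)).
Proof.
move=> ab cd d00 B0 M0 FM KB bK bK'; apply/cdiffP => e e0.
pose p := (b - a) + (d - c); have p0 : 0 <= p by rewrite /p; lra.
pose D := 4 * M * B * p + 1.
have MBp : 0 <= 4 * M * B * p by rewrite !mulr_ge0.
have D0 : 0 < D by rewrite /D; lra.
exists (Num.min d0 (e / D)); first by rewrite lt_min d00 divr_gt0.
move=> v; rewrite lt_min => /andP[vd vD].
have ww : normc (w - w) < d0 by rewrite subrr Normc.normc0.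
have bv := bK v vd; have bw := bK w ww.
have bh : bcont a b c d (fun z => (v - w) * (F z * K' z)).
  by move=> z bz; apply: ccontM; [exact: ccont_cst|exact: bK'].
have bvw : bcont a b c d (fun z => F z * K z v - F z * K z w).
  by move=> z bz; apply: ccontB; [exact: bv|exact: bw].
rewrite (mulrC _ (v - w)) -rintB// -rintZ// -rintB//.
have bnd z : bd a b c d z ->
    normc (F z * K z v - F z * K z w - (v - w) * (F z * K' z)) <= M * (B * normc (v - w) ^+ 2).
  move=> bz; have -> : F z * K z v - F z * K z w - (v - w) * (F z * K' z) =
     F z * (K z (w + (v - w)) - K z w - K' z * (v - w)).
    by rewrite (addrC w) subrK; ring.
  rewrite Normc.normcM; apply: ler_pM; rewrite ?normc_ge0//; [exact: FM|exact: KB].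
have := rint_bound ab cd _ bnd; rewrite -/p => /(_ _) H.
apply: le_trans (H _) _.
  by move=> z bz; apply: ccontB; [exact: bvw|exact: bh].
have n0 := normc_ge0 (v - w).
rewrite ltr_pdivlMr// in vD.
have -> : 4 * (M * (B * normc (v - w) ^+ 2)) * p = normc (v - w) * (4 * M * B * p) * normc (v - w).
  by ring.
rewrite ler_wpM2r//; apply: le_trans (ltW vD); rewrite ler_wpM2l// /D; lra.
Qed.

Lemma near_inside (a b c d : R) w : inside a b c d w -> exists2 m, 0 < m &
  forall v, normc (v - w) < m -> inside a b c d v.
Proof.
move=> iw; have [m m0 [? ? ? ?]] := inside_margin iw; exists m => // v vw.
have := le_lt_trans (le_Re_normc _) vw; have := le_lt_trans (le_Im_normc _) vw.
rewrite cReB cImB !ltr_norml => /andP[? ?] /andP[? ?].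
by split; apply/andP; split; lra.
Qed.

Lemma kernel_int_diff1 (a b c d : R) w F : inside a b c d w ->
  (forall z, rect a b c d z -> ccont F z) ->
  exists l, cdiff (fun v => rint a b c d (fun z => F z * (z - v)^-1)) w l.
Proof.
move=> iw cF; have [ab cd] := inside_le iw; have [m m0 [? ? ? ?]] := inside_margin iw.
have [M HM] := rect_bounded ab cd cF.
have FM z : bd a b c d z -> normc (F z) <= `|M|.
  by move=> /(bd_rect ab cd)/HM H; apply: le_trans H (ler_norm _).
have [r r0 Hr] := near_inside iw.
exists (rint a b c d (fun z => F z * ((z - w) ^+ 2)^-1)).
have m20 : 0 < Num.min r (m / 2) by rewrite lt_min r0; lra.
apply: (@rint_param_diff a b c d w F (fun z v => (z - v)^-1) (fun z => ((z - w) ^+ 2)^-1)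
  (Num.min r (m / 2)) (2 / m ^+ 3) `|M|) => //.
- by rewrite divr_ge0// exprn_ge0// ltW.
- move=> z h bz; rewrite lt_min => /andP[hr hm].
  have mz : m <= normc (z - w) by apply: margin_bd bz.
  have iv : inside a b c d (w + h) by apply: Hr; rewrite addrAC subrr add0r.
  have zw : z - w != 0 by rewrite subr_eq0; exact: inside_bd bz.
  have zwh : z - w - h != 0 by rewrite -addrA -opprD subr_eq0; exact: inside_bd bz.
  have mzh : m / 2 <= normc (z - w - h) by have := normc_sub_le (z - w) h; lra.
  have -> : (z - (w + h))^-1 - (z - w)^-1 - ((z - w) ^+ 2)^-1 * h =
      ((z - w) ^+ 2 * (z - w - h))^-1 * h ^+ 2.
    by rewrite opprD addrA; field; rewrite zw zwh.
  rewrite Normc.normcM Normc.normcV Normc.normcM !normcX ler_wpM2r ?exprn_ge0 ?normc_ge0//.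
  have -> : 2 / m ^+ 3 = (m ^+ 2 * (m / 2))^-1 by field; rewrite gt_eqF.
  rewrite lef_pV2 ?posrE ?mulr_gt0 ?exprn_gt0 ?(lt_le_trans _ mz) ?(lt_le_trans _ mzh)//; try lra.
  apply: ler_pM => //; try lra; first by rewrite exprn_ge0// ltW.
  by rewrite ler_pXn2r ?nnegrE// ltW// (lt_le_trans m0).
- move=> v; rewrite lt_min => /andP[vr _] z bz; apply: ccontM.
    exact/cF/(bd_rect ab cd).
  by apply: ccont_kernel1; apply: inside_bd bz; exact: Hr.
- move=> z bz; apply: ccontM; first exact/cF/(bd_rect ab cd).
  by apply: ccont_kernel; exact: inside_bd bz.
Qed.

Lemma kernel_int_diff2 (a b c d : R) w F : inside a b c d w ->
  (forall z, rect a b c d z -> ccont F z) ->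
  exists l, cdiff (fun v => rint a b c d (fun z => F z * ((z - v) ^+ 2)^-1)) w l.
Proof.
move=> iw cF; have [ab cd] := inside_le iw; have [m m0 [? ? ? ?]] := inside_margin iw.
have [M HM] := rect_bounded ab cd cF.
have FM z : bd a b c d z -> normc (F z) <= `|M|.
  by move=> /(bd_rect ab cd)/HM H; apply: le_trans H (ler_norm _).
have [r r0 Hr] := near_inside iw.
exists (rint a b c d (fun z => F z * (2 * ((z - w) ^+ 3)^-1))).
have m20 : 0 < Num.min r (m / 2) by rewrite lt_min r0; lra.
(* The remainder is h^2 (3 / (A^2 B^2) - 2h / (A^3 B^2)) with A = z - w and B = z - w - h. As |A| >=
   m and |B| >= m/2, the two parts give 3 * 4 + 2 * 2 = 16. *)
apply: (@rint_param_diff a b c d w F (fun z v => ((z - v) ^+ 2)^-1) (fun z => 2 * ((z - w) ^+ 3)^-1)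
  (Num.min r (m / 2)) (16 / m ^+ 4) `|M|) => //.
- by rewrite divr_ge0// exprn_ge0// ltW.
- move=> z h bz; rewrite lt_min => /andP[hr hm].
  have mz : m <= normc (z - w) by apply: margin_bd bz.
  have iv : inside a b c d (w + h) by apply: Hr; rewrite addrAC subrr add0r.
  have zw : z - w != 0 by rewrite subr_eq0; exact: inside_bd bz.
  have zwh : z - w - h != 0 by rewrite -addrA -opprD subr_eq0; exact: inside_bd bz.
  have mzh : m / 2 <= normc (z - w - h) by have := normc_sub_le (z - w) h; lra.
  have -> : ((z - (w + h)) ^+ 2)^-1 - ((z - w) ^+ 2)^-1 - 2 * ((z - w) ^+ 3)^-1 * h =
      (3 * ((z - w) ^+ 2 * (z - w - h) ^+ 2)^-1
       - 2 * ((z - w) ^+ 3 * (z - w - h) ^+ 2)^-1 * h) * h ^+ 2.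
    by rewrite opprD addrA; field; rewrite zw zwh.
  rewrite Normc.normcM normcX ler_wpM2r ?exprn_ge0 ?normc_ge0//.
  set U := (z - w) ^+ 2 * _; set V := (z - w) ^+ 3 * _.
  have nU : normc U = normc (z - w) ^+ 2 * normc (z - w - h) ^+ 2 by rewrite /U Normc.normcM !normcX.
  have nV : normc V = normc (z - w) ^+ 3 * normc (z - w - h) ^+ 2 by rewrite /V Normc.normcM !normcX.
  clearbody U V.
  apply: le_trans (le_normcD _ _) _; rewrite normcN !Normc.normcM !Normc.normcV nU nV !normc_nat.
  set A := normc (z - w) in mz *; set Bb := normc (z - w - h) in mzh *.
  have A0 : 0 < A by lra.
  have B0 : 0 < Bb by lra.
  have i2 : (A ^+ 2 * Bb ^+ 2)^-1 <= 4 / m ^+ 4.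
    have -> : 4 / m ^+ 4 = (m ^+ 2 * (m / 2) ^+ 2)^-1 by field; rewrite gt_eqF.
    rewrite lef_pV2 ?posrE ?mulr_gt0 ?exprn_gt0//; try lra.
    by apply: ler_pM; rewrite ?exprn_ge0 ?ler_pXn2r ?nnegrE//; lra.
  have i3 : (A ^+ 3 * Bb ^+ 2)^-1 * normc h <= 2 / m ^+ 4.
    have -> : 2 / m ^+ 4 = (m ^+ 3 * (m / 2) ^+ 2)^-1 * (m / 2) by field; rewrite gt_eqF.
    apply: ler_pM; rewrite ?normc_ge0 ?invr_ge0 ?mulr_ge0 ?exprn_ge0 ?(ltW A0) ?(ltW B0) ?(ltW hm)//.
    rewrite lef_pV2 ?posrE ?mulr_gt0 ?exprn_gt0//; try lra.
    by apply: ler_pM; rewrite ?exprn_ge0 ?ler_pXn2r ?nnegrE//; lra.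
  rewrite -mulrA; lra.
- move=> v; rewrite lt_min => /andP[vr _] z bz; apply: ccontM.
    exact/cF/(bd_rect ab cd).
  by apply: ccont_kernel; apply: inside_bd bz; exact: Hr.
- move=> z bz; apply: ccontM; first exact/cF/(bd_rect ab cd).
  by apply: ccontM; [exact: ccont_cst|apply: ccont_kernel; exact: inside_bd bz].
Qed.

(** Dividing [cauchy_deriv] by the nonzero kernel integral writes [g] as a quotient of [f] and of
    integrals depending holomorphically on [w], so the value of the kernel integral is
    irrelevant. *)
Lemma holo_deriv (a b c d : R) w f g : inside a b c d w ->
  (forall z, rect a b c d z -> cdiff f z (g z)) -> exists l, cdiff g w l.
Proof.
move=> iw df; have [ab cd] := inside_le iw.
have cf z : rect a b c d z -> ccont f z by move=> /df; exact: cdiff_ccont.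
have c1 z : rect a b c d z -> ccont (fun=> 1 : R[i]) z by move=> _; exact: ccont_cst.
have [l1 D1] := kernel_int_diff1 iw c1.
have [l2 D2] := kernel_int_diff2 iw c1.
have [l3 D3] := kernel_int_diff2 iw cf.
have rw : rect a b c d w by case: iw => /andP[? ?] /andP[? ?]; split; apply/andP; split; exact: ltW.
have K0 : rint a b c d (fun z => 1 * (z - w)^-1) != 0.
  by under [fun z => _]eq_fun do rewrite mul1r; exact: kernel_neq0.
have D := cdiffM (cdiffB D3 (cdiffM (df w rw) D2)) 
  (@cdiffV _ (fun v => rint a b c d (fun z => 1 * (z - v)^-1)) _ _ K0 D1).
eexists; apply: (cdiff_near _ D).
have [r r0 Hr] := near_inside iw; exists r => // v /Hr iv.
have bk2 F : (forall z, rect a b c d z -> ccont F z) ->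
    bcont a b c d (fun z => F z * ((z - v) ^+ 2)^-1).
  move=> cF z bz; apply: ccontM; first exact/cF/(bd_rect ab cd).
  by apply: ccont_kernel; exact: inside_bd bz.
have K1 : rint a b c d (fun z => 1 * (z - v)^-1) = rint a b c d (fun z => (z - v)^-1).
  by apply: rint_eq => z _; rewrite mul1r.
rewrite -rintZ; last exact: bk2.
rewrite -rintB//; [|exact: bk2|]; last first.
  by move=> z bz; apply: ccontM; [exact: ccont_cst|exact: bk2].
have := cauchy_deriv iv df; rewrite -K1 => E.
have -> : rint a b c d (fun z => f z * ((z - v) ^+ 2)^-1 - f v * (1 * ((z - v) ^+ 2)^-1)) =
   g v * rint a b c d (fun z => 1 * (z - v)^-1).
  by rewrite -E; apply: rint_eq => z _; rewrite mul1r mulrBl.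
by rewrite mulfK// K1; exact: kernel_neq0.
Qed.

Lemma square_kernel (s : R) w : 0 < s ->
  1 <= normc (rint (complex.Re w - s) (complex.Re w + s)
                   (complex.Im w - s) (complex.Im w + s) (fun z => (z - w)^-1)).
Proof.
move=> s0; apply: le_trans (le_Im_normc _); apply: le_trans (ler_norm _).
have := @kernel_lower _ (complex.Re w - s) (complex.Re w + s)
                   (complex.Im w - s) (complex.Im w + s) s (2 * s ^+ 2) w s0.
move=> H; apply: le_trans (H _ _ _ _ _); [|lra..|].
  by rewrite (_ : 8 * s ^+ 2 / (2 * s ^+ 2) = 4) ?ler1n//; field; rewrite gt_eqF.
move=> z /bd_rect [||/andP[? ?] /andP[? ?]]; [lra..|].
rewrite normc_sqr cReB cImB mulr_natl mulr2n.
by apply: lerD; rewrite -[leRHS](@ger0_norm _ (s ^+ 2)) ?sqr_ge0// -[leLHS]ger0_norm ?sqr_ge0//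
  !normrX ler_pXn2r ?nnegrE// (@ger0_norm _ s) ?ler_norml; lra.
Qed.

(** In Cauchy's formula for the derivative |f z - f w| <= 2M, |z - w| >= s, the half-perimeter is 4s
    and the kernel integral has modulus at least 1; this makes 4 * 2 * 4 = 32. *)
Lemma cauchy_estimate (s M : R) w f g : 0 < s ->
  (forall z, rect (complex.Re w - s) (complex.Re w + s)
                  (complex.Im w - s) (complex.Im w + s) z -> cdiff f z (g z)) ->
  (forall z, rect (complex.Re w - s) (complex.Re w + s)
                  (complex.Im w - s) (complex.Im w + s) z -> normc (f z) <= M) ->
  normc (g w) <= 32 * M / s.
Proof.
move=> s0 df fM.
set a := _ - s in df fM; set b := _ + s in df fM; set c := _ - s in df fM; set d := _ + s in df fM.
have iw : inside a b c d w by split; rewrite /a /b /c /d; lra.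
have [ab cd] := inside_le iw.
have rw : rect a b c d w by split; rewrite /a /b /c /d; lra.
have E := cauchy_deriv iw df.
have K1 := @square_kernel s w s0; rewrite -/a -/b -/c -/d in K1.
have M0 : 0 <= M by apply: le_trans (fM w rw); exact: normc_ge0.
apply: (@le_trans _ _ (normc (g w * rint a b c d (fun z => (z - w)^-1)))).
  by rewrite Normc.normcM ler_peMr ?normc_ge0.
rewrite -E.
have -> : 32 * M / s = 4 * (2 * M * (s ^+ 2)^-1) * (b - a + (d - c)).
  by rewrite /a /b /c /d; field; rewrite gt_eqF.
apply: rint_bound => //.
  move=> z bz; apply: ccontM; last by apply: ccont_kernel; exact: inside_bd bz.
  apply: ccontB; last exact: ccont_cst.
  exact: cdiff_ccont (df _ (bd_rect ab cd bz)).
move=> z bz; rewrite Normc.normcM Normc.normcV normcX.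
have sz : s <= normc (z - w) by apply: margin_bd bz; rewrite /a /b /c /d; lra.
apply: ler_pM; rewrite ?normc_ge0 ?invr_ge0 ?exprn_ge0 ?normc_ge0//.
  apply: le_trans (le_normcD _ _) _; rewrite normcN mulr_natl mulr2n.
  by apply: lerD; apply: fM => //; exact: (bd_rect ab cd).
rewrite lef_pV2 ?posrE ?exprn_gt0// ?(lt_le_trans s0)//.
by rewrite ler_pXn2r ?nnegrE ?normc_ge0// ltW.
Qed.

Lemma cint_le_J (a b : R) (u : R -> R[i]) : a <= b -> rcont a b u ->
  normc (cint a b u) <= 2 * J a b (fun x => normc (u x)).
Proof.
move=> ab cu.
have cn : cts_on a b (fun x => normc (u x)).
  move=> x xab; apply: continuous_eps => e /(cu x xab)[d d0 Hd]; exists d => // y /Hd.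
  apply: le_lt_trans; rewrite ler_norml normc_sub_le andbT.
  by rewrite lerNl opprB normcB normc_sub_le.
have bnd (P : R[i] -> R) : (forall z, `|P z| <= normc z) ->
    cts_on a b (fun x => P (u x)) -> `|J a b (fun x => P (u x))| <= J a b (fun x => normc (u x)).
  move=> Pn cP; rewrite ler_norml -JN//; apply/andP; split; apply: le_J => //; try exact: cts_N.
    by move=> x _; have := Pn (u x); rewrite ler_norml => /andP[].
  by move=> x _; have := Pn (u x); rewrite ler_norml => /andP[].
apply: le_trans (le_normc_ReIm _) _; rewrite mulr_natl mulr2n; apply: lerD => /=.
  by apply: bnd; [exact: le_Re_normc|exact: rcont_Re].
by apply: bnd; [exact: le_Im_normc|exact: rcont_Im].
Qed.

Lemma rcont_normc a b (u : R -> R[i]) : rcont a b u -> cts_on a b (fun x => normc (u x)).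
Proof.
move=> cu x xab; apply: continuous_eps => e /(cu x xab)[d d0 Hd]; exists d => // y /Hd.
apply: le_lt_trans; rewrite ler_norml normc_sub_le andbT.
by rewrite lerNl opprB normcB normc_sub_le.
Qed.

(** Each side may lie anywhere at distance between s and 2s from [w]: corners are then within |z -
    w|^2 <= 8 s^2, which makes the kernel integral at least 1. This freedom allows choosing sides
    along which |f| has a small integral. *)
Lemma submean_lines (a b c d s : R) w f : 0 < s ->
  a + s <= complex.Re w -> complex.Re w + s <= b ->
  c + s <= complex.Im w -> complex.Im w + s <= d ->
  complex.Re w <= a + 2 * s -> b <= complex.Re w + 2 * s ->
  complex.Im w <= c + 2 * s -> d <= complex.Im w + 2 * s ->
  (forall z, rect a b c d z -> exists l, cdiff f z l) ->
  normc (f w) <= 2 / s * (J a b (fun x => normc (f (cplx x c))) +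
                          J c d (fun y => normc (f (cplx b y))) +
                          J a b (fun x => normc (f (cplx x d))) +
                          J c d (fun y => normc (f (cplx a y)))).
Proof.
move=> s0 h1 h2 h3 h4 k1 k2 k3 k4 df.
have iw : inside a b c d w by split; lra.
have [ab cd] := inside_le iw.
have rw : rect a b c d w by split; lra.
have cf z : rect a b c d z -> ccont f z by move=> /df[l]; exact: cdiff_ccont.
have E := cauchy_formula iw (cf _ rw) (fun z rz _ => df z rz).
have K1 : 1 <= normc (rint a b c d (fun z => (z - w)^-1)).
  apply: le_trans (le_Im_normc _); apply: le_trans (ler_norm _).
  have H := @kernel_lower _ a b c d s (8 * s ^+ 2) w s0 h1 h2 h3 h4.
  apply: le_trans (H _).
    by rewrite (_ : 8 * s ^+ 2 / (8 * s ^+ 2) = 1) ?ler1n//; field; rewrite gt_eqF.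
  move=> z /(bd_rect ab cd)[/andP[? ?] /andP[? ?]].
  have -> : 8 * s ^+ 2 = (2 * s) ^+ 2 + (2 * s) ^+ 2 by ring.
  rewrite normc_sqr cReB cImB.
  have s2 : 0 <= 2 * s by lra.
  by apply: lerD; rewrite -[leRHS](@ger0_norm _ ((2 * s) ^+ 2)) ?sqr_ge0// -[leLHS]ger0_norm ?sqr_ge0//
  !normrX ler_pXn2r ?nnegrE// (@ger0_norm _ (2 * s) s2) ?ler_norml; lra.
apply: (@le_trans _ _ (normc (f w * rint a b c d (fun z => (z - w)^-1)))).
  by rewrite Normc.normcM ler_peMr ?normc_ge0.
rewrite -E.
have bq : bcont a b c d (fun z => f z * (z - w)^-1).
  move=> z bz; apply: ccontM; first exact/cf/bd_rect.
  by apply: ccont_kernel1; exact: inside_bd bz.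
have bf : bcont a b c d f by move=> z bz; exact/cf/bd_rect.
have [q1 q2 q3 q4] := bcont_lines bq.
have [f1 f2 f3 f4] := bcont_lines bf.
have qn z : bd a b c d z -> normc (f z * (z - w)^-1) <= s^-1 * normc (f z).
  move=> bz; rewrite Normc.normcM Normc.normcV mulrC ler_wpM2r ?normc_ge0//.
  have sz : s <= normc (z - w) by apply: margin_bd bz.
  by rewrite lef_pV2 ?posrE// (lt_le_trans s0).
have side x y (u v : R -> R[i]) : x <= y -> rcont x y u -> rcont x y v ->
    (forall t, x <= t <= y -> normc (u t) <= s^-1 * normc (v t)) ->
    normc (cint x y u) <= 2 / s * J x y (fun t => normc (v t)).
  move=> xy cu cv uv; apply: le_trans (cint_le_J xy cu) _.
  rewrite -mulrA ler_pM2l// -JZ; last exact: rcont_normc.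
  apply: le_J => //; first exact: rcont_normc.
  by apply: cts_Z; exact: rcont_normc.
have B1 := side _ _ _ _ ab q1 f1 (fun x xab => qn _ (bd_hc c d xab)).
have B2 := side _ _ _ _ ab q2 f2 (fun x xab => qn _ (bd_hd c d xab)).
have B3 := side _ _ _ _ cd q3 f3 (fun x xab => qn _ (bd_va a b xab)).
have B4 := side _ _ _ _ cd q4 f4 (fun x xab => qn _ (bd_vb a b xab)).
rewrite /rint.
apply: le_trans (le_normcD _ _) _; rewrite normcN normc_i.
apply: le_trans (lerD (le_normcD _ _) (lexx _)) _; rewrite normcN.
apply: le_trans (lerD (lerD (le_normcD _ _) (lexx _)) (lexx _)) _; rewrite normc_i.
rewrite !mulrDr; do ![apply: lerD => //].
Qed.

End CauchyDeriv.

(** * Area mean value inequalities *)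

Section PlaneMeasure.
Context {R : realType}.
Local Notation MT := (measurableTypeR R * measurableTypeR R)%type.
Local Notation mu := (@lebesgue_measure R).
Local Notation mu2 := (@lebesgue_measure R \x @lebesgue_measure R)%E.

Definition pt (w : MT) : R[i] := cplx w.1 w.2.

Definition copen (D : set R[i]) := forall z, D z ->
  exists2 d : R, 0 < d & forall w, normc (w - z) < d -> D w.

(** Boxes with rational data contained in [D] cover it. Those that do not fit are replaced by the
    empty set, so that the union runs over a countable type. *)
Lemma copen_measurable (D : set R[i]) : copen D -> measurable [set w : MT | D (pt w)].
Proof.
move=> oD.
pose box (t : rat * rat * rat) : set MT :=
  (`]ratr t.1.1 - ratr t.2, ratr t.1.1 + ratr t.2[%classic `*`
  `]ratr t.1.2 - ratr t.2, ratr t.1.2 + ratr t.2[%classic)%R.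
pose F t : set MT := if `[< box t `<=` [set w : MT | D (pt w)] >] then box t else set0.
have -> : [set w : MT | D (pt w)] = \bigcup_t F t.
  apply/seteqP; split; last first.
    by move=> w [t _]; rewrite /F; case: asboolP => // H /H.
  move=> [x y] /= Dw; have [d d0 Hd] := oD _ Dw.
  have d40 : 0 < d / 8 by lra.
  have [q1 q1P] := @rat_in_itvoo R (x - d / 8) x ltac:(by rewrite gtrBl).
  have [q2 q2P] := @rat_in_itvoo R (y - d / 8) y ltac:(by rewrite gtrBl).
  have [r rP] := @rat_in_itvoo R (d / 8) (d / 4) ltac:(lra).
  rewrite !in_itv /= in q1P q2P rP.
  exists (q1, q2, r) => //; rewrite /F; case: asboolP => [_|H].
    by split; rewrite /= in_itv /=; lra.
  exfalso; apply: H => -[u v] [] /=; rewrite !in_itv /= => hu hv.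
  apply: Hd; apply: le_lt_trans (le_normc_ReIm _) _ => /=.
  have : `|u - x| < d / 2 by rewrite ltr_norml; lra.
  have : `|v - y| < d / 2 by rewrite ltr_norml; lra.
  by rewrite /pt /=; lra.
apply: countable_bigcupT_measurable; first exact: countableP.
move=> t; rewrite /F; case: asboolP => // _; exact: measurableX.
Qed.

Lemma ccont_measurable (D : set R[i]) (f : R[i] -> R) : copen D ->
  (forall z, D z -> forall e : R, 0 < e -> exists2 d : R, 0 < d &
     forall w, normc (w - z) < d -> `|f w - f z| < e) ->
  measurable_fun [set w : MT | D (pt w)] (fun w => f (pt w)).
Proof.
move=> oD cf mD; apply: (measurability _ (measurable_realfun.RGenOInfty.measurableE R)) => //.
move=> /= _ [_ [x ->] <-].
rewrite [X in measurable X](_ : _ = [set w : MT | (D `&` [set z | x < f z]) (pt w)]).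
  apply: copen_measurable => z [Dz /= xz].
  have [d d0 Hd] := oD z Dz.
  have [d' d'0 Hd'] := cf z Dz (f z - x) ltac:(lra).
  exists (Num.min d d'); first by rewrite lt_min d0.
  move=> w; rewrite lt_min => /andP[/Hd Dw /Hd']; rewrite ltr_norml => /andP[h _].
  by split => //=; lra.
by apply/seteqP; split => w /=; rewrite in_itv /= andbT.
Qed.

Lemma ccont_normc_eps f z : ccont f z -> forall e : R, 0 < e -> exists2 d : R, 0 < d &
     forall w, normc (w - z) < d -> `|normc (f w) - normc (f z)| < e.
Proof.
move=> cf e /cf[d d0 Hd]; exists d => // w /Hd; apply: le_lt_trans.
by rewrite ler_norml normc_sub_le andbT lerNl opprB normcB normc_sub_le.
Qed.

Lemma measurable_normc (D : set R[i]) f : copen D -> (forall z, D z -> ccont f z) ->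
  measurable_fun [set w : MT | D (pt w)] (fun w => normc (f (pt w))).
Proof.
move=> oD cf; apply: (@ccont_measurable D (fun z => normc (f z))) => // z /cf.
exact: ccont_normc_eps.
Qed.

Definition box (a b c d : R) : set MT := `[a, b]%classic `*` `[c, d]%classic.

Lemma measurable_box a b c d : measurable (box a b c d).
Proof. exact: measurableX. Qed.

Lemma boxP a b c d (w : MT) : box a b c d w <-> rect a b c d (pt w).
Proof. by rewrite /box /rect /= !in_itv /=. Qed.

Local Open Scope ereal_scope.

(** Chebyshev's argument: were [h] above (T + e)/s on the whole interval, its integral would be at
    least T + e. The margin [e] makes the contradiction strict. *)
Lemma good_line (h : R -> \bar R) (p s T e : R) : (0 < s)%R -> (0 < e)%R ->
  measurable_fun [set: R] h -> (forall x, 0 <= h x) ->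
  \int[mu]_x h x <= T%:E ->
  exists2 t : R, (p <= t <= p + s)%R & h t <= ((T + e) / s)%:E.
Proof.
move=> s0 e0 mh h0 hT; apply: contrapT => H.
have K x : (p <= x <= p + s)%R -> ((T + e) / s)%:E <= h x.
  move=> xp; rewrite leNgt; apply/negP => hx; apply: H; exists x => //; exact: ltW.
have [Te|Te] := ltP (T + e)%R 0%R.
  have : (0 : \bar R) <= T%:E by apply: le_trans hT; apply: integral_ge0.
  by rewrite lee_fin; lra.
have : (T + e)%:E <= \int[mu]_x h x.
  apply: (@le_trans _ _ (\int[mu]_(x in `[p, (p + s)%R]) h x)); last first.
    by apply: ge0_subset_integral.
  have -> : (T + e)%:E = \int[mu]_(x in `[p, (p + s)%R]) (cst ((T + e) / s)%:E x).
    rewrite integral_cst//= lebesgue_measure_itv /= lte_fin ltrDl s0 -EFinD -EFinM.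
    by congr EFin; rewrite addrAC subrr add0r divfK ?gt_eqF.
  apply: ge0_le_integral => //.
  - by move=> x _; rewrite lee_fin divr_ge0// ltW.
  - exact: measurable_funTS.
by move/le_trans/(_ hT); rewrite lee_fin; lra.
Qed.

Lemma J_EFin (a b : R) u : cts_on a b u -> (forall x, (a <= x <= b)%R -> (0 <= u x)%R) ->
  (J a b u)%:E = \int[mu]_(x in `[a, b]) (u x)%:E.
Proof.
move=> cu u0; rewrite /J /Rintegral fineK//.
exact/integrable_fin_num/J_integrable.
Qed.

Lemma measurable_normc_line (D : set R[i]) f a b c d : copen D -> (forall z, D z -> ccont f z) ->
  (forall z, rect a b c d z -> D z) ->
  measurable_fun setT ((fun w => (normc (f (pt w)))%:E) \_ (box a b c d)).
Proof.
move=> oD cf sub; apply/measurable_restrict; [exact: measurable_box|exact: measurableT|].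
rewrite setTI; apply/measurable_EFinP.
apply: (measurable_funS (E := [set w : MT | D (pt w)])).
- exact: copen_measurable.
- by move=> w /boxP/sub.
- exact: measurable_normc.
Qed.

Lemma submean_lines_xy (a b c d s x0 y0 t : R) f : (0 < s)%R ->
  (x0 - 2 * s <= a <= x0 - 2 * s + s)%R -> (x0 + s <= b <= x0 + s + s)%R ->
  (y0 - 2 * s <= c <= y0 - 2 * s + s)%R -> (y0 + s <= d <= y0 + s + s)%R ->
  (forall z, rect (x0 - 2 * s) (x0 + 2 * s) (y0 - 2 * s) (y0 + 2 * s) z -> exists l, cdiff f z l) ->
  (J a b (fun x => normc (f (cplx x c))) <= t)%R -> (J a b (fun x => normc (f (cplx x d))) <= t)%R ->
  (J c d (fun y => normc (f (cplx a y))) <= t)%R -> (J c d (fun y => normc (f (cplx b y))) <= t)%R ->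
  (normc (f (cplx x0 y0)) <= 2 / s * (4 * t))%R.
Proof.
move=> s0 /andP[ha1 ha2] /andP[hb1 hb2] /andP[hc1 hc2] /andP[hd1 hd2] df B1 B2 B3 B4.
apply: le_trans (@submean_lines _ a b c d s (cplx x0 y0) f s0 _ _ _ _ _ _ _ _ _) _ => /=;
  try by clear -s0 ha1 ha2 hb1 hb2 hc1 hc2 hd1 hd2; lra.
  move=> z [/andP[? ?] /andP[? ?]]; apply: df.
  by split; apply/andP; split; clear B1 B2 B3 B4; lra.
by rewrite ler_wpM2l ?divr_ge0 ?(ltW s0)//; lra.
Qed.

(** By Tonelli's theorem each of the four strips of width s contains a line along which |f| has
    integral about T/s at most, T being the integral over the square; these lines bound a rectangle
    to which [submean_lines] applies. *)
Lemma area_submean (D : set R[i]) f (x0 y0 s : R) : copen D -> (0 < s)%R ->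
  (forall z, D z -> exists l, cdiff f z l) ->
  (forall z, rect (x0 - 2 * s) (x0 + 2 * s) (y0 - 2 * s) (y0 + 2 * s) z -> D z) ->
  (s ^+ 2 * normc (f (cplx x0 y0)))%:E <=
  16%:E * \int[mu2]_(w in box (x0 - 2 * s) (x0 + 2 * s) (y0 - 2 * s) (y0 + 2 * s))
     (normc (f (pt w)))%:E.
Proof.
move=> oD s0 df; set X1 := (x0 - 2 * s)%R; set X2 := (x0 + 2 * s)%R.
set Y1 := (y0 - 2 * s)%R; set Y2 := (y0 + 2 * s)%R => sub.
have cf z : D z -> ccont f z by move=> /df[l]; exact: cdiff_ccont.
set I := \int[_]_(_ in _) _.
have I0 : 0 <= I by apply: integral_ge0 => w _; rewrite lee_fin normc_ge0.
have [Ioo|Ioo] := eqVneq I +oo.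
  by rewrite Ioo gt0_muley ?lte_fin// leey.
have [T IT] : exists T, I = T%:E.
  by case: (I) I0 Ioo => // t _ _; exists t.
have T0 : (0 <= T)%R by rewrite -lee_fin -IT.
pose F := (fun w : MT => (normc (f (pt w)))%:E) \_ (box X1 X2 Y1 Y2).
have mF : measurable_fun setT F by exact: measurable_normc_line sub.
have F0 w : 0 <= F w.
  by rewrite /F patchE; case: ifP => // _; rewrite lee_fin normc_ge0.
have IF : I = \int[mu2]_w F w by rewrite /I integral_mkcond.
have Ix : \int[mu]_x fubini_F mu F x = T%:E by rewrite -fubini_tonelli1// -IF.
have Iy : \int[mu]_x fubini_G mu F x = T%:E by rewrite -fubini_tonelli2// -IF.
have mx : measurable_fun [set: R] (fubini_F mu F) by exact: measurable_fun_fubini_tonelli_F.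
have my : measurable_fun [set: R] (fubini_G mu F) by exact: measurable_fun_fubini_tonelli_G.
have x0' x : 0 <= fubini_F mu F x by apply: integral_ge0.
have y0' y : 0 <= fubini_G mu F y by apply: integral_ge0.
have ccf x y : (X1 <= x <= X2)%R -> (Y1 <= y <= Y2)%R -> ccont f (cplx x y).
  by move=> hx hy; apply/cf/sub; split.
have FE x y : (X1 <= x <= X2)%R -> (Y1 <= y <= Y2)%R -> F (x, y) = (normc (f (cplx x y)))%:E.
  by move=> hx hy; rewrite /F patchE mem_set//; apply/boxP; split.
have sx x c d : (X1 <= x <= X2)%R -> (Y1 <= c)%R -> (d <= Y2)%R ->
    (J c d (fun y => normc (f (cplx x y))))%:E <= fubini_F mu F x.
  move=> hx hc hd; have hy y : (c <= y <= d)%R -> (Y1 <= y <= Y2)%R.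
    by move=> /andP[? ?]; rewrite (le_trans hc)// (le_trans _ hd).
  rewrite J_EFin; last 2 first.
  - by apply/rcont_normc/vline_cont => y /hy; exact: ccf.
  - by move=> *; exact: normc_ge0.
  rewrite (eq_integral (fun y => F (x, y))); last first.
    by move=> y; rewrite inE /= in_itv /= => /hy hy'; rewrite FE.
  apply: ge0_subset_integral => //.
  exact: measurable_funTS (measurable_fun_pair2 x mF).
have sy y a b : (Y1 <= y <= Y2)%R -> (X1 <= a)%R -> (b <= X2)%R ->
    (J a b (fun x => normc (f (cplx x y))))%:E <= fubini_G mu F y.
  move=> hy ha hb; have hx x : (a <= x <= b)%R -> (X1 <= x <= X2)%R.
    by move=> /andP[? ?]; rewrite (le_trans ha)// (le_trans _ hb).
  rewrite J_EFin; last 2 first.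
  - by apply/rcont_normc/hline_cont => x /hx hx'; exact: ccf.
  - by move=> *; exact: normc_ge0.
  rewrite (eq_integral (fun x => F (x, y))); last first.
    by move=> x; rewrite inE /= in_itv /= => /hx hx'; rewrite FE.
  apply: ge0_subset_integral => //.
  exact: measurable_funTS (measurable_fun_pair1 y mF).
rewrite IT -EFinM lee_fin.
suff : (s ^+ 2 * normc (f (cplx x0 y0)) <= 8 * T)%R by lra.
apply/ler_addgt0Pr => e e0.
(* The final constant is s^2 * (2/s) * 4 / s = 8, so a margin of e/8 on each line costs e in
   total. *)
have e80 : (0 < e / 8)%R by lra.
have leq (u v : \bar R) : u = v -> u <= v by move=> ->.
have [b hb Hb] := good_line (x0 + s)%R s0 e80 mx x0' (leq _ _ Ix).
have [a ha Ha] := good_line (x0 - 2 * s)%R s0 e80 mx x0' (leq _ _ Ix).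
have [d hd Hd] := good_line (y0 + s)%R s0 e80 my y0' (leq _ _ Iy).
have [c hc Hc] := good_line (y0 - 2 * s)%R s0 e80 my y0' (leq _ _ Iy).
have B1 := le_trans (sy c a b ltac:(clear -hc hd s0; rewrite /Y1 /Y2; lra) ltac:(clear -ha s0; rewrite /X1; lra) ltac:(clear -hb s0; rewrite /X2; lra)) Hc.
have B2 := le_trans (sy d a b ltac:(clear -hc hd s0; rewrite /Y1 /Y2; lra) ltac:(clear -ha s0; rewrite /X1; lra) ltac:(clear -hb s0; rewrite /X2; lra)) Hd.
have B3 := le_trans (sx a c d ltac:(clear -ha hb s0; rewrite /X1 /X2; lra) ltac:(clear -hc s0; rewrite /Y1; lra) ltac:(clear -hd s0; rewrite /Y2; lra)) Ha.
have B4 := le_trans (sx b c d ltac:(clear -ha hb s0; rewrite /X1 /X2; lra) ltac:(clear -hc s0; rewrite /Y1; lra) ltac:(clear -hd s0; rewrite /Y2; lra)) Hb.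
rewrite !lee_fin in B1 B2 B3 B4.
have H' : (normc (f (cplx x0 y0)) <= 2 / s * (4 * ((T + e / 8) / s)))%R.
  by apply: (submean_lines_xy s0 ha hb hc hd _ B1 B2 B3 B4) => z /sub/df.
have -> : (8 * T + e = s ^+ 2 * (2 / s * (4 * ((T + e / 8) / s))))%R by field; rewrite gt_eqF.
by rewrite ler_wpM2l// exprn_ge0// ltW.
Qed.

End PlaneMeasure.

(** * Area mean value inequality for all positive exponents *)

Section QuasiSubmean.
Context {R : realType}.
Local Notation MT := (measurableTypeR R * measurableTypeR R)%type.
Local Notation mu2 := (@lebesgue_measure R \x @lebesgue_measure R)%E.

Lemma continuous_powR_norm (D : set R[i]) f (q : R) : copen D -> 0 < q ->
  (forall z, D z -> ccont f z) ->
  measurable_fun [set w : MT | D (pt w)] (fun w => normc (f (pt w)) `^ q).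
Proof.
move=> oD q0 cf.
apply: (measurableT_comp (f := fun x : R => x `^ q)); first exact: measurable_powR.
exact: measurable_normc.
Qed.

Definition square (x0 y0 r : R) : set MT := box (x0 - r) (x0 + r) (y0 - r) (y0 + r).

Lemma squareP x0 y0 r (w : MT) : square x0 y0 r w <->
  `|w.1 - x0| <= r /\ `|w.2 - y0| <= r.
Proof.
rewrite /square boxP /rect /=; split => -[].
  by move=> /andP[? ?] /andP[? ?]; split; rewrite ler_norml; apply/andP; split; lra.
by rewrite !ler_norml => /andP[? ?] /andP[? ?]; split; apply/andP; split; lra.
Qed.

Lemma measurable_square x0 y0 r : measurable (square x0 y0 r).
Proof. exact: measurable_box. Qed.

(* Hardy and Littlewood's trick for exponents below 1: apply the mean value
   inequality at a near-maximum of [dist(z, boundary)^2 * |f z|^q]. *)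
Lemma quasi_submean (q : R) : 0 < q <= 1 -> exists2 C : R, 0 < C &
  forall (D : set R[i]) f x0 y0 s, copen D -> 0 < s ->
  (forall z, D z -> exists l, cdiff f z l) ->
  (forall w, square x0 y0 (2 * s) w -> D (pt w)) ->
  ((s ^+ 2 * normc (f (cplx x0 y0)) `^ q)%:E <=
  C%:E * \int[mu2]_(w in square x0 y0 (2 * s)) (normc (f (pt w)) `^ q)%:E)%E.
Proof.
move=> /andP[q0 q1].
(* On the square around the near-maximum, |f|^q is at most 8 times its value at the centre: 2 from
   the near-maximum and 4 from halving the distance to the boundary. [K] is the resulting factor for
   |f|. *)
pose K : R := 8 `^ q^-1; have K0 : 0 < K by apply: powR_gt0; lra.
have Kq0 : 0 < K `^ (1 - q) by exact: powR_gt0.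
exists (256 * 8 * K `^ (1 - q)); first by rewrite !mulr_gt0.
move=> D f x0 y0 s oD s0 df sub.
set A := square x0 y0 (2 * s).
have mA : measurable A by exact: measurable_square.
have cf z : D z -> ccont f z by move=> /df[l]; exact: cdiff_ccont.
have mfq : measurable_fun A (fun w => (normc (f (pt w)) `^ q)%:E).
  apply/measurable_EFinP; apply: (measurable_funS (E := [set w : MT | D (pt w)])).
  - exact: copen_measurable.
  - by move=> w /sub.
  - exact: continuous_powR_norm.
set I := (\int[_]_(_ in _) _)%E.
have I0 : (0 <= I)%E by apply: integral_ge0 => w _; rewrite lee_fin powR_ge0.
have [Ioo|Ioo] := eqVneq I +oo%E.
  by rewrite Ioo gt0_muley ?lte_fin ?leey// !mulr_gt0.
have [T IT] : exists T, I = T%:E.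
  by case: (I) I0 Ioo => // t _ _; exists t.
have T0 : 0 <= T by rewrite -lee_fin -IT.
rewrite IT -EFinM lee_fin.
have [f0|f0] := eqVneq (f (cplx x0 y0)) 0.
  by rewrite f0 Normc.normc0 powR0 ?gt_eqF// mulr0 !mulr_ge0// ltW.
have [M0 HM0] : exists M, forall w, A w -> normc (f (pt w)) <= M.
  have [|||M HM] := @rect_bounded _ (x0 - 2 * s) (x0 + 2 * s) (y0 - 2 * s) (y0 + 2 * s) f; [lra|lra|..].
    by move=> [x y] rz; apply: cf; apply: (sub (x, y)); apply/boxP.
  by exists M => w /boxP; exact: HM.
(* Distance to the boundary of the square in the maximum norm. *)
pose d (w : MT) : R := 2 * s - Num.max `|w.1 - x0| `|w.2 - y0|.
have dA w : A w -> 0 <= d w.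
  by move=> /squareP[h1 h2]; rewrite /d subr_ge0 ge_max h1 h2.
have d2s w : d w <= 2 * s.
  by rewrite /d lerBlDr lerDl le_max normr_ge0.
pose Phi w : R := d w ^+ 2 * normc (f (pt w)) `^ q.
pose S := [set Phi w | w in A].
have c0A : A (x0, y0) by apply/squareP; rewrite /= !subrr normr0; split; lra.
have hS : has_sup S.
  split; first by exists (Phi (x0, y0)); exists (x0, y0).
  exists ((2 * s) ^+ 2 * M0 `^ q) => _ [w Aw <-].
  apply: ler_pM; rewrite ?exprn_ge0 ?powR_ge0 ?dA//.
    by rewrite ler_pXn2r ?nnegrE ?dA//; lra.
  have M00 : 0 <= M0 by apply: le_trans (HM0 w Aw); exact: normc_ge0.
  by apply: ge0_ler_powR; rewrite ?nnegrE ?normc_ge0 ?HM0// ltW.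
set M := sup S.
have PhiM w : A w -> Phi w <= M by move=> Aw; apply: sup_upper_bound => //; exists w.
have Phi0 : Phi (x0, y0) = (2 * s) ^+ 2 * normc (f (cplx x0 y0)) `^ q.
  by rewrite /Phi /d /= !subrr normr0 maxxx subr0.
have M_gt0 : 0 < M.
  apply: lt_le_trans (PhiM _ c0A); rewrite Phi0 mulr_gt0 ?exprn_gt0 ?powR_gt0 ?normc_gt0//; lra.
have [_ [w1 Aw1 <-] Hw1] : exists2 t, S t & M / 2 < t.
  have [|t St Ht] := @sup_adherent _ S (M / 2) _ hS; first by lra.
  by exists t => //; move: Ht; rewrite -/M; lra.
set d1 := d w1.
have d10 : 0 < d1.
  rewrite lt_def dA// andbT; apply/eqP => E; move: Hw1.
  by rewrite /Phi -/d1 E expr0n mul0r; lra.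
set N1 := normc (f (pt w1)).
have N10 : 0 < N1.
  rewrite lt_def normc_ge0 andbT; apply/eqP => E; move: Hw1.
  by rewrite /Phi -/N1 E powR0 ?gt_eqF// mulr0; lra.
have Nq0 : 0 < N1 `^ q by exact: powR_gt0.
(* Half-side d1/2, so that on [A1] the distance to the boundary is still at least d1/2. *)
set A1 := square w1.1 w1.2 (2 * (d1 / 4)).
have A1d w : A1 w -> d1 / 2 <= d w.
  move=> /squareP[h1 h2]; move: (erefl d1); rewrite {1}/d1 /d => E.
  have e1 : `|w1.1 - x0| <= 2 * s - d1.
    by rewrite -E subKr le_max lexx.
  have e2 : `|w1.2 - y0| <= 2 * s - d1.
    by rewrite -E subKr le_max lexx orbT.
  have k1 : `|w.1 - x0| <= 2 * s - d1 / 2.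
    have -> : w.1 - x0 = (w.1 - w1.1) + (w1.1 - x0) by rewrite subrKA.
    apply: le_trans (ler_normD _ _) _; clear -h1 e1; lra.
  have k2 : `|w.2 - y0| <= 2 * s - d1 / 2.
    have -> : w.2 - y0 = (w.2 - w1.2) + (w1.2 - y0) by rewrite subrKA.
    apply: le_trans (ler_normD _ _) _; clear -h2 e2; lra.
  have : Num.max `|w.1 - x0| `|w.2 - y0| <= 2 * s - d1 / 2 by rewrite ge_max k1 k2.
  rewrite /d; set m := Num.max _ _; clear; lra.
have A1A : A1 `<=` A.
  move=> w /A1d dw; apply/squareP.
  have : 0 <= d w by apply: le_trans dw; rewrite divr_ge0// ltW.
  by rewrite /d subr_ge0 ge_max => /andP[].
have up w : A1 w -> normc (f (pt w)) `^ q <= 8 * N1 `^ q.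
  move=> A1w; have Aw := A1A _ A1w; have := PhiM w Aw; rewrite /Phi => H.
  have h2 : (d1 / 2) ^+ 2 * normc (f (pt w)) `^ q <= M.
    apply: le_trans H; rewrite ler_wpM2r ?powR_ge0// ler_pXn2r ?nnegrE ?dA ?A1d//.
    by rewrite divr_ge0// ltW.
  have h3 : M < 2 * (d1 ^+ 2 * N1 `^ q) by move: Hw1; rewrite /Phi -/d1 -/N1; clear; lra.
  have d120 : 0 < d1 ^+ 2 by rewrite exprn_gt0.
  rewrite -(ler_pM2l d120); move: h2 h3; rewrite expr_div_n.
  set u := normc _ `^ q; set v := N1 `^ q; set t := d1 ^+ 2; clear; lra.
(* Writing |f| = |f|^(1-q) |f|^q trades the integral of |f| for that of |f|^q; the factor N1^(1-q)
   is cancelled later against N1 = N1^q N1^(1-q). *)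
have up1 w : A1 w -> normc (f (pt w)) <= (K * N1) `^ (1 - q) * normc (f (pt w)) `^ q.
  move=> A1w; have := up w A1w; set n := normc _ => nq.
  have n0 : 0 <= n by exact: normc_ge0.
  have nK : n <= K * N1.
    have qN0 : 0 <= q^-1 by rewrite invr_ge0 ltW.
    have : (n `^ q) `^ q^-1 <= (8 * N1 `^ q) `^ q^-1.
      apply: ge0_ler_powR => //; rewrite nnegrE ?powR_ge0// mulr_ge0 ?powR_ge0//.
    rewrite powRM ?powR_ge0// -!powRrM mulfV ?gt_eqF// !powRr1 ?(ltW N10)//.
  have [->|nn] := eqVneq n 0; first by rewrite mulr_ge0 ?powR_ge0.
  have np : 0 < n by rewrite lt_def nn.
  rewrite -[X in X <= _](powRr1 n0) -{1}(subrK q 1) powRD ?nn ?implybT//.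
  rewrite ler_wpM2r ?powR_ge0//; apply: ge0_ler_powR; rewrite ?nnegrE ?subr_ge0//.
  by rewrite mulr_ge0// ltW.
have sub1 z : rect (w1.1 - 2 * (d1 / 4)) (w1.1 + 2 * (d1 / 4))
    (w1.2 - 2 * (d1 / 4)) (w1.2 + 2 * (d1 / 4)) z -> D z.
  by case: z => x y rz; apply: (sub (x, y)); apply: A1A; apply/boxP.
have d140 : 0 < d1 / 4 by clear -d10; lra.
have := area_submean oD d140 df sub1.
rewrite -/(square w1.1 w1.2 (2 * (d1 / 4))) -/A1 => Hsub.
have Hint : (\int[mu2]_(w in A1) (normc (f (pt w)))%:E <= ((K * N1) `^ (1 - q) * T)%:E)%E.
  apply: (@le_trans _ _ (\int[mu2]_(w in A1) (((K * N1) `^ (1 - q))%:E * (normc (f (pt w)) `^ q)%:E))%E).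
    apply: ge0_le_integral.
    - exact: measurable_square.
    - by move=> w _; rewrite lee_fin normc_ge0.
    - apply/measurable_EFinP; apply: (measurable_funS (E := [set w : MT | D (pt w)])).
      + exact: copen_measurable.
      + by move=> w /A1A /sub.
      + exact: measurable_normc.
    - by apply: measurable_funeM; exact: measurable_funS mfq.
    - by move=> w /up1 h; rewrite -EFinM lee_fin.
  rewrite ge0_integralZl//; last 4 first.
  - exact: measurable_square.
  - exact: measurable_funS mfq.
  - by move=> w _; rewrite lee_fin powR_ge0.
  - by rewrite lee_fin powR_ge0.
  rewrite EFinM lee_wpmul2l ?lee_fin ?powR_ge0// -IT.
  apply: ge0_subset_integral => //; first exact: measurable_square.
  by move=> w _; rewrite lee_fin powR_ge0.
have key : (d1 / 4) ^+ 2 * N1 <= 16 * ((K * N1) `^ (1 - q) * T).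
  rewrite -lee_fin; apply: le_trans (_ : _ <= 16%:E * ((K * N1) `^ (1 - q) * T)%:E)%E _; last by rewrite EFinM.
  by apply: le_trans Hsub _; rewrite lee_wpmul2l ?lee_fin.
have N1q : N1 = N1 `^ q * N1 `^ (1 - q).
  by rewrite -powRD ?(gt_eqF N10) ?implybT// addrC subrK powRr1// ltW.
have Np : 0 < N1 `^ (1 - q) by exact: powR_gt0.
have key2 : (d1 / 4) ^+ 2 * N1 `^ q <= 16 * (K `^ (1 - q) * T).
  rewrite -(ler_pM2r Np) -mulrA -N1q; apply: le_trans key _.
  by rewrite powRM ?(ltW K0) ?(ltW N10)// le_eqVlt; apply/orP; left; apply/eqP; ring.
have h0 := PhiM _ c0A; rewrite Phi0 in h0.
have c0 : 0 <= K `^ (1 - q) * T by rewrite mulr_ge0// ltW.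
have -> : 256 * 8 * K `^ (1 - q) * T = 2048 * (K `^ (1 - q) * T) by ring.
have key3 : d1 ^+ 2 * N1 `^ q <= 256 * (K `^ (1 - q) * T).
  by move: key2; rewrite expr_div_n mulrAC ler_pdivrMr ?exprn_gt0//; clear; lra.
move: Hw1 key3 h0 c0; rewrite /Phi -/d1 -/N1 exprMn -(mulrA (2 ^+ 2)).
set ab := d1 ^+ 2 * _; set c := K `^ _ * T; set vu := s ^+ 2 * _.
by rewrite (_ : 2 ^+ 2 = 4 :> R); [clear; lra|ring].
Qed.

Lemma holo_exp (D : set R[i]) f m : (forall z, D z -> exists l, cdiff f z l) ->
  forall z, D z -> exists l, cdiff (fun w => f w ^+ m) z l.
Proof. by move=> df z /df[l /(cdiffX m) dl]; eexists; exact: dl. Qed.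

(** Reduction to an exponent at most 1: |f|^p = |f^m|^(p/m) for an integer m > p, and f^m is again
    holomorphic. *)
Lemma power_submean (p : R) : 0 < p -> exists2 C : R, 0 < C &
  forall (D : set R[i]) f x0 y0 s, copen D -> 0 < s ->
  (forall z, D z -> exists l, cdiff f z l) ->
  (forall w, square x0 y0 (2 * s) w -> D (pt w)) ->
  ((s ^+ 2 * normc (f (cplx x0 y0)) `^ p)%:E <=
  C%:E * \int[mu2]_(w in square x0 y0 (2 * s)) (normc (f (pt w)) `^ p)%:E)%E.
Proof.
move=> p0; pose m := (Num.truncn p).+1.
have pm : p < m%:R by apply: truncnS_gt.
have m0 : 0 < m%:R :> R by rewrite ltr0n.
have [|C C0 HC] := @quasi_submean (p / m%:R).
  by rewrite divr_gt0//= ler_pdivrMr// mul1r ltW.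
exists C => // D f x0 y0 s oD s0 df sub.
have E z : normc (f z ^+ m) `^ (p / m%:R) = normc (f z) `^ p.
  rewrite normcX -powR_mulrn ?normc_ge0// -powRrM mulrCA mulfV ?mulr1//.
  by rewrite gt_eqF.
have := HC D (fun z => f z ^+ m) x0 y0 s oD s0 (holo_exp m df) sub.
by rewrite E; under eq_integral do rewrite E.
Qed.

End QuasiSubmean.

(** * Weighted Dirichlet spaces *)

Section Disc.
Context {R : realType}.
Local Notation MT := (measurableTypeR R * measurableTypeR R)%type.
Local Notation mu2 := (@lebesgue_measure R \x @lebesgue_measure R)%E.
Local Notation disc := (@unit_disc R).
Implicit Types (f g h : R[i] -> R[i]) (z : R[i]).

Definition pdisc : set MT := [set w | disc (pt w)].

Lemma normc_ball_sub z w : normc w <= normc z + normc (w - z).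
Proof. by rewrite -{1}(subrK z w) addrC le_normcD. Qed.

Lemma copen_disc : copen disc.
Proof.
move=> z; rewrite /unit_disc /= => zD; exists (1 - normc z); first by rewrite subr_gt0.
by move=> w wz; have := normc_ball_sub z w; lra.
Qed.

Lemma measurable_pdisc : measurable pdisc.
Proof. apply: copen_measurable; exact: copen_disc. Qed.

(** With d = 1 - |z|, the square of half-side d/2 around z lies within 3d/4 of z, as the square root
    of 2 is below 3/2; so 1 - |w| stays between d/4 and 7d/4. *)
Lemma near_square z w : disc z -> square (complex.Re z) (complex.Im z) ((1 - normc z) / 2) w ->
  (1 - normc z) / 4 <= 1 - normc (pt w) <= 2 * (1 - normc z).
Proof.
move=> zD /squareP[h1 h2]; set n := normc (pt w); set d := 1 - normc z in h1 h2 *.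
have d0 : 0 < d by rewrite subr_gt0.
have E : normc (pt w - z) <= 3 / 4 * d.
  rewrite -(@ler_pXn2r _ 2)// ?nnegrE ?normc_ge0//; last by rewrite mulr_ge0// ltW.
  rewrite normc_sqr cReB cImB /=.
  rewrite -(real_normK (num_real (w.1 - _))) -(real_normK (num_real (w.2 - _))).
  have p2 (x : R) : 0 <= x -> x <= d / 2 -> x ^+ 2 <= (d / 2) ^+ 2.
    by move=> x0 xd; rewrite ler_pXn2r ?nnegrE//; lra.
  apply: le_trans (lerD (p2 _ (normr_ge0 _) h1) (p2 _ (normr_ge0 _) h2)) _.
  by have := sqr_ge0 d; rewrite !exprMn !expr2; nra.
have := normc_ball_sub z (pt w); have := normc_ball_sub (pt w) z; rewrite (normcB z).
by rewrite -/n; move: E; rewrite /d; move=> E A B; apply/andP; split; lra.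
Qed.

Lemma near_square_disc z w : disc z ->
  square (complex.Re z) (complex.Im z) ((1 - normc z) / 2) w -> disc (pt w).
Proof.
move=> zD /(near_square zD)/andP[h _]; move: zD h; rewrite /unit_disc /=; lra.
Qed.

Lemma holD_cdiff f z : holD f -> disc z -> cdiff f z (cderiv f z).
Proof. by move=> hf zD; apply: derivable_cdiff; exact: hf. Qed.

Lemma rect_square (x y r : R) z : rect (x - r) (x + r) (y - r) (y + r) z ->
  square x y r (complex.Re z, complex.Im z).
Proof. by case: z => u v H; apply/boxP. Qed.

Lemma holD_deriv f z : holD f -> disc z -> exists l, cdiff (cderiv f) z l.
Proof.
move=> hf zD; have d0 : 0 < 1 - normc z by rewrite subr_gt0.
apply: (@holo_deriv _ (complex.Re z - (1 - normc z) / 2) (complex.Re z + (1 - normc z) / 2)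
  (complex.Im z - (1 - normc z) / 2) (complex.Im z + (1 - normc z) / 2) z f).
  by split; lra.
move=> w /rect_square/(near_square_disc zD); rewrite /pt cplxK; exact: holD_cdiff.
Qed.

Lemma holD_deriv_cont f z : holD f -> disc z -> ccont (cderiv f) z.
Proof. by move=> hf /(holD_deriv hf)[l]; exact: cdiff_ccont. Qed.

Lemma normc1B_bounds z : disc z -> 1 - normc z <= 1 - normc z ^+ 2 <= 2 * (1 - normc z).
Proof. rewrite /unit_disc /= => zD; have := normc_ge0 z; rewrite expr2; nra. Qed.

Lemma normc1B_gt0 z : disc z -> 0 < 1 - normc z ^+ 2.
Proof.
move=> zD; apply: lt_le_trans (proj1 (andP (normc1B_bounds zD))).
by rewrite subr_gt0.
Qed.

Definition density (p alpha : R) h (w : MT) : R :=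
  (1 - normc (pt w) ^+ 2) `^ alpha * normc (h (pt w)) `^ p.

Lemma density_ge0 p alpha h w : 0 <= density p alpha h w.
Proof. by rewrite mulr_ge0 ?powR_ge0. Qed.

Lemma measurable_density p alpha h : 0 < p -> (forall z, disc z -> ccont h z) ->
  measurable_fun pdisc (fun w => (density p alpha h w)%:E).
Proof.
move=> p0 ch; apply/measurable_EFinP; apply: measurable_funM; last first.
  exact: continuous_powR_norm copen_disc p0 ch.
apply: (measurableT_comp (f := fun x : R => x `^ alpha)); first exact: measurable_powR.
apply: measurable_funB => //; apply: measurable_funX.
by apply: (@measurable_normc _ disc (fun z => z) copen_disc) => z _; exact: ccont_id.
Qed.

(** The factor 1/pi does not affect finiteness. *)
Lemma dirichletP p alpha f : weighted_dirichlet p alpha f <->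
  holD f /\ (\int[mu2]_(w in pdisc) (density p alpha (cderiv f) w)%:E < +oo)%E.
Proof.
rewrite /weighted_dirichlet /= /disc_integral.
set I := (\int[_]_(_ in _) _)%E.
have I0 : (0 <= I)%E.
  by apply: integral_ge0 => w _; rewrite lee_fin mulr_ge0 ?powR_ge0.
have pi0 : 0 < (pi : R)^-1 by rewrite invr_gt0 pi_gt0.
split=> -[hf H]; split => //.
  rewrite ltey; apply/eqP => E; move: H; rewrite E gt0_muley ?lte_fin//.
by case: (I) I0 H => // r _ _; rewrite -EFinM ltry.
Qed.

(** The sign of [alpha] decides which end of the interval is the worst; the absolute value in the
    constant covers both. *)
Lemma powR_comparable (alpha d x : R) : 0 < d -> d / 4 <= x <= 4 * d ->
  4 `^ (- `|alpha|) * d `^ alpha <= x `^ alpha.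
Proof.
move=> d0 /andP[h1 h2]; have d40 : 0 < d / 4 by lra.
have x0 : 0 < x by lra.
have [a0|a0] := leP 0 alpha.
  rewrite ger0_norm// powRN mulrC -ler_pdivlMr ?invr_gt0 ?powR_gt0// invrK.
  rewrite -powRM ?(ltW x0)//; apply: ge0_ler_powR; rewrite ?nnegrE ?mulr_ge0 ?(ltW d0) ?(ltW x0)//; lra.
rewrite ltr0_norm// opprK -powRM ?(ltW d0)//.
have -> : alpha = - (- alpha) by rewrite opprK.
rewrite !(powRN _ (- alpha)) lef_pV2 ?posrE ?powR_gt0//; last lra.
apply: ge0_ler_powR; rewrite ?nnegrE ?oppr_ge0 ?(ltW a0) ?(ltW x0)//; lra.
Qed.

(** This is [power_submean] at scale (1 - |z|)/4: on the resulting square the weight is comparable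
    with (1 - |z|)^alpha and can be moved inside the integral. *)
Lemma pointwise_estimate (p alpha : R) : 0 < p -> exists2 C : R, 0 < C &
  forall h z, (forall z, disc z -> exists l, cdiff h z l) -> disc z ->
  ((((1 - normc z) ^+ 2 * (1 - normc z) `^ alpha) * normc (h z) `^ p)%:E <=
   C%:E * \int[mu2]_(w in square (complex.Re z) (complex.Im z) ((1 - normc z) / 2))
     (density p alpha h w)%:E)%E.
Proof.
move=> p0; have [C C0 HC] := @power_submean R p p0.
pose c : R := 4 `^ (- `|alpha|); have c0 : 0 < c by exact: powR_gt0.
exists (16 * C / c); first by rewrite divr_gt0 ?mulr_gt0.
move=> h z dh zD; set d := 1 - normc z; have d0 : 0 < d by rewrite subr_gt0.
have d40 : 0 < d / 4 by rewrite divr_gt0.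
have ch u : disc u -> ccont h u by move=> /dh[l]; exact: cdiff_ccont.
have := HC disc h (complex.Re z) (complex.Im z) (d / 4) copen_disc d40 dh.
have -> : 2 * (d / 4) = d / 2 by field.
move=> /(_ (fun w => near_square_disc zD)); rewrite cplxK.
set A := square _ _ _ => H.
have mA : measurable A by exact: measurable_square.
have Adisc : A `<=` pdisc by move=> w; exact: near_square_disc.
have mh : measurable_fun A (fun w => (normc (h (pt w)) `^ p)%:E).
  apply: measurable_funS Adisc _; first exact: measurable_pdisc.
  by apply/measurable_EFinP; exact: continuous_powR_norm copen_disc p0 ch.
have md : measurable_fun A (fun w => (density p alpha h w)%:E).
  by apply: measurable_funS Adisc _; [exact: measurable_pdisc|exact: measurable_density].
have da0 : 0 < d `^ alpha by exact: powR_gt0.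
have le1 : ((c * d `^ alpha)%:E * \int[mu2]_(w in A) (normc (h (pt w)) `^ p)%:E <=
   \int[mu2]_(w in A) (density p alpha h w)%:E)%E.
  rewrite -ge0_integralZl//; last 2 first.
  - by move=> w _; rewrite lee_fin powR_ge0.
  - by rewrite lee_fin mulr_ge0 ?powR_ge0.
  apply: ge0_le_integral => //.
  - by move=> w _; rewrite -EFinM lee_fin mulr_ge0 ?powR_ge0// mulr_ge0 ?powR_ge0.
  - exact: measurable_funeM.
  move=> w Aw; rewrite -EFinM lee_fin ler_wpM2r ?powR_ge0//.
  have wD := near_square_disc zD Aw.
  have /andP[h1 h2] := near_square zD Aw; have /andP[h3 h4] := normc1B_bounds wD.
  by apply: powR_comparable => //; rewrite -/d in h1 h2; lra.
move: H le1; set I := (\int[_]_(_ in _) _)%E; set I' := (\int[_]_(_ in _) _)%E => H le1.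
have cd0 : 0 < c * d `^ alpha by rewrite mulr_gt0.
have -> : (d ^+ 2 * d `^ alpha * normc (h z) `^ p)%:E =
  (((16 / c) * (c * d `^ alpha))%:E * ((d / 4) ^+ 2 * normc (h z) `^ p)%:E)%E.
  by rewrite -EFinM; congr EFin; field; rewrite gt_eqF.
apply: le_trans (lee_wpmul2l _ H) _.
  by rewrite lee_fin mulr_ge0 ?divr_ge0 ?(ltW c0) ?(ltW cd0).
have -> : (((16 / c) * (c * d `^ alpha))%:E * (C%:E * I) =
  (16 * C / c)%:E * ((c * d `^ alpha)%:E * I))%E.
  by rewrite !muleA -!EFinM; congr (_%:E * _)%E; field; rewrite gt_eqF.
by rewrite lee_wpmul2l// lee_fin divr_ge0 ?mulr_ge0// ltW.
Qed.

(** The pointwise estimate bounds |F'| by K (1 - |z|)^-ga; on the segment from 0 to 1 - 2^-N, of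
    length at most 1, this is at most K 2^(ga N). *)
Lemma weighted_dirichlet_growth (p alpha : R) F : 0 < p -> weighted_dirichlet p alpha F ->
  exists C B : R, [/\ 0 <= C, 1 <= B & forall N : nat,
    normc (F (((1 - 2^-1 ^+ N) : R)%:C)%C) <= C + C * B ^+ N].
Proof.
move=> p0 /dirichletP[hF IF]; have [C0 C00 HC0] := @pointwise_estimate p alpha p0.
set I := (\int[_]_(_ in _) _)%E in IF.
have I0 : (0 <= I)%E by apply: integral_ge0 => w _; rewrite lee_fin density_ge0.
have [T IT] : exists T, I = T%:E by case: (I) I0 IF => // t _ _; exists t.
have T0 : 0 <= T by rewrite -lee_fin -IT.
have dF z : disc z -> exists l, cdiff (cderiv F) z l by exact: holD_deriv.
have cF z : disc z -> ccont (cderiv F) z by exact: holD_deriv_cont.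
(* Truncation at 0 makes the bound on |F'| monotone in 1 - |z| and yields [1 <= B]. *)
pose ga := Num.max 0 ((2 + alpha) / p).
have ga0 : 0 <= ga by rewrite le_max lexx.
pose K := (C0 * T) `^ p^-1.
have bnd z : disc z -> normc (cderiv F z) <= K * (1 - normc z) `^ (- ga).
  move=> zD; set d := 1 - normc z; have d0 : 0 < d by rewrite subr_gt0.
  have : (d ^+ 2 * d `^ alpha * normc (cderiv F z) `^ p) <= C0 * T.
    rewrite -lee_fin; apply: le_trans (HC0 _ _ dF zD) _.
    rewrite EFinM lee_wpmul2l ?lee_fin ?(ltW C00)// -IT.
    apply: ge0_subset_integral.
    - exact: measurable_square.
    - exact: measurable_pdisc.
    - exact: measurable_density.
    - by move=> w _; rewrite lee_fin density_ge0.
    - by move=> w; exact: near_square_disc.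
  rewrite -[d ^+ 2]powR_mulrn ?(ltW d0)// -powRD ?(gt_eqF d0) ?implybT// => H.
  have dp : 0 < d `^ (2 + alpha) by exact: powR_gt0.
  rewrite mulrC -ler_pdivlMr// in H.
  have pV0 : 0 <= p^-1 by rewrite invr_ge0 ltW.
  have : (normc (cderiv F z) `^ p) `^ p^-1 <= (C0 * T / d `^ (2 + alpha)) `^ p^-1.
    apply: ge0_ler_powR => //; rewrite nnegrE ?powR_ge0// divr_ge0 ?mulr_ge0//; exact: ltW.
  rewrite -powRrM mulfV ?gt_eqF// powRr1 ?normc_ge0// => /le_trans; apply.
  rewrite powRM ?invr_ge0 ?(ltW dp) ?mulr_ge0 ?(ltW C00)// ler_wpM2l ?powR_ge0//.
  rewrite -powRN -powRrM mulNr; apply: ger_powR.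
    by rewrite d0 /d lerBlDr lerDl normc_ge0.
  by rewrite lerN2 le_max lexx orbT.
pose B : R := 2 `^ ga.
have B1 : 1 <= B by rewrite /B -[X in X <= _](powRr0 2); apply: ler_powR => //; rewrite ler1n.
have K0 : 0 <= K by exact: powR_ge0.
exists (normc (F 0) + 2 * K), B; split => //; first by rewrite addr_ge0 ?normc_ge0// mulr_ge0.
move=> N; set x := 1 - 2^-1 ^+ N.
have q0 : 0 < (2^-1 : R) ^+ N by rewrite exprn_gt0 ?invr_gt0.
have q1 : (2^-1 : R) ^+ N <= 1 by rewrite exprn_ile1 ?invr_ge0 ?invf_le1 ?ler1n.
have x01 : 0 <= x <= 1 by rewrite /x; lra.
have tx (t : R) : 0 <= t <= 1 -> normc (0 + (t%:C)%C * (x%:C)%C) <= x.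
  case/andP: x01 => x0 _ /andP[t0 t1]; rewrite add0r Normc.normcM !normc_real !ger0_norm//.
  by rewrite ler_piMl.
have tD (t : R) : 0 <= t <= 1 -> disc (0 + (t%:C)%C * (x%:C)%C).
  by move=> /tx H; rewrite /unit_disc /=; apply: le_lt_trans H _; rewrite /x; lra.
have := @cdiff_MVI _ F (cderiv F) 0 (x%:C)%C (K * B ^+ N).
move=> /(_ (fun t ht => holD_cdiff hF (tD t ht))) H.
have {}H := H _.
rewrite add0r in H.
have n1 : normc (x%:C)%C <= 1 by rewrite normc_real ger0_norm; case/andP: x01.
have BN : 0 <= B ^+ N by rewrite exprn_ge0// (le_trans _ B1).
have M0 : 0 <= 2 * (K * B ^+ N) by rewrite !mulr_ge0.
have H2 : normc (F (x%:C)%C - F 0) <= 2 * (K * B ^+ N).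
  apply: le_trans (H _) _.
    move=> t ht; apply: le_trans (bnd _ (tD t ht)) _; rewrite ler_wpM2l//.
    have -> : B ^+ N = (2^-1 ^+ N) `^ (- ga).
      rewrite -powR_mulrn ?powR_ge0// /B -powRrM mulrC powRrM powR_mulrn//.
      by rewrite exprVn -[(_ ^+ _)^-1]powR_inv1 ?exprn_ge0// -powRrM mulN1r opprK.
    rewrite !powRN lef_pV2 ?posrE ?powR_gt0//; last first.
      by rewrite subr_gt0; exact: tD.
    apply: ge0_ler_powR; rewrite ?nnegrE ?(ltW q0) ?subr_ge0//.
      by apply: ltW; exact: tD.
    by have := tx t ht; rewrite /x; lra.
  by rewrite -[leRHS]mulr1 ler_wpM2l.
have := normc_sub_le (F (x%:C)%C) (F 0); have := normc_ge0 (F 0).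
have : normc (F 0) * 1 <= normc (F 0) * (1 + B ^+ N).
  by rewrite ler_wpM2l ?normc_ge0// lerDl.
set b := B ^+ N in H2 BN *; set m := normc (F 0); set y := normc (F _); nra.
Qed.

End Disc.

(** * Growth of functions of the Dirichlet space *)

Section Growth.
Context {R : realType}.
Local Notation MT := (measurableTypeR R * measurableTypeR R)%type.
Local Notation mu2 := (@lebesgue_measure R \x @lebesgue_measure R)%E.
Local Notation disc := (@unit_disc R).
Implicit Types (f g h : R[i] -> R[i]) (z : R[i]).
Local Notation half n := ((2^-1 : R) ^+ n).

Lemma ihalf_gt0 n : 0 < half n. Proof. by rewrite exprn_gt0 ?invr_gt0. Qed.

Lemma ihalf_le1 n : half n <= 1.
Proof. by rewrite exprn_ile1 ?invr_ge0 ?invf_le1 ?ler1n. Qed.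

Lemma ihalfS n : half n.+1 = half n / 2. Proof. by rewrite exprSr. Qed.

Lemma ihalf_small (e : R) : 0 < e -> exists n, half n < e.
Proof.
move=> e0; have : half n @[n --> \oo] --> (0 : R).
  by apply: cvg_expr; rewrite gtr0_norm ?invr_gt0// invf_lt1// ltr1n.
move=> /cvgrPdist_lt/(_ _ e0)[n _ Hn]; exists n; have := Hn n (leqnn n).
by rewrite sub0r normrN gtr0_norm ?ihalf_gt0.
Qed.

Lemma dyadic (x : R) : 0 < x <= 1 -> exists n, half n.+1 < x <= half n.
Proof.
move=> /andP[x0 x1]; have [m Hm] := ihalf_small x0.
have ex : exists n, half n < x by exists m.
case: (ex_minnP ex) => -[|n] Hn min.
  by move: Hn; rewrite expr0 ltNge x1.
exists n; rewrite Hn leNgt; apply/negP => /min; by rewrite ltnn.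
Qed.

(** Telescoping. The energies of annuli that overlap m at a time are differences of this form, so
    the overlap costs only a factor m. *)
Lemma sum_shift_diff (u : nat -> R) m n : (forall k, 0 <= u k) ->
  \sum_(k < n) (u k - u (k + m)%N) <= \sum_(i < m) u i.
Proof.
move=> u0; rewrite sumrB lerBlDr.
have -> : \sum_(i < m) u i + \sum_(k < n) u (k + m)%N = \sum_(i < m + n) u i.
  rewrite big_split_ord /=; congr (_ + _); apply: eq_bigr => i _.
  by rewrite addnC.
by rewrite addnC big_split_ord /= lerDl sumr_ge0.
Qed.

Lemma sum_sqr_le (b : nat -> R) n :
  (\sum_(k < n) b k) ^+ 2 <= n%:R * \sum_(k < n) b k ^+ 2.
Proof.
elim: n => [|n IH]; first by rewrite !big_ord0 expr0n mulr0.
rewrite !big_ord_recr /=; set s := \sum_(_ < n) _ in IH *; set q := \sum_(_ < n) _ in IH *.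
have n0 : 0 <= n%:R :> R by [].
have q0 : 0 <= q by apply: sumr_ge0 => i _; exact: sqr_ge0.
rewrite -natr1; set N := n%:R in IH n0 *; set x := b n.
have [N0|N0] := eqVneq N 0.
  have s0 : s = 0.
    by apply/eqP; rewrite -sqrf_eq0 eq_le sqr_ge0 andbT (le_trans IH)// N0 mul0r.
  by rewrite s0 N0 !add0r mul1r lerDr.
have Np : 0 < N by rewrite lt_def N0.
have : 2 * s * x <= q + N * x ^+ 2.
  rewrite -(ler_pM2l Np) -subr_ge0.
  have -> : N * (q + N * x ^+ 2) - N * (2 * s * x) = (N * q - s ^+ 2) + (s - N * x) ^+ 2 by ring.
  by rewrite addr_ge0 ?subr_ge0 ?sqr_ge0.
move=> H; rewrite -subr_ge0.
have -> : (N + 1) * (q + x ^+ 2) - (s + x) ^+ 2 =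
  (N * q - s ^+ 2) + (q + N * x ^+ 2 - 2 * s * x) by ring.
by rewrite addr_ge0 ?subr_ge0.
Qed.

(** A radial segment inside the k-th annulus has length at most 2^-(k+1), and |g| <= b_k 2^(k+1)
    there; the factor 2 is the loss in the complex mean value inequality. *)
Lemma growth_from_layers f g (b : nat -> R) :
  (forall z, disc z -> cdiff f z (g z)) ->
  (forall k z, half k.+1 <= 1 - normc z <= half k -> (1 - normc z) * normc (g z) <= b k) ->
  (forall k, 0 <= b k) ->
  forall n z, normc z <= 1 - half n -> normc (f z - f 0) <= \sum_(k < n) 2 * b k.
Proof.
move=> df gb b0; elim => [|n IH] z.
  rewrite expr0 subrr => z0; have /eqP : normc z == 0 by rewrite eq_le z0 normc_ge0.
  by move=> /Normc.eq0_normc ->; rewrite subrr Normc.normc0 big_ord0.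
move=> zn; rewrite big_ord_recr /=.
have [zn'|zn'] := leP (normc z) (1 - half n).
  by apply: le_trans (IH _ zn') _; rewrite lerDl mulr_ge0.
have hn := ihalf_gt0 n; have hn1 := ihalf_le1 n.
have nz0 : 0 < normc z by lra.
(* [r] projects z radially on the circle of radius 1 - 2^-n, where the induction hypothesis
   applies. *)
pose r := (1 - half n) / normc z.
have r0 : 0 <= r by rewrite divr_ge0 ?normc_ge0//; lra.
have r1 : r <= 1 by rewrite ler_pdivrMr// mul1r ltW.
pose z' := (r%:C)%C * z.
have nz' : normc z' = 1 - half n.
  by rewrite Normc.normcM normc_real ger0_norm// divfK// gt_eqF.
have IHz' : normc (f z' - f 0) <= \sum_(k < n) 2 * b k by apply: IH; rewrite nz'.
pose h := z - z'.
have hE : h = ((1 - r)%:C)%C * z by rewrite rmorphB /= mulrBl mul1r.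
have segE (t : R) : z' + (t%:C)%C * h = ((r + t * (1 - r))%:C)%C * z.
  by apply: cplx_eq; rewrite hE /z' !(cReD, cImD, cReM, cImM) /=; ring.
have nseg (t : R) : 0 <= t <= 1 -> 1 - half n <= normc (z' + (t%:C)%C * h) <= normc z.
  move=> /andP[t0 t1]; rewrite segE Normc.normcM normc_real ger0_norm; last by nra.
  have -> : 1 - half n = r * normc z by rewrite divfK// gt_eqF.
  by rewrite ler_pM2r// ler_piMl ?normc_ge0 ?andbT//; nra.
have nh : normc h <= half n / 2.
  rewrite hE Normc.normcM normc_real ger0_norm ?subr_ge0// mulrBl mul1r divfK ?gt_eqF//.
  by move: zn; rewrite ihalfS; lra.
have hsn : 0 < half n / 2 by lra.
have := @cdiff_MVI _ f g z' h (b n / (half n / 2)).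
have segD (t : R) : 0 <= t <= 1 -> disc (z' + (t%:C)%C * h).
  move=> /nseg/andP[_ H]; rewrite /unit_disc /=; apply: le_lt_trans H _.
  by move: zn; rewrite ihalfS; lra.
move=> /(_ (fun t ht => df _ (segD t ht))) H.
have {H} : normc (f (z' + h) - f z') <= 2 * (b n / (half n / 2)) * normc h.
  apply: H => t ht; have /andP[s1 s2] := nseg t ht.
  have lb : half n / 2 <= 1 - normc (z' + (t%:C)%C * h) by move: zn; rewrite ihalfS; lra.
  move: (z' + _) s1 s2 lb => v s1 s2 lb.
  have G : (1 - normc v) * normc (g v) <= b n by apply: gb; rewrite ihalfS lb; lra.
  by rewrite ler_pdivlMr// mulrC; apply: le_trans G; rewrite ler_wpM2r ?normc_ge0.
rewrite /h (addrC z') subrK => H.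
have -> : f z - f 0 = (f z - f z') + (f z' - f 0) by rewrite subrKA.
apply: le_trans (le_normcD _ _) _; rewrite addrC; apply: lerD => //.
apply: le_trans H _.
apply: le_trans (_ : _ <= 2 * (b n / (half n / 2)) * (half n / 2)) _.
  by rewrite ler_wpM2l// mulr_ge0// divr_ge0// ltW.
by rewrite -mulrA divfK// gt_eqF.
Qed.

Lemma density20 h (w : MT) : density 2 0 h w = normc (h (pt w)) ^+ 2.
Proof. by rewrite /density powRr0 mul1r powR_mulrn// normc_ge0. Qed.

Definition collar (t : R) : set MT := [set w | disc (pt w) /\ 1 - normc (pt w) < t].

Lemma measurable_collar t : measurable (collar t).
Proof.
apply: (@copen_measurable _ [set z | disc z /\ 1 - normc z < t]).
move=> z [zD zt]; have [d d0 Hd] := copen_disc zD.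
exists (Num.min d (t - (1 - normc z))); first by rewrite lt_min d0; lra.
move=> w; rewrite lt_min => /andP[/Hd wD wt]; split => //.
by have := normc_ball_sub w z; rewrite normcB; lra.
Qed.

(* With b_k^2 bounded by the energy of the k-th annulus, enlarged so that five
   consecutive ones overlap, Cauchy-Schwarz bounds (sum_(K <= k < n) b_k)^2 by
   n times the energy beyond the K-th annulus. *)
Lemma dirichlet_growth f : dirichlet f -> forall eta : R, 0 < eta ->
  exists2 C, 0 <= C & forall n z, normc z <= 1 - half n -> normc (f z) ^+ 2 <= eta * n%:R + C.
Proof.
move=> /dirichletP[hf]; set g := cderiv f; set I := (\int[_]_(_ in _) _)%E => Ioo.
have p2 : 0 < 2 :> R by [].
have [C C0 HC] := @pointwise_estimate R 2 0 p2.
have dg z : disc z -> exists l, cdiff g z l by exact: holD_deriv.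
have cg z : disc z -> ccont g z by exact: holD_deriv_cont.
have md : measurable_fun (pdisc : set MT) (fun w => (density 2 0 g w)%:E) by exact: measurable_density.
have d0 (w : MT) : (0 <= (density 2 0 g w)%:E)%E by rewrite lee_fin density_ge0.
have msub (A : set MT) : A `<=` pdisc -> measurable_fun A (fun w => (density 2 0 g w)%:E).
  by move=> AD; apply: measurable_funS AD md; exact: measurable_pdisc.
have leI (A : set MT) : measurable A -> A `<=` pdisc -> (\int[mu2]_(w in A) (density 2 0 g w)%:E <= I)%E.
  by move=> mA AD; apply: ge0_subset_integral => //; exact: measurable_pdisc.
have finI (A : set MT) : measurable A -> A `<=` pdisc ->
    (\int[mu2]_(w in A) (density 2 0 g w)%:E)%E \is a fin_num.
  move=> mA AD; rewrite ge0_fin_numE; last by apply: integral_ge0 => w _.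
  exact: le_lt_trans (leI _ mA AD) Ioo.
(* For z in the k-th annulus the square around z lies where half k / 8 <= 1 - |w| <= 2 half k. As 4
   half (k + 5) = half k / 8, it is contained in U_k minus U_(k+5). *)
pose U k := collar (4 * half k).
have mU k : measurable (U k) by exact: measurable_collar.
have UD k : U k `<=` pdisc by move=> w [].
have UU k j : (k <= j)%N -> U j `<=` U k.
  move=> kj w [wD wj]; split => //; apply: lt_le_trans wj _.
  rewrite ler_pM2l//; apply: ler_wiXn2l => //; rewrite ?invr_ge0 ?invf_le1 ?ler1n//.
pose u k := fine (\int[mu2]_(w in U k) (density 2 0 g w)%:E)%E.
have uE k : (\int[mu2]_(w in U k) (density 2 0 g w)%:E)%E = (u k)%:E.
  by rewrite fineK// finI.
have u0 k : 0 <= u k by rewrite fine_ge0// integral_ge0.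
have udec k j : (k <= j)%N -> u j <= u k.
  by move=> kj; rewrite -lee_fin -!uE; apply: ge0_subset_integral => //; [exact: msub|exact: UU].
have adiff k : (\int[mu2]_(w in U k `\` U (k + 5)%N) (density 2 0 g w)%:E)%E = (u k - u (k + 5)%N)%:E.
  have mD : measurable (U k `\` U (k + 5)%N) by exact: measurableD.
  have E : U k = (U k `\` U (k + 5)%N) `|` U (k + 5)%N by rewrite setUC setDUK//; apply: UU; rewrite leq_addr.
  have := uE k; rewrite {1}E ge0_integral_setU//.
  - rewrite uE => H; rewrite EFinB -H addeK//.
  - by rewrite -E; exact: msub.
  - by apply/disj_setPS => w [[_ nw] w']; exact: nw.
pose b k := Num.sqrt (C * (u k - u (k + 5)%N)).
have b0 k : 0 <= b k by exact: sqrtr_ge0.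
have b2 k : b k ^+ 2 = C * (u k - u (k + 5)%N).
  by rewrite sqr_sqrtr// mulr_ge0 ?(ltW C0)// subr_ge0 udec// leq_addr.
have gb k z : half k.+1 <= 1 - normc z <= half k -> (1 - normc z) * normc (g z) <= b k.
  move=> /andP[k1 k2]; have dz : 0 < 1 - normc z by apply: lt_le_trans k1; exact: ihalf_gt0.
  have zD : disc z by rewrite /unit_disc /=; lra.
  have := HC g z dg zD; rewrite powRr0 mulr1 powR_mulrn ?normc_ge0// -exprMn => H.
  rewrite -(@ler_pXn2r _ 2)// ?nnegrE ?mulr_ge0 ?normc_ge0 ?(ltW dz)//.
  rewrite b2 -lee_fin; apply: le_trans H _; rewrite EFinM lee_wpmul2l ?lee_fin ?(ltW C0)//.
  rewrite -adiff; apply: ge0_subset_integral => //.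
  - exact: measurable_square.
  - exact: measurableD.
  - by apply: msub => w [/UD].
  - move=> w Aw; have wD := near_square_disc zD Aw; have /andP[w1 w2] := near_square zD Aw.
    split; first by split => //; have := ihalf_gt0 k; lra.
    have h5 : half (k + 5) = half k / 32 by rewrite !addnS addn0 !ihalfS; field.
    move=> [_]; rewrite h5 => w3; move: k1; rewrite ihalfS.
    by move: w1 w2 w3; clear; set q := half k; lra.
move=> eta eta0.
(* 40 = 8 * 5, with 8 from (S + 2X)^2 <= 2 S^2 + 8 X^2 and 5 from the overlap. The energies of the
   collars tend to 0 because those of their complements increase to the full energy. *)
have ucvg : exists K, 40 * C * u K <= eta.
  have cv : (\int[mu2]_(w in pdisc `\` U i) (density 2 0 g w)%:E)%E @[i --> \oo] -->
      (\int[mu2]_(w in \bigcup_i (pdisc `\` U i)) (density 2 0 g w)%:E)%E.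
    apply: ge0_nondecreasing_set_cvg_integral => //.
    - apply/nondecreasing_seqP => n; apply/subsetPset => w [wD nw]; split => //.
      by move=> /(UU _ _ (leqnSn n)).
    - by move=> i; apply: measurableD => //; exact: measurable_pdisc.
    - by move=> i; apply: msub => w [].
  have EU : \bigcup_i (pdisc `\` U i) = pdisc.
    apply/seteqP; split => [w [i _ []]//|w wD].
    have w0 : 0 < (1 - normc (pt w)) / 4 by rewrite divr_gt0// subr_gt0; exact: wD.
    have [n Hn] := ihalf_small w0; exists n => //; split => //; move=> [_].
    by move: Hn; set q := half n; lra.
  rewrite EU -/I in cv.
  have If : I \is a fin_num by apply: finI => //; exact: measurable_pdisc.
  have E i : (\int[mu2]_(w in pdisc `\` U i) (density 2 0 g w)%:E)%E = (fine I - u i)%:E.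
    have mD : measurable (pdisc `\` U i) by apply: measurableD => //; exact: measurable_pdisc.
    have E : pdisc = (pdisc `\` U i) `|` U i by rewrite setUC setDUK.
    have : I = (\int[mu2]_(w in pdisc `\` U i) (density 2 0 g w)%:E + (u i)%:E)%E.
      rewrite /I {1}E ge0_integral_setU//.
      - by rewrite uE.
      - by rewrite -E.
      - by apply/disj_setPS => w [[_ nw] w']; exact: nw.
    by move=> ->; rewrite fineD ?finI// ?fin_numE//= addrK fineK// finI// => w [].
  have {}E : (fun i => \int[mu2]_(w in pdisc `\` U i) (density 2 0 g w)%:E)%E =
    (fun i => (fine I - u i)%:E) by apply/funext => i; exact: E.
  rewrite E -(fineK If) in cv.
  have e0 : 0 < eta / (40 * C) by rewrite divr_gt0 ?mulr_gt0.
  move: cv => /fine_cvgP[_] /cvgrPdist_le/(_ _ e0)[K _ HK]; exists K.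
  have := HK K (leqnn K); rewrite /= subKr ger0_norm// ler_pdivlMr ?mulr_gt0// mulrC.
  by [].
have [K HK] := ucvg.
pose S := normc (f 0) + \sum_(k < K) 2 * b k.
have S0 : 0 <= S by rewrite addr_ge0 ?normc_ge0// sumr_ge0// => k _; rewrite mulr_ge0.
exists (2 * S ^+ 2); first by rewrite mulr_ge0// sqr_ge0.
move=> n z zn.
have H1 := growth_from_layers (fun z zD => holD_cdiff hf zD) gb b0 zn.
pose X := \sum_(k < n) b (K + k)%N.
have X0 : 0 <= X by apply: sumr_ge0.
have H2 : normc (f z) <= S + 2 * X.
  have := normc_sub_le (f z) (f 0); rewrite lerBlDr => /le_trans; apply.
  rewrite addrC /S -addrA lerD2l.
  apply: le_trans H1 _.
  apply: (@le_trans _ _ (\sum_(k < K + n) 2 * b k)).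
    by rewrite addnC big_split_ord /= lerDl sumr_ge0// => k _; rewrite mulr_ge0.
  by rewrite big_split_ord /= /X mulr_sumr.
have H3 : X ^+ 2 <= n%:R * (5 * C * u K).
  apply: le_trans (sum_sqr_le (fun k => b (K + k)%N) n) _; rewrite ler_wpM2l//.
  under eq_bigr => k _ do rewrite b2.
  rewrite -mulr_sumr (mulrC 5) -mulrA ler_wpM2l ?(ltW C0)//.
  under eq_bigr => k _ do rewrite -addnA.
  apply: le_trans (@sum_shift_diff (fun k => u (K + k)%N) 5 n _) _ => //.
  rewrite (_ : 5 * u K = \sum_(i < 5) u K); last by rewrite sumr_const card_ord mulr_natl.
  by apply: ler_sum => i _; rewrite udec// leq_addr.
have nf0 := normc_ge0 (f z).
have H4 : normc (f z) ^+ 2 <= (S + 2 * X) ^+ 2 by rewrite ler_pXn2r ?nnegrE// addr_ge0 ?mulr_ge0.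
apply: le_trans H4 _.
have H5 : (S + 2 * X) ^+ 2 <= 2 * S ^+ 2 + 8 * X ^+ 2.
  have : 0 <= (S - 2 * X) ^+ 2 by exact: sqr_ge0.
  by clear; rewrite !expr2; nra.
apply: le_trans H5 _; rewrite addrC lerD2r.
apply: le_trans (_ : 8 * (n%:R * (5 * C * u K)) <= _); first by rewrite ler_pM2l.
have -> : 8 * (n%:R * (5 * C * u K)) = (40 * C * u K) * n%:R by ring.
by rewrite ler_wpM2r.
Qed.

End Growth.

(** * Integrability of powers of 1 - |z|^2 *)

Section WeightIntegral.
Context {R : realType}.
Local Notation MT := (measurableTypeR R * measurableTypeR R)%type.
Local Notation mu := (@lebesgue_measure R).
Local Notation mu2 := (@lebesgue_measure R \x @lebesgue_measure R)%E.
Local Notation disc := (@unit_disc R).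
Implicit Types (f g h : R[i] -> R[i]) (z : R[i]).
Local Notation half n := ((2^-1 : R) ^+ n).

Lemma nneseries_bound (u : nat -> \bar R) (B : \bar R) : (forall n, 0 <= u n)%E ->
  (forall n, \sum_(0 <= k < n) u k <= B)%E -> (\sum_(0 <= k <oo) u k <= B)%E.
Proof.
move=> u0 uB; apply: lime_le; first exact: is_cvg_nneseries.
by near=> n; exact: uB.
Unshelve. all: by end_near. Qed.

Lemma copenI (A B : set R[i]) : copen A -> copen B -> copen (A `&` B).
Proof.
move=> oA oB z [/oA[d d0 Hd] /oB[e e0 He]]; exists (Num.min d e); first by rewrite lt_min d0.
by move=> w; rewrite lt_min => /andP[/Hd ? /He ?].
Qed.

Lemma copen_gt (u : R[i] -> R) (t : R) :
  (forall z, forall e : R, 0 < e -> exists2 d : R, 0 < d &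
     forall w, normc (w - z) < d -> `|u w - u z| < e) -> copen [set z | t < u z].
Proof.
move=> cu z /= tz; have e0 : 0 < u z - t by rewrite subr_gt0.
have [d d0 Hd] := cu z _ e0; exists d => // w /Hd; rewrite ltr_norml => /andP[h _]; lra.
Qed.

Lemma copen_outside (t : R) : copen [set z : R[i] | 1 - t < normc z ^+ 2].
Proof.
apply: copen_gt => z e e0.
have c2 : ccont (fun w : R[i] => w ^+ 2) z by apply: ccontX; exact: ccont_id.
by have [d d0 Hd] := ccont_normc_eps c2 e0; exists d => // w /Hd; rewrite !normcX.
Qed.

Definition outer_ring (t : R) : set R[i] := disc `&` [set z | 1 - t < normc z ^+ 2].

Lemma copen_outer_ring t : copen (outer_ring t).
Proof. by apply: copenI; [exact: copen_disc|exact: copen_outside]. Qed.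

Lemma mu_itv (a b : R) : a <= b -> mu `[a, b]%classic = (b - a)%:E.
Proof.
rewrite le_eqVlt => /predU1P[<-|ab].
  by rewrite set_itv1 lebesgue_measure_set1 subrr.
by have := lebesgue_measure_itv `[a, b]; rewrite /= lte_fin ab.
Qed.

Definition slab (t : R) : R -> \bar R := (fun=> (2 * t)%:E) \_ (`[-1, 1]%classic : set R).

(** On the slice y^2 ranges over an interval of length at most t, and its derivative in |y| is at
    least 1 because |y| > 1/2; so |y| ranges over an interval of length t, and [p] is its lower end.
    The two signs of y give 2t. *)
Lemma slice_bound (t x : R) (A : set R) : 0 < t -> measurable (A : set (measurableTypeR R)) ->
  (forall y, A y -> [/\ 2^-1 < `|y|, 1 - t < x ^+ 2 + y ^+ 2 & x ^+ 2 + y ^+ 2 < 1]) ->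
  (mu A <= slab t x)%E.
Proof.
move=> t0 mA HA; rewrite /slab patchE; case: ifPn => [_|]; last first.
  rewrite notin_setE /= in_itv /= => xn.
  have -> : A = set0; last by rewrite measure0.
  rewrite -subset0 => y /HA[_ _ h]; apply: xn.
  have : x ^+ 2 <= 1 by have := sqr_ge0 y; lra.
  by move=> x1; rewrite -ler_norml -(@ler_pXn2r _ 2)// ?nnegrE// expr1n real_normK ?num_real.
pose p := Num.sqrt (Num.max (4^-1) (1 - t - x ^+ 2)).
have m4 : 4^-1 <= Num.max (4^-1) (1 - t - x ^+ 2) by rewrite le_max lexx.
have p2 : p ^+ 2 = Num.max (4^-1) (1 - t - x ^+ 2).
  by rewrite sqr_sqrtr//; apply: le_trans m4; rewrite invr_ge0.
have p0 : 0 <= p by exact: sqrtr_ge0.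
have ph : 2^-1 <= p.
  rewrite -(@ler_pXn2r _ 2)// ?nnegrE ?invr_ge0//.
  by rewrite p2 (_ : 2^-1 ^+ 2 = 4^-1)//; field.
have sub : A `<=` `[p, p + t]%classic `|` `[- (p + t), - p]%classic.
  move=> y /HA[y1 y2 y3].
  have yp : p <= `|y|.
    rewrite -(@ler_pXn2r _ 2)// ?nnegrE// p2 real_normK ?num_real// ge_max; apply/andP; split.
      have : 2^-1 ^+ 2 < `|y| ^+ 2 by rewrite ltr_pXn2r ?nnegrE ?invr_ge0.
      rewrite real_normK ?num_real// (_ : 2^-1 ^+ 2 = 4^-1); first exact: ltW.
      by field.
    lra.
  have ypt : `|y| <= p + t.
    rewrite -(@ler_pXn2r _ 2)// ?nnegrE ?addr_ge0 ?(ltW t0)// real_normK ?num_real//.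
    have : 1 - t - x ^+ 2 <= p ^+ 2 by rewrite p2 le_max lexx orbT.
    have : t <= 2 * (p * t) by rewrite mulrA ler_peMl ?(ltW t0)//; lra.
    by rewrite sqrrD -mulr_natl; have := sqr_ge0 t; lra.
  have [y0|y0] := leP 0 y.
    by left; rewrite /= in_itv /=; rewrite ger0_norm// in yp ypt; rewrite yp.
  by right; rewrite /= in_itv /=; rewrite ltr0_norm// in yp ypt; apply/andP; split; lra.
have mI (a b : R) : measurable (`[a, b]%classic : set (measurableTypeR R)) by [].
apply: (@le_trans _ _ (mu (`[p, p + t]%classic `|` `[- (p + t), - p]%classic))).
  by apply: le_measure; rewrite ?inE//; apply: measurableU.
apply: le_trans (measureU2 _ (mI _ _) (mI _ _)) _.
apply: (@le_trans _ _ ((p + t - p)%:E + (- p - - (p + t))%:E)%E); last first.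
  by rewrite -EFinD lee_fin; lra.
by apply: leeD; rewrite le_eqVlt; apply/orP; left; apply/eqP; apply: mu_itv; lra.
Qed.

Lemma measurable_slab t : measurable_fun [set: R] (slab t).
Proof. by apply/measurable_restrict => //; exact: measurable_cst. Qed.

Lemma slab_bound (t : R) : 0 < t ->
  (\int[mu]_x slab t x = (4 * t)%:E)%E.
Proof.
move=> t0; rewrite /slab -integral_mkcond integral_cst//=.
rewrite mu_itv; last lra.
by rewrite -EFinM; congr EFin; ring.
Qed.

(** For t <= 1/2 the squares of the coordinates add up to more than 1/2, so one coordinate exceeds
    1/2 in modulus; slicing along it avoids the long tangential slices, and each of the two pieces
    has area at most 4t. For t > 1/2 the square around the disc has area 4 < 8t. *)
Lemma ring_area (t : R) : 0 < t -> (mu2 [set w | outer_ring t (pt w)] <= (8 * t)%:E)%E.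
Proof.
move=> t0.
have mr : measurable ([set w | outer_ring t (pt w)] : set MT) by apply: copen_measurable; exact: copen_outer_ring.
have [t2|t2] := ltP 2^-1 t.
  apply: (@le_trans _ _ (mu2 (box (-1) 1 (-1) 1))).
    apply: le_measure; rewrite ?inE//; first exact: measurable_box.
    move=> w [] ; rewrite /unit_disc /= => wD _; apply/boxP; split.
      by rewrite -ler_norml (le_trans (le_Re_normc _))// ltW.
    by rewrite -ler_norml (le_trans (le_Im_normc _))// ltW.
  rewrite /box product_measure1E//.
  apply: (@le_trans _ _ ((1 - -1)%:E * (1 - -1)%:E)%E); last by rewrite -EFinM lee_fin; lra.
  by rewrite le_eqVlt; apply/orP; left; apply/eqP; congr (_ * _)%E; apply: mu_itv; lra.
pose A1 : set MT := [set w | (outer_ring t `&` [set z | 2^-1 < `|complex.Im z|]) (pt w)].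
pose A2 : set MT := [set w | (outer_ring t `&` [set z | 2^-1 < `|complex.Re z|]) (pt w)].
have m1 : measurable A1.
  apply: copen_measurable; apply: copenI; first exact: copen_outer_ring.
  apply: copen_gt => z e e0; exists e => // w wz; apply: le_lt_trans wz.
  apply: le_trans (le_Im_normc _); rewrite cImB.
  exact: ler_dist_dist.
have m2 : measurable A2.
  apply: copen_measurable; apply: copenI; first exact: copen_outer_ring.
  apply: copen_gt => z e e0; exists e => // w wz; apply: le_lt_trans wz.
  apply: le_trans (le_Re_normc _); rewrite cReB.
  exact: ler_dist_dist.
have sub : [set w | outer_ring t (pt w)] `<=` A1 `|` A2.
  move=> w Hw; have [H|H] := ltP 2^-1 `|complex.Im (pt w)|; first by left.
  right; split => //=; rewrite ltNge; apply/negP => H2.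
  have {}H2 : `|complex.Re (pt w)| <= 2^-1 by [].
  have : 1 - t < normc (pt w) ^+ 2 by case: Hw.
  rewrite normc_sqr.
  have sq (x : R) : `|x| <= 2^-1 -> x ^+ 2 <= 4^-1.
    move=> hx; rewrite -(real_normK (num_real x)) (_ : 4^-1 = 2^-1 ^+ 2); last by field.
    by rewrite ler_pXn2r ?nnegrE ?invr_ge0.
  have := sq _ H; have := sq _ H2; set a := complex.Re _ ^+ 2; set b := complex.Im _ ^+ 2; lra.
have prop w : outer_ring t (pt w) -> 1 - t < w.1 ^+ 2 + w.2 ^+ 2 /\ w.1 ^+ 2 + w.2 ^+ 2 < 1.
  move=> [wD H]; have {}H : 1 - t < normc (pt w) ^+ 2 by [].
  split; first by rewrite normc_sqr in H.
  have : normc (pt w) ^+ 2 < 1 by rewrite expr_lt1 ?normc_ge0.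
  by rewrite normc_sqr.
apply: (@le_trans _ _ (mu2 (A1 `|` A2))).
  by apply: le_measure; rewrite ?inE//; apply: measurableU.
apply: le_trans (measureU2 _ m1 m2) _.
have -> : 8 * t = 4 * t + 4 * t by ring.
rewrite EFinD; apply: leeD.
  rewrite -slab_bound// /product_measure1; apply: ge0_le_integral => //.
  - exact: measurable_fun_xsection.
  - exact: measurable_slab.
  - move=> x _; apply: slice_bound => //; first exact: measurable_xsection.
    by move=> y; rewrite /xsection /= inE => -[/prop[h1 h2] h3].
have E : mu2 A2 = (\int[mu]_y (mu \o ysection A2) y)%E.
  have := @indic_fubini_tonelli _ _ _ _ R mu mu A2 m2.
  by rewrite indic_fubini_tonelli_FE// indic_fubini_tonelli_GE.
apply: (@le_trans _ _ (\int[mu]_y (mu \o ysection A2) y)%E).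
  by rewrite le_eqVlt; apply/orP; left; apply/eqP; exact: E.
rewrite -slab_bound//; apply: ge0_le_integral => //.
- exact: measurable_fun_ysection.
- exact: measurable_slab.
- move=> y _; apply: slice_bound => //; first exact: measurable_ysection.
  by move=> x; rewrite /ysection /= inE => -[/prop[h1 h2] h3]; rewrite !(addrC (y ^+ 2)).
Qed.

Definition weight (beta : R) (w : MT) : R := (1 - normc (pt w) ^+ 2) `^ beta.

Lemma measurable_weight beta : measurable_fun (pdisc : set MT) (fun w => (weight beta w)%:E).
Proof.
apply/measurable_EFinP; rewrite /weight.
apply: (measurableT_comp (f := fun x : R => x `^ beta)); first exact: measurable_powR.
apply: measurable_funB => //; apply: measurable_funX.
by apply: (@measurable_normc _ disc (fun z => z) copen_disc) => z _; exact: ccont_id.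
Qed.

Lemma geo_partial (r : R) n : 0 <= r < 1 -> \sum_(0 <= k < n) r ^+ k <= (1 - r)^-1.
Proof.
move=> /andP[r0 r1]; have r10 : 0 < 1 - r by lra.
rewrite -[leRHS]mul1r ler_pdivlMr// big_mkord.
have := subrX1 r n; have : 0 <= r ^+ n by rewrite exprn_ge0.
by set S := \sum_(_ < n) _; lra.
Qed.

(** For beta <= 0, where 1 - |z|^2 is about 2^-k the weight is at most 2^(-beta (k+1)) and the area
    is O(2^-k); the integral is dominated by a geometric series of ratio 2^(-beta) / 2, below 1
    because beta > -1. *)
Lemma weight_integrable beta : -1 < beta ->
  (\int[mu2]_(w in pdisc) (weight beta w)%:E < +oo)%E.
Proof.
move=> b1.
wlog b0 : beta b1 / beta <= 0.
  move=> H; have [b0|b0] := leP beta 0; first exact: H.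
  apply: le_lt_trans (H 0 _ _); rewrite ?ltrN10//.
  apply: ge0_le_integral.
  - exact: measurable_pdisc.
  - by move=> w _; rewrite lee_fin powR_ge0.
  - exact: measurable_weight.
  - exact: measurable_weight.
  move=> w wD; rewrite lee_fin; apply: ger_powR; last exact: ltW.
  by rewrite normc1B_gt0//= lerBlDr lerDl exprn_ge0 ?normc_ge0.
pose r : R := 2 `^ (- beta).
have r0 : 0 < r by exact: powR_gt0.
have r2 : r / 2 < 1.
  rewrite ltr_pdivrMr// mul1r -[X in _ < X]powRr1// /r.
  rewrite lt_neqAle ler_powR ?ler1n ?andbT//; last by lra.
  apply/eqP => /(congr1 (@ln R)); rewrite !ln_powR => /(mulIf _) H.
  have : - beta = 1 by apply: H; rewrite gt_eqF// ln_gt0// ltr1n.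
  by move=> E; move: b1; lra.
(* Full rings replace dyadic annuli: they overlap, but every point lies in the ring of its own scale
   and all terms are nonnegative. The factor 2 turns [x <= half k] into the strict inequality that
   defines the ring. *)
pose u k (w : MT) : \bar R := ((r ^+ k.+1)%:E * (\1_([set w | outer_ring (2 * half k) (pt w)] : set MT) w)%:E)%E.
have mring k : measurable ([set w | outer_ring (2 * half k) (pt w)] : set MT).
  by apply: copen_measurable; exact: copen_outer_ring.
have u0 k w : (0 <= u k w)%E by rewrite /u -EFinM lee_fin mulr_ge0// exprn_ge0// ltW.
have mu_ k : measurable_fun (pdisc : set MT) (u k).
  by apply: measurable_funeM; apply/measurable_EFinP; exact: measurable_indic.
apply: (@le_lt_trans _ _ (\int[mu2]_(w in pdisc) (\sum_(0 <= k <oo) u k w))%E).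
  apply: ge0_le_integral.
  - exact: measurable_pdisc.
  - by move=> w _; rewrite lee_fin powR_ge0.
  - exact: measurable_weight.
  - exact: ge0_emeasurable_sum.
  move=> w wD; set x := 1 - normc (pt w) ^+ 2; have x0 : 0 < x by exact: normc1B_gt0.
  have x01 : 0 < x <= 1 by rewrite x0 /x lerBlDr lerDl exprn_ge0 ?normc_ge0.
  have [k /andP[k1 k2]] := dyadic x01.
  apply: (@le_trans _ _ (\sum_(0 <= i < k.+1) u i w)%E); last by apply: nneseries_lim_ge.
  rewrite big_nat_recr//=.
  apply: (@le_trans _ _ (u k w)); last by rewrite leeDr// sume_ge0.
  rewrite /u indicE mem_set/=; last first.
    split => //; have hk : 0 < half k by exact: ihalf_gt0.
    by move: k2; rewrite /x /mkset; lra.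
  rewrite mule1 lee_fin /weight -/x.
  have -> : r ^+ k.+1 = half k.+1 `^ beta.
    rewrite -powR_mulrn ?(ltW r0)// /r -powRrM mulrC powRrM powR_mulrn//.
    by rewrite exprVn -[(_ ^+ _)^-1]powR_inv1 ?exprn_ge0// -powRrM mulN1r.
  rewrite -[beta]opprK !(powRN _ (- beta)) lef_pV2 ?posrE ?powR_gt0 ?ihalf_gt0//.
  apply: ge0_ler_powR; rewrite ?nnegrE ?oppr_ge0 ?(ltW x0) ?(ltW (ihalf_gt0 _))//; exact: ltW.
rewrite integral_nneseries//; last exact: measurable_pdisc.
have r02 : 0 <= r / 2 < 1 by rewrite r2 divr_ge0// ltW.
apply: (@le_lt_trans _ _ (16 * r * (1 - r / 2)^-1)%:E); last by rewrite ltry.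
apply: nneseries_bound => n; first by apply: integral_ge0.
apply: (@le_trans _ _ (\sum_(0 <= k < n) (16 * r * (r / 2) ^+ k)%:E)%E); last first.
  by rewrite sumEFin lee_fin -mulr_sumr ler_wpM2l ?geo_partial// mulr_ge0// ltW.
apply: lee_sum => k _; rewrite ge0_integralZl//; last 3 first.
- exact: measurable_pdisc.
- by apply/measurable_EFinP; exact: measurable_indic.
- by rewrite lee_fin exprn_ge0// ltW.
rewrite integral_indic//; last exact: measurable_pdisc.
apply: (@le_trans _ _ ((r ^+ k.+1)%:E * (8 * (2 * half k))%:E)%E).
  rewrite lee_wpmul2l ?lee_fin ?exprn_ge0 ?(ltW r0)//.
  apply: le_trans (ring_area _); last by rewrite mulr_gt0 ?ihalf_gt0.
  apply: le_measure; rewrite ?inE//.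
    by apply: measurableI => //; exact: measurable_pdisc.
rewrite -EFinM lee_fin exprS expr_div_n exprVn le_eqVlt; apply/orP; left; apply/eqP; ring.
Qed.

End WeightIntegral.

(** * A Gaussian bound is sufficient *)

Section Sufficiency.
Context {R : realType}.
Local Notation MT := (measurableTypeR R * measurableTypeR R)%type.
Local Notation mu2 := (@lebesgue_measure R \x @lebesgue_measure R)%E.
Local Notation disc := (@unit_disc R).
Implicit Types (f g h phi : R[i] -> R[i]) (z : R[i]).
Local Notation half n := ((2^-1 : R) ^+ n).

Lemma entire_cdiff phi z : entire phi -> cdiff phi z (cderiv phi z).
Proof. by move=> /(_ z); exact: derivable_cdiff. Qed.

Lemma superposition_holD phi f : entire phi -> holD f -> holD (superposition phi f).
Proof.
move=> ephi hf z zD.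
by have [] := cdiff_derivable (cdiff_comp (holD_cdiff hf zD) (entire_cdiff (f z) ephi)).
Qed.

Lemma superposition_deriv phi f z : entire phi -> holD f -> disc z ->
  cderiv (superposition phi f) z = cderiv phi (f z) * cderiv f z.
Proof.
move=> ephi hf zD.
by have [] := cdiff_derivable (cdiff_comp (holD_cdiff hf zD) (entire_cdiff (f z) ephi)).
Qed.

(** On the square of half-side 1 about w, |z| <= |w| + 2 and so |z|^2 <= 2|w|^2 + 8: the Cauchy
    estimate doubles the constant in the exponent but keeps the shape of the bound. *)
Lemma deriv_gauss phi (A : R) : entire phi -> 0 <= A ->
  (forall w, normc (phi w) <= A * expR (A * normc w ^+ 2)) ->
  forall w, normc (cderiv phi w) <= 32 * A * expR (8 * A) * expR (2 * A * normc w ^+ 2).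
Proof.
move=> ephi A0 phiA w.
have := @cauchy_estimate _ 1 (A * expR (8 * A) * expR (2 * A * normc w ^+ 2)) w phi (cderiv phi) ltr01.
have -> : 32 * A * expR (8 * A) * expR (2 * A * normc w ^+ 2) =
  32 * (A * expR (8 * A) * expR (2 * A * normc w ^+ 2)) / 1 by rewrite divr1 !mulrA.
apply; first by move=> z _; exact: entire_cdiff.
move=> z [/andP[h1 h2] /andP[h3 h4]]; apply: le_trans (phiA z) _.
rewrite -mulrA ler_wpM2l// -expRD ler_expR.
have -> : 8 * A + 2 * A * normc w ^+ 2 = A * (2 * normc w ^+ 2 + 8) by ring.
rewrite ler_wpM2l//.
have zw : normc (z - w) <= 2.
  apply: le_trans (le_normc_ReIm _) _; rewrite cReB cImB.
  by apply: (@le_trans _ _ (1 + 1)); [apply: lerD; rewrite ler_norml; lra|lra].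
have := normc_ball_sub w z; have := normc_ge0 z; have := normc_ge0 w.
rewrite !expr2; set a := normc z; set b := normc w => b0 a0 ab.
have : a <= b + 2 by lra.
move=> H; have h2' : a * a <= (b + 2) * (b + 2) by apply: ler_pM.
by have : 0 <= (b - 2) * (b - 2); [rewrite -expr2 sqr_ge0|move: h2'; clear; lra].
Qed.

Lemma powR_expR (x p : R) : expR x `^ p = expR (p * x).
Proof. by rewrite /powR gt_eqF ?expR_gt0// expRK. Qed.

(** Where 1 - |z| is about 2^-n, |f|^2 <= eta n + C1, so the Gaussian bound on phi' becomes exp(c
    eta n), a power of 1 - |z| with exponent proportional to eta. *)
Lemma composed_growth phi f (p eps : R) : entire phi -> 0 < p -> 0 < eps ->
  (exists2 A : R, 0 <= A & forall w, normc (phi w) <= A * expR (A * normc w ^+ 2)) ->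
  dirichlet f ->
  exists2 C : R, 0 <= C & forall z, disc z ->
    normc (cderiv phi (f z)) `^ p <= C * (1 - normc z ^+ 2) `^ (- eps).
Proof.
move=> ephi p0 e0 [A A0 phiA] df.
pose L : R := ln 2; have L0 : 0 < L by rewrite ln_gt0// ltr1n.
have Ap0 : 0 <= 2 * A * p by rewrite !mulr_ge0// ltW.
have Ap1 : 0 < 2 * A * p + 1 by lra.
(* Chosen so that 2 A p eta <= eps log 2; the added 1 covers [A = 0]. *)
pose eta := eps * L / (2 * A * p + 1).
have eta0 : 0 < eta by rewrite divr_gt0 ?mulr_gt0.
have [C1 C10 HC1] := dirichlet_growth df eta0.
pose B := 32 * A * expR (8 * A).
have B0 : 0 <= B by rewrite !mulr_ge0 ?expR_ge0.
exists (B `^ p * expR (p * (2 * A * C1) + 2 * eps * L)).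
  by rewrite mulr_ge0 ?powR_ge0 ?expR_ge0.
move=> z zD; have x0 := normc1B_gt0 zD; set x := 1 - normc z ^+ 2 in x0 *.
have z01 : 0 < 1 - normc z <= 1 by rewrite subr_gt0 zD lerBlDr lerDl normc_ge0.
have [n /andP[n1 n2]] := dyadic z01.
have zn : normc z <= 1 - half n.+1 by lra.
have fz := HC1 _ _ zn.
have : normc (cderiv phi (f z)) `^ p <= (B * expR (2 * A * (eta * n.+1%:R + C1))) `^ p.
  apply: ge0_ler_powR; rewrite ?nnegrE ?normc_ge0 ?mulr_ge0 ?expR_ge0 ?(ltW p0)//.
  apply: le_trans (deriv_gauss ephi A0 phiA (f z)) _; rewrite -/B.
  by rewrite ler_wpM2l// ler_expR ler_wpM2l// mulr_ge0.
move/le_trans; apply.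
rewrite powRM ?expR_ge0// powR_expR -[leRHS]mulrA ler_wpM2l ?powR_ge0//.
rewrite /powR gt_eqF// -expRD ler_expR.
have lx : ln x <= 2 * L - n.+1%:R * L.
  have -> : 2 * L - n.+1%:R * L = ln (4 * half n.+1).
    rewrite lnM ?posrE ?ihalf_gt0// exprVn lnV ?posrE ?exprn_gt0// lnXn//.
    have -> : (4 : R) = 2 ^+ 2 by ring.
    by rewrite lnXn// -/L -(mulr_natl L 2) -(mulr_natl L n.+1).
  rewrite ler_ln ?posrE ?mulr_gt0 ?ihalf_gt0//.
  have /andP[_ h] := normc1B_bounds zD; apply: le_trans h _.
  by rewrite ihalfS; lra.
have eL : 2 * A * p * eta <= eps * L.
  rewrite /eta mulrCA ler_piMr ?mulr_ge0 ?(ltW e0) ?(ltW L0)//.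
  by rewrite ler_pdivrMr// mul1r; lra.
have h1 : - eps * ln x >= - eps * (2 * L - n.+1%:R * L).
  by rewrite !mulNr lerN2 ler_pM2l.
have h2 : 2 * A * p * eta * n.+1%:R <= eps * L * n.+1%:R by rewrite ler_wpM2r.
have -> : p * (2 * A * (eta * n.+1%:R + C1)) =
  2 * A * p * eta * n.+1%:R + p * (2 * A * C1) by ring.
have e : - eps * (2 * L - n.+1%:R * L) = - (2 * eps * L) + eps * L * n.+1%:R by ring.
move: h1 h2; rewrite e; set a := - eps * ln x; set b := eps * L * _; set c := _ * n.+1%:R.
by clear; lra.
Qed.

(* If p < 2, either the weight is at most |f'|^(2-p) or |f'|^p is at most a power
   of the weight; if p >= 2, the factor ((1-|z|^2)|f'|)^(p-2) is bounded. *)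
Lemma energy_split (p alpha : R) f : 0 < p -> p - 2 < alpha -> (p < 2 -> p / 2 - 1 < alpha) ->
  dirichlet f ->
  exists eps beta C : R, [/\ 0 < eps, -1 < beta, 0 <= C & forall z, disc z ->
    (1 - normc z ^+ 2) `^ (alpha - eps) * normc (cderiv f z) `^ p <=
    C * (normc (cderiv f z) ^+ 2 + (1 - normc z ^+ 2) `^ beta)].
Proof.
move=> p0 hlo hp2 df; have [p2|p2] := ltP p 2.
  have ha := hp2 p2.
  pose eps := (alpha - (p / 2 - 1)) / 2; have e0 : 0 < eps by rewrite /eps; lra.
  have dp : 0 < 2 - p by lra.
  (* The exponent for which t^(2/(2-p)) = x^beta, where t = x^(alpha - eps). That beta > -1 means
     alpha - eps > p/2 - 1, and [eps] is half of the available gap. *)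
  pose beta := 2 * (alpha - eps) / (2 - p).
  exists eps, beta, 1; split => //.
    by rewrite /beta ltr_pdivlMr// /eps; lra.
  move=> z zD; have x0 := normc1B_gt0 zD; set x := 1 - _ in x0 *.
  set y := normc _; have y0 : 0 <= y by exact: normc_ge0.
  rewrite mul1r; set t := x `^ (alpha - eps).
  have t0 : 0 < t by exact: powR_gt0.
  have [->|yn] := eqVneq y 0.
    by rewrite powR0 ?gt_eqF// mulr0 addr_ge0 ?powR_ge0 ?exprn_ge0.
  have yp : 0 < y by rewrite lt_def yn.
  have ypp : 0 <= y `^ p by exact: powR_ge0.
  have y2 : y ^+ 2 = y `^ (2 - p) * y `^ p.
    by rewrite -powRD ?yn ?implybT// subrK powR_mulrn.
  have [ty|ty] := leP t (y `^ (2 - p)).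
    apply: le_trans (_ : _ <= y ^+ 2) _; last by rewrite lerDl powR_ge0.
    by rewrite y2 ler_wpM2r.
  apply: le_trans (_ : _ <= x `^ beta) _; last by rewrite lerDr exprn_ge0.
  have -> : x `^ beta = t * t `^ (p / (2 - p)).
    rewrite -{1}(powRr1 (ltW t0)) -powRD ?(gt_eqF t0) ?implybT// /t -powRrM.
    by congr (_ `^ _); rewrite /beta; field; rewrite gt_eqF.
  rewrite ler_pM2l//.
  have -> : y `^ p = (y `^ (2 - p)) `^ (p / (2 - p)).
    by rewrite -powRrM mulrCA divff ?mulr1// gt_eqF.
  by apply: ge0_ler_powR; rewrite ?nnegrE ?powR_ge0 ?divr_ge0 ?(ltW p0) ?(ltW dp) ?(ltW t0) ?(ltW ty).
(* Here the whole gap is spent: the remaining weight exponent is exactly p - 2, matching the power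
   of |f'| beyond the square. *)
pose eps := alpha - (p - 2); have e0 : 0 < eps by rewrite /eps; lra.
have /dirichletP[hf If] := df.
have q0 : 0 < 2 :> R by [].
have [C C0 HC] := @pointwise_estimate R 2 0 q0.
set I := (\int[_]_(_ in _) _)%E in If.
have I0 : (0 <= I)%E by apply: integral_ge0 => w _; rewrite lee_fin density_ge0.
have [T IT] : exists T, I = T%:E by case: (I) I0 If => // t _ _; exists t.
have T0 : 0 <= T by rewrite -lee_fin -IT.
pose B := 2 * Num.sqrt (C * T).
have B0 : 0 <= B by rewrite mulr_ge0 ?sqrtr_ge0.
exists eps, 0, (B `^ (p - 2)); split; rewrite ?ltrN10 ?powR_ge0//.
move=> z zD; have x0 := normc1B_gt0 zD; set x := 1 - _ in x0 *.
set y := normc _; have y0 : 0 <= y by exact: normc_ge0.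
have xy : x * y <= B.
  have dz : 0 < 1 - normc z by rewrite subr_gt0.
  have H : ((1 - normc z) * y) ^+ 2 <= C * T.
    have := HC (cderiv f) z (fun z zD => holD_deriv hf zD) zD.
    rewrite powRr0 mulr1 powR_mulrn// -exprMn -lee_fin => /le_trans; apply.
    rewrite EFinM lee_wpmul2l ?lee_fin ?(ltW C0)// -IT.
    apply: ge0_subset_integral.
    - exact: measurable_square.
    - exact: measurable_pdisc.
    - by apply: measurable_density => // u; exact: holD_deriv_cont.
    - by move=> w _; rewrite lee_fin density_ge0.
    - by move=> w; exact: near_square_disc.
  have h1 : (1 - normc z) * y <= Num.sqrt (C * T).
    rewrite -(@ler_pXn2r _ 2)// ?nnegrE ?sqrtr_ge0 ?mulr_ge0 ?(ltW dz)//.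
    by rewrite sqr_sqrtr// mulr_ge0// ltW.
  have /andP[_ h2] := normc1B_bounds zD.
  apply: (@le_trans _ _ (2 * (1 - normc z) * y)); first by rewrite ler_wpM2r.
  by rewrite -mulrA ler_pM2l.
have -> : alpha - eps = p - 2 by rewrite /eps; ring.
have [->|yn] := eqVneq y 0.
  by rewrite powR0 ?gt_eqF// mulr0 mulr_ge0 ?powR_ge0// addr_ge0 ?powR_ge0.
have -> : y `^ p = y `^ (p - 2) * y ^+ 2.
  by rewrite -[y ^+ 2]powR_mulrn// -powRD ?yn ?implybT// subrK.
rewrite mulrA -powRM ?(ltW x0)//.
apply: ler_pM; rewrite ?powR_ge0 ?exprn_ge0//.
  by apply: ge0_ler_powR; rewrite ?nnegrE ?mulr_ge0 ?(ltW x0)//; lra.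
by rewrite lerDl powR_ge0.
Qed.

Lemma gauss_sufficient (p alpha : R) phi : entire phi -> 0 < p -> p - 2 < alpha ->
  (p < 2 -> p / 2 - 1 < alpha) ->
  (exists2 A : R, 0 <= A & forall w, normc (phi w) <= A * expR (A * normc w ^+ 2)) ->
  superposition phi @` @dirichlet R `<=` weighted_dirichlet p alpha.
Proof.
move=> ephi p0 hlo hp2 hA _ [f df <-].
have [eps [beta [C [e0 b1 C0 HC]]]] := energy_split p0 hlo hp2 df.
have [C' C'0 HC'] := composed_growth ephi p0 e0 hA df.
have /dirichletP[hf If] := df.
apply/dirichletP; split; first exact: superposition_holD.
have hF := superposition_holD ephi hf.
have md : measurable_fun (pdisc : set MT) (fun w => (density 2 0 (cderiv f) w)%:E).
  by apply: measurable_density => // z; exact: holD_deriv_cont.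
have CC : 0 <= C' * C by rewrite mulr_ge0.
apply: (@le_lt_trans _ _ (\int[mu2]_(w in pdisc) ((C' * C)%:E *
   ((density 2 0 (cderiv f) w)%:E + (weight beta w)%:E)))%E).
  apply: ge0_le_integral.
  - exact: measurable_pdisc.
  - by move=> w _; rewrite lee_fin density_ge0.
  - by apply: measurable_density => // z; exact: holD_deriv_cont.
  - by apply: measurable_funeM; apply: emeasurable_funD => //; exact: measurable_weight.
  move=> w wD; have x0 := normc1B_gt0 wD.
  rewrite -EFinD -EFinM lee_fin density20 /weight /density superposition_deriv//.
  set x := 1 - _ in x0 *; rewrite Normc.normcM powRM ?normc_ge0// mulrCA.
  apply: (@le_trans _ _ (C' * x `^ (- eps) * (x `^ alpha * normc (cderiv f (pt w)) `^ p))).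
    by rewrite ler_wpM2r ?HC'// mulr_ge0 ?powR_ge0.
  rewrite -!mulrA ler_wpM2l// mulrA -powRD ?(gt_eqF x0) ?implybT// addrC.
  exact: HC.
rewrite ge0_integralZl//; last 3 first.
- exact: measurable_pdisc.
- by apply: emeasurable_funD => //; exact: measurable_weight.
- by move=> w _; rewrite -EFinD lee_fin addr_ge0 ?density_ge0 ?powR_ge0.
rewrite ge0_integralD//; last 4 first.
- exact: measurable_pdisc.
- by move=> w _; rewrite lee_fin density_ge0.
- by move=> w _; rewrite lee_fin powR_ge0.
- exact: measurable_weight.
have Iw := weight_integrable b1.
have fin1 : (\int[mu2]_(w in pdisc) (density 2 0 (cderiv f) w)%:E)%E \is a fin_num.
  by rewrite ge0_fin_numE// integral_ge0// => w _; rewrite lee_fin density_ge0.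
have fin2 : (\int[mu2]_(w in pdisc) (weight beta w)%:E)%E \is a fin_num.
  by rewrite ge0_fin_numE// integral_ge0// => w _; rewrite lee_fin powR_ge0.
by rewrite -(fineK fin1) -(fineK fin2) -EFinD -EFinM ltry.
Qed.

End Sufficiency.

(** * Order and type *)

Section Order.
Context {R : realType}.
Implicit Types (phi : R[i] -> R[i]) (z w : R[i]).

Lemma bounded_ball phi (r : R) : entire phi -> exists2 M : R, 0 <= M &
  forall w, normc w <= r -> normc (phi w) <= M.
Proof.
move=> ephi; have [r0|r0] := leP 0 r; last first.
  by exists 0 => // w wr; have := normc_ge0 w; lra.
have [|||M HM] := @rect_bounded _ (- r) r (- r) r phi; [lra|lra|..].
  by move=> z _; exact: cdiff_ccont (entire_cdiff z ephi).
exists (Num.max 0 M); first by rewrite le_max lexx.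
move=> w wr; rewrite le_max; apply/orP; right; apply: HM; split; rewrite -ler_norml.
  exact: le_trans (le_Re_normc _) wr.
exact: le_trans (le_Im_normc _) wr.
Qed.

Lemma le_max_modulus phi w : entire phi -> normc (phi w) <= max_modulus phi (normc w).
Proof.
move=> ephi; apply: sup_upper_bound; last by exists w.
split; first by exists (normc (phi w)); exists w.
have [M _ HM] := bounded_ball (normc w) ephi.
by exists M => _ [z /= zw <-]; apply: HM; rewrite zw.
Qed.

Lemma max_modulus_le phi (r M : R) : 0 <= r -> (forall w, normc w = r -> normc (phi w) <= M) ->
  max_modulus phi r <= M.
Proof.
move=> r0 HM; apply: sup_le_ub; last by move=> _ [z /= zr <-]; exact: HM.
exists (normc (phi (r%:C)%C)); exists (r%:C)%C => //.
by rewrite /mkset normc_real ger0_norm.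
Qed.

Lemma le_expR_ln (x y : R) : 0 <= y -> ln x <= y -> x <= expR y.
Proof.
move=> y0 xy; have [x0|x0] := leP x 0; first exact: le_trans x0 (expR_ge0 _).
by rewrite -[x]lnK ?posrE// ler_expR.
Qed.

Lemma eventually_gauss phi (K r0 : R) : entire phi -> 0 <= K ->
  (forall w, r0 < normc w -> normc (phi w) <= expR (K * normc w ^+ 2)) ->
  exists2 A : R, 0 <= A & forall w, normc (phi w) <= A * expR (A * normc w ^+ 2).
Proof.
move=> ephi K0 HK; have [M M0 HM] := bounded_ball r0 ephi.
have A0 : 0 <= 1 + K + M by rewrite !addr_ge0.
exists (1 + K + M) => // w.
have n2 : 0 <= normc w ^+ 2 by rewrite exprn_ge0 ?normc_ge0.
have [wr|wr] := leP (normc w) r0.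
  apply: le_trans (HM _ wr) _; apply: (@le_trans _ _ ((1 + K + M) * 1)); first by lra.
  rewrite ler_wpM2l//; apply: le_trans (expR_ge1Dx _).
  by rewrite lerDl mulr_ge0.
apply: le_trans (HK _ wr) _; apply: (@le_trans _ _ (1 * expR ((1 + K + M) * normc w ^+ 2))).
  by rewrite mul1r ler_expR ler_wpM2r//; lra.
by rewrite ler_wpM2r ?expR_ge0//; lra.
Qed.

Lemma limf_esup_lt (u : R -> \bar R) (B : \bar R) :
  (limf_esup u (pinfty_nbhs R) < B)%E -> exists r0 : R, forall r, r0 < r -> (u r < B)%E.
Proof.
rewrite /limf_esup => /ereal_inf_lt[_ [V [r0 [_ HV]] <-] HB].
exists r0 => r /HV Vr; apply: le_lt_trans HB.
by apply: ereal_sup_ubound; exists r.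
Qed.

Lemma limf_esup_le (u : R -> \bar R) (B : \bar R) (r0 : R) :
  (forall r, r0 < r -> (u r <= B)%E) -> (limf_esup u (pinfty_nbhs R) <= B)%E.
Proof.
move=> H; rewrite /limf_esup; apply: ereal_inf_le.
exists (ereal_sup [set u r | r in [set r | r0 < r]]).
  by exists [set r | r0 < r] => //; exists r0; split => //; exact: num_real.
by apply: ge_ereal_sup => _ [r /= rr0 <-]; exact: H.
Qed.

Lemma order_gauss phi : entire phi ->
  ((growth_order phi < 2%:E)%E \/ (growth_order phi = 2%:E /\ (growth_type phi < +oo)%E)) ->
  exists2 A : R, 0 <= A & forall w, normc (phi w) <= A * expR (A * normc w ^+ 2).
Proof.
move=> ephi [Ho|[Ho Ht]].
  have [[c Hc]|nc] := pselect (is_constant phi).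
    exists (normc c); first exact: normc_ge0.
    move=> w; rewrite Hc -[X in X <= _]mulr1 ler_wpM2l ?normc_ge0//.
    by rewrite -expR0 ler_expR mulr_ge0 ?exprn_ge0 ?normc_ge0.
  move: Ho; rewrite /growth_order; case: asboolP => // _ /limf_esup_lt[r0 Hr].
  apply: (@eventually_gauss phi 1 (Num.max 1 r0)) => // w.
  rewrite gt_max => /andP[w1 wr]; set r := normc w in w1 wr *.
  apply: le_trans (le_max_modulus w ephi) _; rewrite -/r mul1r.
  apply: le_expR_ln; first by rewrite exprn_ge0// normc_ge0.
  have lr : 0 < ln r by exact: ln_gt0.
  have := Hr r wr; rewrite lte_fin ltr_pdivrMr// => H.
  have r2 : expR (2 * ln r) = r ^+ 2.
    by rewrite expRM_natl lnK// posrE; lra.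
  by rewrite -r2; apply: le_expR_ln; [rewrite mulr_ge0// ltW|exact: ltW].
have := limf_esup_lt Ht; rewrite Ho /= => -[r0 _].
move: Ht; rewrite /growth_type /limf_esup => /ereal_inf_lt[_ [V [r1 [_ HV]] <-] HB].
(* The supremum over the tail is below +oo but might be -oo, hence the case analysis. *)
have [K HK] : exists K : R, forall r, V r ->
    ln (max_modulus phi r) / r `^ fine (growth_order phi) <= K.
  set S := ereal_sup _ in HB.
  have US r : V r -> ((ln (max_modulus phi r) / r `^ fine (growth_order phi))%:E <= S)%E.
    by move=> Vr; apply: ereal_sup_ubound; exists r.
  case: (S) HB US => [K|//|] _ US.
    by exists K => r /US; rewrite lee_fin.
  by exists 0 => r /US; rewrite leeNy_eq.
apply: (@eventually_gauss phi `|K| (Num.max 1 r1)) => // w.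
rewrite gt_max => /andP[w1 wr]; set r := normc w in w1 wr *.
apply: le_trans (le_max_modulus w ephi) _; rewrite -/r.
have r0' : 0 < r by lra.
apply: le_expR_ln; first by rewrite mulr_ge0// exprn_ge0// ltW.
have := HK r (HV _ wr); rewrite Ho /= powR_mulrn ?(ltW r0')// ler_pdivrMr ?exprn_gt0//.
move/le_trans; apply; rewrite ler_wpM2r ?exprn_ge0 ?(ltW r0')//; exact: ler_norm.
Qed.

(** From log log M(r) <= 2 log r + log K the order is at most 2; if it equals 2, then log M(r) / r^2
    <= K bounds the type. *)
Lemma gauss_order phi (K T : R) : 1 <= K ->
  (forall w, T <= normc w -> normc (phi w) <= expR (K * normc w ^+ 2)) ->
  (growth_order phi < 2%:E)%E \/ (growth_order phi = 2%:E /\ (growth_type phi < +oo)%E).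
Proof.
move=> K1 HK; have K0 : 0 < K by lra.
have lnMr r : Num.max 1 T < r -> ln (max_modulus phi r) <= K * r ^+ 2.
  rewrite gt_max => /andP[r1 rT]; have r0 : 0 <= r by lra.
  have Mr : max_modulus phi r <= expR (K * r ^+ 2).
    by apply: max_modulus_le => // w wr; have := HK w; rewrite wr => -> //; exact: ltW.
  have [M0|M0] := leP (max_modulus phi r) 0.
    by rewrite ln0// mulr_ge0 ?exprn_ge0// ltW.
  by rewrite -[leRHS]expRK ler_ln ?posrE ?expR_gt0.
have [cst|ncst] := pselect (is_constant phi).
  by left; rewrite /growth_order; case: asboolP.
have le2 : (growth_order phi <= 2%:E)%E.
  rewrite /growth_order; case: asboolP => // _; apply/lee_addgt0Pr => e e0.
  (* Beyond exp(log K / e) one has log K <= e log r. *)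
  apply: (@limf_esup_le _ _ (Num.max (Num.max 1 T) (expR (ln K / e)))) => r.
  rewrite gt_max => /andP[rT re]; have H := lnMr r rT.
  have r1 : 1 < r by move: rT; rewrite gt_max => /andP[].
  have r0 : 0 < r by lra.
  have lr : 0 < ln r by exact: ln_gt0.
  have Ke : ln K <= e * ln r.
    have : ln (expR (ln K / e)) < ln r by rewrite ltr_ln ?posrE ?expR_gt0.
    by rewrite expRK ltr_pdivrMr// mulrC => /ltW.
  rewrite -EFinD lee_fin ler_pdivrMr//.
  apply: (@le_trans _ _ (2 * ln r + ln K)); last by rewrite [leRHS]mulrDl lerD2l.
  have [M0|M0] := leP (ln (max_modulus phi r)) 0.
    rewrite (ln0 M0) addr_ge0 ?mulr_ge0 ?(ltW lr)//.
    by rewrite ln_ge0.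
  have -> : 2 * ln r + ln K = ln (K * r ^+ 2).
    by rewrite addrC lnM ?posrE ?exprn_gt0// lnXn// mulr_natl.
  by rewrite ler_ln ?posrE// mulr_gt0 ?exprn_gt0.
move: le2; rewrite le_eqVlt => /predU1P[Ho|]; last by left.
right; split => //; apply: (@le_lt_trans _ _ K%:E); last by rewrite ltry.
apply: (@limf_esup_le _ _ (Num.max 1 T)) => r rT; rewrite Ho /= lee_fin.
have r0 : 0 < r by move: rT; rewrite gt_max => /andP[]; lra.
by rewrite powR_mulrn ?(ltW r0)// ler_pdivrMr ?exprn_gt0// lnMr.
Qed.

End Order.

(** * Series of holomorphic functions *)

Section Series.
Context {R : realType}.
Local Notation disc := (@unit_disc R).
Implicit Types (f g h phi : R[i] -> R[i]) (z w : R[i]).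
Local Notation half n := ((2^-1 : R) ^+ n).

(** Reduces inequalities between infinite sums to partial sums whose tails are bounded by
    [K * half n]. *)
Lemma le_half_eps (x y K : R) : (forall n, x <= y + K * half n) -> x <= y.
Proof.
move=> H; rewrite leNgt; apply/negP => yx.
have K1 : 0 < Num.max 1 K by rewrite lt_max ltr01.
have e0 : 0 < (x - y) / Num.max 1 K by rewrite divr_gt0// subr_gt0.
have [n Hn] := ihalf_small e0; have := H n; rewrite leNgt => /negP; apply.
rewrite -ltrBrDl; move: Hn; rewrite ltr_pdivlMr// mulrC; apply: le_lt_trans.
by rewrite ler_wpM2r ?(ltW (ihalf_gt0 _))// le_max lexx orbT.
Qed.

Lemma sum_half_le (k n : nat) : \sum_(k <= j < n) half j <= 2 * half k.
Proof.
have [kn|nk] := leqP k n; last first.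
  by rewrite big_geq 1?ltnW// mulr_ge0// ltW// ihalf_gt0.
have -> : \sum_(k <= j < n) half j = 2 * half k - 2 * half n.
  elim: n kn => [|n IH]; first by rewrite leqn0 => /eqP ->; rewrite big_geq// subrr.
  rewrite leq_eqVlt => /predU1P[->|kn]; first by rewrite big_geq// subrr.
  by rewrite big_nat_recr//= IH// ihalfS; field.
by rewrite gerBl mulr_ge0// ltW// ihalf_gt0.
Qed.

Lemma real_series_tail (u : nat -> R) (A : R) : (forall j, `|u j| <= A * half j) ->
  forall n, `|limn (series u) - \sum_(j < n) u j| <= 2 * A * half n.
Proof.
move=> uA n; have A0 : 0 <= A by have := uA 0%N; rewrite expr0 mulr1; apply: le_trans.
have part (k m : nat) : `|\sum_(k <= j < m) u j| <= 2 * A * half k.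
  apply: le_trans (ler_norm_sum _ _ _) _.
  apply: (@le_trans _ _ (\sum_(k <= j < m) A * half j)); first exact: ler_sum.
  by rewrite -mulr_sumr -mulrA mulrCA ler_wpM2l// sum_half_le.
have cv : cvgn (series u).
  apply: cauchy_cvg; apply: (@cauchy_seriesP _ _ u).2 => e e0.
  have e1 : 0 < e / (2 * A + 1) by rewrite divr_gt0//; lra.
  have [N HN] := ihalf_small e1.
  exists ([set k | (N <= k)%N], setT).
    by split => //; [exists N|exact: filterT].
  move=> [k m] /= [Nk _]; apply: le_lt_trans (part _ _) _.
  move: HN; rewrite ltr_pdivlMr; last by lra.
  have hk : half k <= half N by apply: ler_wiXn2l => //; rewrite ?invr_ge0 ?invf_le1 ?ler1n.
  have := ihalf_gt0 (R := R) k; have : 0 <= (2 * A) * (half N - half k) by rewrite !mulr_ge0// subr_ge0.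
  by move: (half k) (half N) => a b; nra.
have cv2 : series u m - \sum_(j < n) u j @[m --> \oo] --> limn (series u) - \sum_(j < n) u j.
  by apply: cvgB => //; exact: cvg_cst.
have cv3 : `|series u m - \sum_(j < n) u j| @[m --> \oo] --> `|limn (series u) - \sum_(j < n) u j|.
  exact: cvg_norm cv2.
rewrite -(cvg_lim _ cv3)//; apply: limr_le; first by apply/cvg_ex; eexists; exact: cv3.
exists n => // m /= nm.
rewrite /series /= (@big_cat_nat _ _ _ n)//= big_mkord addrAC subrr add0r; exact: part.
Qed.

(** The sum of the series, taken coordinatewise so that convergence is a matter of real series. *)
Definition csum (u : nat -> R[i]) : R[i] :=
  cplx (limn (series (complex.Re (R:=R) \o u))) (limn (series (complex.Im (R:=R) \o u))).

Lemma csum_tail (u : nat -> R[i]) (A : R) : (forall j, normc (u j) <= A * half j) ->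
  forall n, normc (csum u - \sum_(j < n) u j) <= 4 * A * half n.
Proof.
move=> uA n; apply: le_trans (le_normc_ReIm _) _; rewrite cReB cImB /=.
have reS m : complex.Re (\sum_(j < m) u j) = \sum_(j < m) complex.Re (u j).
  by elim: m => [|m IH]; rewrite ?big_ord0// !big_ord_recr /= cReD IH.
have imS m : complex.Im (\sum_(j < m) u j) = \sum_(j < m) complex.Im (u j).
  by elim: m => [|m IH]; rewrite ?big_ord0// !big_ord_recr /= cImD IH.
rewrite reS imS.
have H1 := @real_series_tail (complex.Re (R:=R) \o u) A (fun j => le_trans (le_Re_normc _) (uA j)) n.
have H2 := @real_series_tail (complex.Im (R:=R) \o u) A (fun j => le_trans (le_Im_normc _) (uA j)) n.
by move: (lerD H1 H2) => /le_trans; apply; rewrite -!mulrA -mulrDl; apply: ler_wpM2r; [rewrite -(pmulr_rge0 _ (ltr0Sn R 0)); have := uA n; have := normc_ge0 (u n); lra | lra].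
Qed.

Lemma normc_sum (I : Type) (r : seq I) (P : pred I) (F : I -> R[i]) :
  normc (\sum_(i <- r | P i) F i) <= \sum_(i <- r | P i) normc (F i).
Proof.
elim/big_rec2: _ => [|i y x _ IH]; first by rewrite Normc.normc0.
by apply: le_trans (le_normcD _ _) _; rewrite lerD2l.
Qed.

(** Two Cauchy estimates bound u' within 2d of z and then u'' within d, squares of half-side s
    reaching as far as 2s. The Taylor remainder is linear in [M], hence can be summed over a
    series. *)
Lemma derivative_bounds (u : R[i] -> R[i]) (M d : R) z : holD u -> 0 < d ->
  normc z + 4 * d < 1 -> (forall w, normc w <= normc z + 4 * d -> normc (u w) <= M) ->
  normc (cderiv u z) <= 32 * M / d /\
  forall w, normc (w - z) < d ->
    normc (u w - u z - cderiv u z * (w - z)) <= 2 * (2 * (64 * (32 * M / d) / d)) * normc (w - z) ^+ 2.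
Proof.
move=> hu d0 zd uM.
have sq (s : R) w v : rect (complex.Re w - s) (complex.Re w + s) (complex.Im w - s) (complex.Im w + s) v ->
    normc (v - w) <= 2 * s.
  move=> [/andP[h1 h2] /andP[h3 h4]]; apply: le_trans (le_normc_ReIm _) _; rewrite cReB cImB.
  by apply: (@le_trans _ _ (s + s)); [apply: lerD; rewrite ler_norml; lra|lra].
have D1 w : normc (w - z) <= 2 * d -> normc (cderiv u w) <= 32 * M / d.
  move=> wz; apply: (@cauchy_estimate _ d M w u) => // v /sq vw;
    have vz : normc v <= normc z + 4 * d by have := normc_ball_sub w v; have := normc_ball_sub z w; lra.
    by apply: holD_cdiff => //; rewrite /unit_disc /=; lra.
  exact: uM.
have D2 w l : normc (w - z) < d -> cdiff (cderiv u) w l -> normc l <= 64 * (32 * M / d) / d.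
  move=> wz wl; have dg v : disc v -> exists m, cdiff (cderiv u) v m by exact: holD_deriv.
  have wD : disc w by rewrite /unit_disc /=; have := normc_ball_sub z w; lra.
  have dgE v : disc v -> cdiff (cderiv u) v (cderiv (cderiv u) v).
    by move=> /dg[m]; exact: cdiff_cderiv.
  rewrite (cdiff_unique wl (dgE _ wD)).
  have -> : 64 * (32 * M / d) / d = 32 * (32 * M / d) / (d / 2) by field; rewrite gt_eqF.
  apply: (@cauchy_estimate _ (d / 2) (32 * M / d) w (cderiv u)); first by rewrite divr_gt0.
    move=> v /sq vw; apply: dgE; rewrite /unit_disc /=.
    by have := normc_ball_sub w v; have := normc_ball_sub z w; lra.
  move=> v /sq vw; apply: D1; have := normc_triangle v z w; lra.
split; first by apply: D1; rewrite subrr Normc.normc0 mulr_ge0// ltW.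
move=> w wz; set h := w - z; set K := 64 * _ / d.
have seg (t : R) : 0 <= t <= 1 -> normc ((t%:C)%C * h) <= normc h.
  by move=> /andP[t0 t1]; rewrite Normc.normcM normc_real ger0_norm// ler_piMl ?normc_ge0.
have segD (t : R) : 0 <= t <= 1 -> disc (z + (t%:C)%C * h).
  move=> /seg th; rewrite /unit_disc /=; have := le_normcD z ((t%:C)%C * h).
  by move: wz; rewrite -/h; lra.
have dv v : normc (v - z) < d -> exists l, cdiff (cderiv u) v l /\ normc l <= K.
  move=> vz; have vD : disc v by rewrite /unit_disc /=; have := normc_ball_sub z v; lra.
  by have [l Hl] := holD_deriv hu vD; exists l; split => //; exact: D2 Hl.
have dE v : normc (v - z) < d -> cdiff (cderiv u) v (cderiv (cderiv u) v) /\ normc (cderiv (cderiv u) v) <= K.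
  by move=> /dv[l [H1 H2]]; have H3 := cdiff_cderiv H1; rewrite (cdiff_unique H3 H1).
have V1 (v : R[i]) : normc v <= normc h -> normc (cderiv u (z + v) - cderiv u z) <= 2 * K * normc h.
  move=> vh; apply: le_trans (_ : 2 * K * normc v <= _); last first.
    apply: ler_wpM2l => //; rewrite mulr_ge0//.
    by have [|_] := dE z; [rewrite subrr Normc.normc0|apply: le_trans; exact: normc_ge0].
  have sg (t : R) : 0 <= t <= 1 -> normc (z + (t%:C)%C * v - z) < d.
    move=> /andP[t0 t1]; rewrite addrAC subrr add0r Normc.normcM normc_real ger0_norm//.
    by apply: le_lt_trans wz; apply: le_trans vh; rewrite ler_piMl ?normc_ge0.
  by apply: (@cdiff_MVI _ (cderiv u) (cderiv (cderiv u))) => t /sg/dE[].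
have -> : u w - u z - cderiv u z * h = (u (z + h) - cderiv u z * (z + h)) - (u z - cderiv u z * z).
  by rewrite (_ : z + h = w); rewrite /h; ring.
have -> : 2 * (2 * K) * normc h ^+ 2 = 2 * (2 * K * normc h) * normc h by ring.
apply: (@cdiff_MVI _ (fun v => u v - cderiv u z * v) (fun v => cderiv u v - cderiv u z)) => t t01.
  apply: cdiffB; first by apply: holD_cdiff => //; exact: segD.
  by apply: cdiff_eq (cdiffZ _ (cdiff_id _)); rewrite mulr1.
by apply: V1; exact: seg.
Qed.

(** The second order remainders of the terms are at most K |w - z|^2 2^-j with a single K, so their
    sum is again quadratic in w - z. The bound on the derivatives serves to estimate tails of the
    differentiated series. *)
Lemma weierstrass (u : nat -> R[i] -> R[i]) : (forall j, holD (u j)) ->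
  (forall r : R, r < 1 -> exists A : R, forall j z, normc z <= r -> normc (u j z) <= A * half j) ->
  forall z, disc z -> cdiff (fun w => csum (u^~ w)) z (csum (fun j => cderiv (u j) z)) /\
    exists B : R, forall j, normc (cderiv (u j) z) <= B * half j.
Proof.
move=> hu uA z zD; pose d : R := (1 - normc z) / 8.
have d0 : 0 < d by rewrite divr_gt0// subr_gt0.
have zd : normc z + 4 * d < 1 by rewrite /d; move: zD; rewrite /unit_disc /=; lra.
have [A {}uA] := uA _ zd.
have H j := derivative_bounds (hu j) d0 zd (uA j).
have zD4 : normc z <= normc z + 4 * d by lra.
have A0 : 0 <= A by have := uA 0%N z zD4; rewrite expr0 mulr1; apply: le_trans; exact: normc_ge0.
pose B : R := 32 * A / d; have B0 : 0 <= B by apply: divr_ge0; [exact: mulr_ge0|exact: ltW].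
have vB j : normc (cderiv (u j) z) <= B * half j.
  have [h _] := H j; apply: le_trans h _; rewrite /B.
  by rewrite mulrA mulrAC.
split; last by exists B.
pose K := 2 * (2 * (64 * B / d)); have K0 : 0 <= K by rewrite !mulr_ge0// invr_ge0 ltW.
have rem j w : normc (w - z) < d ->
    normc (u j w - u j z - cderiv (u j) z * (w - z)) <= K * normc (w - z) ^+ 2 * half j.
  move=> wz; have [_ /(_ w wz)] := H j; move=> /le_trans; apply.
  by rewrite le_eqVlt; apply/orP; left; apply/eqP; rewrite /K /B; field; rewrite gt_eqF.
have main w : normc (w - z) < d -> normc (csum (u^~ w) - csum (u^~ z) -
    csum (fun j => cderiv (u j) z) * (w - z)) <= 2 * (K * normc (w - z) ^+ 2).
  move=> wz; have wD : normc w <= normc z + 4 * d by have := normc_ball_sub z w; lra.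
  apply: (@le_half_eps _ _ (4 * A + 4 * A + 4 * B * normc (w - z))) => n.
  have T1 := csum_tail (fun j => uA j w wD) n.
  have T2 := csum_tail (fun j => uA j z zD4) n.
  have T3 := csum_tail vB n.
  set a := csum _ in T1 *; set b := csum _ in T2 *; set c := csum _ in T3 *.
  set a' := \sum_(j < n) _ in T1; set b' := \sum_(j < n) _ in T2; set c' := \sum_(j < n) _ in T3.
  have -> : a - b - c * (w - z) = ((a - a') - (b - b') - (c - c') * (w - z)) + (a' - b' - c' * (w - z)) by ring.
  apply: le_trans (le_normcD _ _) _; rewrite addrC; apply: lerD.
    have -> : a' - b' - c' * (w - z) = \sum_(j < n) (u j w - u j z - cderiv (u j) z * (w - z)).
      by rewrite !sumrB mulr_suml.
    apply: le_trans (normc_sum _ _ _) _.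
    apply: (@le_trans _ _ (\sum_(j < n) K * normc (w - z) ^+ 2 * half j)).
      by apply: ler_sum => j _; exact: rem.
    rewrite -mulr_sumr mulrC; apply: ler_wpM2r.
      by apply: mulr_ge0 => //; rewrite exprn_ge0 ?normc_ge0.
    by have := sum_half_le 0 n; rewrite big_mkord expr0 mulr1.
  apply: le_trans (le_normcD _ _) _; rewrite normcN Normc.normcM.
  apply: (@le_trans _ _ (normc (a - a') + normc (b - b') + normc (c - c') * normc (w - z))).
    by rewrite lerD2r; apply: le_trans (le_normcD _ _) _; rewrite normcN.
  have T4 : normc (c - c') * normc (w - z) <= 4 * B * half n * normc (w - z).
    by rewrite ler_wpM2r ?normc_ge0.
  have -> : (4 * A + 4 * A + 4 * B * normc (w - z)) * half n =
    4 * A * half n + 4 * A * half n + 4 * B * half n * normc (w - z) by ring.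
  by apply: lerD => //; exact: lerD.
apply/cdiffP => e e0.
have K1 : 0 < 2 * K + 1 by lra.
exists (Num.min d (e / (2 * K + 1))); first by rewrite lt_min d0 divr_gt0.
move=> w; rewrite lt_min => /andP[wd we].
apply: le_trans (main w wd) _.
have -> : 2 * (K * normc (w - z) ^+ 2) = 2 * K * normc (w - z) * normc (w - z) by ring.
apply: ler_wpM2r; first exact: normc_ge0.
move: we; rewrite ltr_pdivlMr// mulrC => /ltW; apply: le_trans.
by rewrite ler_wpM2r ?normc_ge0//; lra.
Qed.

End Series.

(** * The gliding hump *)

Section Peaks.
Context {R : realType}.
Local Notation MT := (measurableTypeR R * measurableTypeR R)%type.
Local Notation mu := (@lebesgue_measure R).
Local Notation mu2 := (@lebesgue_measure R \x @lebesgue_measure R)%E.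
Local Notation disc := (@unit_disc R).
Implicit Types (f g h phi : R[i] -> R[i]) (z : R[i]).
Local Notation half n := ((2^-1 : R) ^+ n).

Lemma half_expK n : half n * 2 ^+ n = 1.
Proof. by rewrite -exprMn mulVf ?expr1n// pnatr_eq0. Qed.

Lemma half_mono m n : (m <= n)%N -> half n <= half m.
Proof. by move=> mn; apply: ler_wiXn2l => //; rewrite ?invr_ge0 ?invf_le1 ?ler1n. Qed.

Lemma sum_exp2_le n : \sum_(0 <= k < n) (2 : R) ^+ k <= 2 ^+ n.
Proof.
elim: n => [|n IH]; first by rewrite big_geq// expr0.
by rewrite big_nat_recr//= exprS; lra.
Qed.

Definition cauchy_term (k : nat) : R[i] -> R[i] :=
  fun z => ((half k)%:C)%C * (((1 + half k)%:C)%C - z)^-1.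

(** An average of Cauchy kernels with poles at 1 + 2^-k, each of modulus about min(1, 2^-k / |1 -
    z|): a holomorphic substitute for log(1/|1-z|) / N cut off at scale 2^-N. *)
Definition peak (N : nat) : R[i] -> R[i] :=
  fun z => ((N%:R^-1 : R)%:C)%C * \sum_(k < N) cauchy_term k z.

Definition peak_deriv (N : nat) : R[i] -> R[i] :=
  fun z => ((N%:R^-1 : R)%:C)%C *
    \sum_(k < N) (((half k)%:C)%C * ((((1 + half k)%:C)%C - z)^-1) ^+ 2).

Lemma pole_dist (t : R) z : 0 <= t -> disc z ->
  t <= normc (((1 + t)%:C)%C - z) /\ normc (1 - z) <= normc (((1 + t)%:C)%C - z).
Proof.
rewrite /unit_disc /= => t0 zD; split.
  have := normc_sub_le (((1 + t)%:C)%C) z; rewrite normc_real ger0_norm; lra.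
rewrite -(@ler_pXn2r _ 2)// ?nnegrE ?normc_ge0// !normc_sqr !cReB !cImB /=.
have := le_trans (ler_norm _) (le_Re_normc z); set x := complex.Re z => xz.
rewrite lerD2r ler_pXn2r ?nnegrE//; lra.
Qed.

Lemma pole_neq0 k z : disc z -> ((1 + half k)%:C)%C - z != 0.
Proof.
move=> zD; rewrite -normc_gt0.
have [h _] := pole_dist (ltW (ihalf_gt0 (R := R) k)) zD.
exact: lt_le_trans (ihalf_gt0 _) h.
Qed.

Lemma disc_neq1 z : disc z -> 0 < normc (1 - z) < 2.
Proof.
rewrite /unit_disc /= => zD; have := normc_sub_le 1 z; have := le_normcD 1 (- z).
by rewrite normcN Normc.normc1; lra.
Qed.

Lemma cauchy_term_bound k z : disc z ->
  normc (cauchy_term k z) <= 1 /\ normc (cauchy_term k z) <= half k / normc (1 - z).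
Proof.
move=> zD; have hk := ihalf_gt0 (R := R) k.
have [h1 h2] := pole_dist (ltW hk) zD; have /andP[x0 _] := disc_neq1 zD.
rewrite Normc.normcM Normc.normcV normc_real ger0_norm ?(ltW hk)//; split.
  by rewrite ler_pdivrMr ?mul1r//; exact: lt_le_trans h1.
by rewrite ler_pM2l// lef_pV2 ?posrE//; exact: lt_le_trans h2.
Qed.

Lemma peak_bound N z : (0 < N)%N -> disc z ->
  normc (peak N z) <= 1 /\ normc (peak N z) <= 2 / (N%:R * normc (1 - z)).
Proof.
move=> N0 zD; have Np : 0 < N%:R :> R by rewrite ltr0n.
have /andP[x0 _] := disc_neq1 zD.
rewrite Normc.normcM normc_real ger0_norm ?invr_ge0//; split.
  rewrite mulrC ler_pdivrMr// mul1r; apply: le_trans (normc_sum _ _ _) _.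
  rewrite -[leRHS]mulr1 mulr_natl -[X in _ *+ X]card_ord -sumr_const.
  by apply: ler_sum => k _; have [] := cauchy_term_bound k zD.
rewrite invfM mulrCA ler_pM2l ?invr_gt0//.
apply: le_trans (normc_sum _ _ _) _.
apply: (@le_trans _ _ (\sum_(k < N) half k / normc (1 - z))).
  by apply: ler_sum => k _; have [] := cauchy_term_bound k zD.
rewrite -mulr_suml ler_pM2r ?invr_gt0//.
by have := sum_half_le (R := R) 0 N; rewrite big_mkord expr0 mulr1.
Qed.

Lemma cdiff_sum (n : nat) (u v : nat -> R[i] -> R[i]) z :
  (forall k, cdiff (u k) z (v k z)) ->
  cdiff (fun w => \sum_(k < n) u k w) z (\sum_(k < n) v k z).
Proof.
move=> uv; elim: n => [|n IH].
  rewrite big_ord0; apply: cdiff_ext (cdiff_cst 0 z) => w; by rewrite big_ord0.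
rewrite big_ord_recr /=; apply: cdiff_ext (cdiffD IH (uv n)) => w.
by rewrite big_ord_recr.
Qed.

Lemma peak_cdiff N z : disc z -> cdiff (peak N) z (peak_deriv N z).
Proof.
move=> zD; apply: cdiffZ.
apply: (@cdiff_sum N cauchy_term (fun k z => ((half k)%:C)%C * ((((1 + half k)%:C)%C - z)^-1) ^+ 2)) => k.
apply: cdiffZ.
have D : cdiff (fun w => ((1 + half k)%:C)%C - w) z (0 - 1) by apply: cdiffB; [exact: cdiff_cst|exact: cdiff_id].
have nz := pole_neq0 k zD.
apply: cdiff_eq (@cdiffV _ (fun w => ((1 + half k)%:C)%C - w) _ _ nz D).
by rewrite sub0r opprK mul1r exprVn.
Qed.

Lemma peak_holD N : holD (peak N).
Proof. by move=> z /(peak_cdiff N)/cdiff_derivable[]. Qed.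

Lemma peak_cderiv N z : disc z -> cderiv (peak N) z = peak_deriv N z.
Proof. by move=> /(peak_cdiff N)/cdiff_derivable[]. Qed.

(** If |1 - z| / 2 is about 2^-n, the terms with k < n are at most 2^k and the others at most 2^-k
    4^n; both geometric sums are of order 2^n. Cutting [m] off at [N] leaves only N + 1 scales. *)
Lemma sum_deriv_bound N z : disc z -> exists2 m, (m <= N)%N &
  normc (1 - z) <= 2 * half m /\
  normc (\sum_(k < N) (((half k)%:C)%C * ((((1 + half k)%:C)%C - z)^-1) ^+ 2)) <= 3 * 2 ^+ m.
Proof.
move=> zD; have /andP[x0 x2] := disc_neq1 zD; set x := normc (1 - z) in x0 x2 *.
have [|n /andP[n1 n2]] := @dyadic R (x / 2); first by apply/andP; split; lra.
have hn := ihalf_gt0 (R := R) n.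
exists (minn n N); first exact: geq_minr.
split.
  apply: (@le_trans _ _ (2 * half n)); first by lra.
  by rewrite ler_pM2l// half_mono// geq_minl.
pose a k := normc (((half k)%:C)%C * ((((1 + half k)%:C)%C - z)^-1) ^+ 2).
have aE k : a k = half k * (normc (((1 + half k)%:C)%C - z))^-1 ^+ 2.
  by rewrite /a Normc.normcM normcX Normc.normcV normc_real ger0_norm// ltW// ihalf_gt0.
have a1 k : a k <= 2 ^+ k.
  have hk := ihalf_gt0 (R := R) k; have [h _] := pole_dist (ltW hk) zD.
  rewrite aE; apply: (@le_trans _ _ (half k * (half k)^-1 ^+ 2)).
    rewrite ler_pM2l// ler_pXn2r ?nnegrE ?invr_ge0 ?normc_ge0 ?(ltW hk)// lef_pV2 ?posrE//.
    exact: lt_le_trans h.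
  by rewrite expr2 mulrA divff ?gt_eqF// mul1r exprVn invrK.
have a2 k : a k <= half k * (2 ^+ n) ^+ 2.
  have hk := ihalf_gt0 (R := R) k; have [_ h] := pole_dist (ltW hk) zD.
  rewrite aE ler_pM2l// ler_pXn2r ?nnegrE ?invr_ge0 ?normc_ge0 ?exprn_ge0//.
  have -> : (2 : R) ^+ n = (half n)^-1 by rewrite exprVn invrK.
  rewrite lef_pV2 ?posrE//; last exact: lt_le_trans h.
  by apply: le_trans h; rewrite -/x; move: n1; rewrite ihalfS; lra.
apply: le_trans (normc_sum _ _ _) _; rewrite -(big_mkord xpredT a).
rewrite (@big_cat_nat _ _ _ (minn n N))//=; last exact: geq_minr.
have s1 : \sum_(0 <= k < minn n N) a k <= 2 ^+ minn n N.
  by apply: le_trans (sum_exp2_le _); apply: ler_sum.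
have s2 : \sum_(minn n N <= k < N) a k <= 2 * 2 ^+ minn n N.
  have [nN|Nn] := leqP n N; last first.
    by rewrite big_geq// mulr_ge0// exprn_ge0.
  apply: (@le_trans _ _ (\sum_(n <= k < N) half k * (2 ^+ n) ^+ 2)); first exact: ler_sum.
  rewrite -mulr_suml; apply: le_trans (ler_wpM2r _ (sum_half_le _ _)) _; first exact: sqr_ge0.
  by rewrite expr2 -mulrA (mulrA (half n)) half_expK mul1r.
by lra.
Qed.

Lemma box_area (a b c d : R) : a <= b -> c <= d -> mu2 (box a b c d) = ((b - a) * (d - c))%:E.
Proof.
by move=> ab cd; rewrite /box product_measure1E//; rewrite EFinM; congr (_ * _)%E; apply: mu_itv.
Qed.

(** At scale m the squared derivative is at most 9 * 4^m / N^2, on a square of area 16 * 4^-m around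
    1. Each of the N + 1 scales thus contributes 144 / N^2, and N + 1 <= 2N. *)
Lemma peak_energy N : (0 < N)%N ->
  (\int[mu2]_(w in pdisc) (density 2 0 (cderiv (peak N)) w)%:E <= (288 / N%:R)%:E)%E.
Proof.
move=> N0; have Np : 0 < N%:R :> R by rewrite ltr0n.
pose Q m : set MT := box (1 - 2 * half m) (1 + 2 * half m) (- (2 * half m)) (2 * half m).
have mQ m : measurable (Q m) by exact: measurable_box.
pose k m : R := N%:R^-1 ^+ 2 * (9 * 4 ^+ m).
have k0 m : 0 <= k m by rewrite !mulr_ge0 ?exprn_ge0 ?invr_ge0.
have aQ m : (mu2 (Q m) <= (16 * half m ^+ 2)%:E)%E.
  have hm := ihalf_gt0 (R := R) m; rewrite box_area; [|lra..].
  by rewrite lee_fin; set t := half m; rewrite le_eqVlt; apply/orP; left; apply/eqP; ring.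
have mi m : measurable_fun (pdisc : set MT) (fun w => (k m * \1_(Q m) w)%:E).
  apply/measurable_EFinP; apply: measurable_funM; first exact: measurable_cst.
  by apply: measurable_funTS; exact: measurable_indic.
have i0 m (w : MT) : (0 <= (k m * \1_(Q m) w)%:E)%E by rewrite lee_fin mulr_ge0.
apply: (@le_trans _ _ (\int[mu2]_(w in pdisc) (\sum_(m < N.+1) (k m * \1_(Q m) w)%:E))%E).
  apply: ge0_le_integral.
  - exact: measurable_pdisc.
  - by move=> w _; rewrite lee_fin density_ge0.
  - by apply: measurable_density => // z; apply: holD_deriv_cont; exact: peak_holD.
  - by apply: emeasurable_sum => m; exact: mi.
  move=> w wD; rewrite density20 peak_cderiv// sumEFin lee_fin.
  have [m mN [xm Sm]] := sum_deriv_bound N wD.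
  rewrite (bigD1 (inord m))//= inordK//.
  apply: (@le_trans _ _ (k m * \1_(Q m) w)); last first.
    by rewrite lerDl sumr_ge0// => j _; rewrite mulr_ge0.
  rewrite indicE mem_set ?mulr1; last first.
    apply/boxP; rewrite /rect; have := le_trans (le_Re_normc _) xm; have := le_trans (le_Im_normc _) xm.
    by rewrite cReB cImB !ler_norml /=; set a := w.1; set b := w.2; clear; lra.
  rewrite /peak_deriv Normc.normcM normc_real ger0_norm ?invr_ge0// exprMn ler_wpM2l ?exprn_ge0 ?invr_ge0//.
  have -> : 9 * 4 ^+ m = (3 * 2 ^+ m) ^+ 2 :> R.
    by rewrite exprMn -exprM mulnC exprM; congr (_ * _ ^+ _); ring.
  by rewrite ler_pXn2r ?nnegrE ?normc_ge0// mulr_ge0// exprn_ge0.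
rewrite ge0_integral_sum//; last exact: measurable_pdisc.
apply: (@le_trans _ _ (\sum_(m < N.+1) (N%:R^-1 ^+ 2 * 144)%:E)%E); last first.
  rewrite sumEFin lee_fin sumr_const card_ord -[leLHS]mulr_natl.
  have -> : 288 / N%:R = (N%:R + N%:R) * (N%:R^-1 ^+ 2 * 144) :> R by field; rewrite gt_eqF.
  apply: ler_wpM2r; first by rewrite mulr_ge0 ?exprn_ge0 ?invr_ge0.
  by rewrite -natr1 lerD2l ler1n.
apply: lee_sum => m _; under eq_integral do rewrite EFinM.
rewrite ge0_integralZl//; last 3 first.
- exact: measurable_pdisc.
- by apply/measurable_EFinP; apply: measurable_funTS; exact: measurable_indic.
- by rewrite lee_fin.
rewrite integral_indic//; last exact: measurable_pdisc.
apply: (@le_trans _ _ ((k m)%:E * (16 * half m ^+ 2)%:E)%E).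
  apply: lee_wpmul2l; first by rewrite lee_fin.
  apply: le_trans (aQ m); apply: le_measure; rewrite ?inE//.
  by apply: measurableI => //; exact: measurable_pdisc.
rewrite -EFinM lee_fin /k -!mulrA ler_wpM2l ?exprn_ge0 ?invr_ge0//.
have -> : (4 : R) ^+ m = (2 ^+ m) ^+ 2 by rewrite -exprM mulnC exprM; congr (_ ^+ _); ring.
have H : half m ^+ 2 * (2 ^+ m) ^+ 2 = 1 by rewrite -exprMn half_expK expr1n.
rewrite le_eqVlt; apply/orP; left; apply/eqP.
rewrite (_ : 9 * ((2 ^+ m) ^+ 2 * (16 * half m ^+ 2)) = 144 * (half m ^+ 2 * (2 ^+ m) ^+ 2)).
  by rewrite H mulr1.
by ring.
Qed.

(** At this point the k-th kernel equals 2^-k / (2^-k + 2^-N), at least 1/2 for k < N. *)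
Lemma peak_top N : (0 < N)%N -> 2^-1 <= normc (peak N ((1 - half N)%:C)%C).
Proof.
move=> N0; have Np : 0 < N%:R :> R by rewrite ltr0n.
have hN := ihalf_gt0 (R := R) N.
have E k : cauchy_term k ((1 - half N)%:C)%C = ((half k / (half k + half N))%:C)%C.
  rewrite /cauchy_term -rmorphB /= -fmorphV -rmorphM /=; congr ((_ / _)%:C)%C; ring.
have -> : peak N ((1 - half N)%:C)%C = ((N%:R^-1 * \sum_(k < N) half k / (half k + half N))%:C)%C.
  rewrite /peak rmorphM rmorph_sum /=; congr (_ * _); apply: eq_bigr => k _; exact: E.
apply: le_trans (le_trans (ler_norm _) (le_Re_normc _)) => /=.
rewrite mulrC ler_pdivlMr// mulrC.
rewrite mulr_natl -[X in _ *+ X]card_ord -sumr_const; apply: ler_sum => k _.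
have hk := ihalf_gt0 (R := R) k; have : half N <= half k by rewrite half_mono// ltnW.
by move=> h; rewrite ler_pdivlMr ?addr_gt0//; lra.
Qed.

End Peaks.

(** * Sums of peaks and the choice of the next one *)

Section GlidingHump.
Context {R : realType}.
Local Notation MT := (measurableTypeR R * measurableTypeR R)%type.
Local Notation mu := (@lebesgue_measure R).
Local Notation mu2 := (@lebesgue_measure R \x @lebesgue_measure R)%E.
Local Notation disc := (@unit_disc R).
Implicit Types (f g h phi : R[i] -> R[i]) (z : R[i]).
Local Notation half n := ((2^-1 : R) ^+ n).

Definition locally_summable (u : nat -> R[i] -> R[i]) : Prop :=
  forall r : R, r < 1 -> exists A : R, forall j z, normc z <= r -> normc (u j z) <= A * half j.

Lemma csum_holD (u : nat -> R[i] -> R[i]) : (forall j, holD (u j)) -> locally_summable u ->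
  holD (fun w => csum (u^~ w)).
Proof. by move=> hu su z zD; have [/cdiff_derivable[]] := weierstrass hu su zD. Qed.

Lemma csum_cderiv (u : nat -> R[i] -> R[i]) z : (forall j, holD (u j)) -> locally_summable u ->
  disc z -> exists B : R, forall n, normc (cderiv (fun w => csum (u^~ w)) z -
    \sum_(j < n) cderiv (u j) z) <= B * half n.
Proof.
move=> hu su zD; have [/cdiff_derivable[_ ->] [B HB]] := weierstrass hu su zD.
by exists (4 * B) => n; exact: csum_tail.
Qed.

Lemma sum_half_lt1 n : \sum_(j < n) half j.+1 <= 1.
Proof.
rewrite -(big_mkord xpredT (fun j => half j.+1)) -[n]addn0 /=.
have := sum_half_le (R := R) 1 n.+1; rewrite big_add1 /= addn0 expr1.
by rewrite divff// pnatr_eq0.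
Qed.

(* Cauchy-Schwarz with the weights 2^-(j+1), whose sum is at most 1. *)
Lemma weighted_sum_sqr (b : nat -> R) n :
  (\sum_(j < n) b j) ^+ 2 <= \sum_(j < n) 2 ^+ j.+1 * b j ^+ 2.
Proof.
set S := \sum_(j < n) b j.
have H : 0 <= \sum_(j < n) half j.+1 * (2 ^+ j.+1 * b j - S) ^+ 2.
  by apply: sumr_ge0 => j _; rewrite mulr_ge0 ?sqr_ge0// ltW// ihalf_gt0.
have E t : \sum_(j < n) half j.+1 * (2 ^+ j.+1 * b j - t) ^+ 2 =
  \sum_(j < n) 2 ^+ j.+1 * b j ^+ 2 - 2 * t * (\sum_(j < n) b j) + t ^+ 2 * \sum_(j < n) half j.+1.
  rewrite !mulr_sumr -sumrB -big_split /=; apply: eq_bigr => j _.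
  have := @half_expK R j.+1; set x := half j.+1; set y := 2 ^+ j.+1 => xy.
  have -> : x * (y * b j - t) ^+ 2 = (x * y) * y * b j ^+ 2 - (x * y) * (2 * t * b j) + t ^+ 2 * x by ring.
  by rewrite xy; ring.
move: H; rewrite E; have := ler_wpM2l (sqr_ge0 S) (sum_half_lt1 n); rewrite mulr1.
by set q := \sum_(j < n) 2 ^+ _ * _; set t := S ^+ 2 * _; rewrite -/S !expr2; clear; lra.
Qed.

(** The weighted Cauchy-Schwarz inequality holds pointwise for the derivatives, so a nonnegative
    series can be integrated term by term. The weights 2^(j+1) are harmless for energies of order
    8^-j. *)
Lemma csum_dirichlet (u : nat -> R[i] -> R[i]) (e : nat -> R) (M : R) :
  (forall j, holD (u j)) -> locally_summable u ->
  (forall j, (\int[mu2]_(w in pdisc) (density 2 0 (cderiv (u j)) w)%:E <= (e j)%:E)%E) ->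
  (forall n, \sum_(0 <= j < n) 2 ^+ j.+1 * e j <= M) ->
  dirichlet (fun w => csum (u^~ w)).
Proof.
move=> hu su ue eM; set f := (fun w : R[i] => _).
have hf : holD f by exact: csum_holD.
apply/dirichletP; split => //.
pose D j (w : MT) : \bar R := ((2 ^+ j.+1)%:E * (density 2 0 (cderiv (u j)) w)%:E)%E.
have D0 j (w : MT) : (0 <= D j w)%E.
  by rewrite /D -EFinM lee_fin mulr_ge0 ?density_ge0// exprn_ge0.
have mdu j : measurable_fun (pdisc : set MT) (fun w => (density 2 0 (cderiv (u j)) w)%:E).
  by apply: measurable_density => // z; exact: holD_deriv_cont (hu j).
have mD j : measurable_fun (pdisc : set MT) (D j) by apply: measurable_funeM.
apply: (@le_lt_trans _ _ (\int[mu2]_(w in pdisc) (\sum_(0 <= j <oo) D j w))%E).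
  apply: ge0_le_integral.
  - exact: measurable_pdisc.
  - by move=> w _; rewrite lee_fin density_ge0.
  - by apply: measurable_density => // z; exact: holD_deriv_cont hf.
  - by apply: ge0_emeasurable_sum.
  move=> w wD; rewrite density20.
  have [B HB] := csum_cderiv hu su wD; set g := cderiv f (pt w) in HB *.
  have part n : (\sum_(0 <= j < n) D j w <= \sum_(0 <= j <oo) D j w)%E.
    by apply: nneseries_lim_ge => j _ _.
  set S := (\sum_(0 <= j <oo) _)%E in part *.
  have S0 : (0 <= S)%E by apply: nneseries_ge0 => j _ _.
  case: S part S0 => [s||] // part s0; last by rewrite leey.
  rewrite lee_fin in s0; rewrite lee_fin.
  have part' n : normc (\sum_(j < n) cderiv (u j) (pt w)) <= Num.sqrt s.
    rewrite -(@ler_pXn2r _ 2)// ?nnegrE ?normc_ge0 ?sqrtr_ge0// sqr_sqrtr//.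
    apply: (@le_trans _ _ ((\sum_(j < n) normc (cderiv (u j) (pt w))) ^+ 2)).
      rewrite ler_pXn2r ?nnegrE ?normc_ge0 ?normc_sum//.
      by apply: sumr_ge0 => j _; exact: normc_ge0.
    apply: le_trans (weighted_sum_sqr (fun j => normc (cderiv (u j) (pt w))) n) _.
    have := part n; rewrite big_mkord -lee_fin -sumEFin; apply: le_trans.
    by rewrite le_eqVlt; apply/orP; left; apply/eqP; apply: eq_bigr => j _; rewrite /D density20 EFinM.
  have gs : normc g <= Num.sqrt s.
    apply: (@le_half_eps _ _ _ B) => n; have := part' n; have := HB n.
    have := le_normcD (g - \sum_(j < n) cderiv (u j) (pt w)) (\sum_(j < n) cderiv (u j) (pt w)).
    by rewrite subrK; set a := normc g; set b := normc (_ - _); set c := normc (\sum_(_ < _) _); lra.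
  by rewrite -[leRHS](sqr_sqrtr s0) ler_pXn2r ?nnegrE ?normc_ge0 ?sqrtr_ge0.
rewrite integral_nneseries//; last exact: measurable_pdisc.
apply: (@le_lt_trans _ _ M%:E); last by rewrite ltry.
apply: nneseries_bound => [j|n]; first exact: integral_ge0.
apply: (@le_trans _ _ (\sum_(0 <= j < n) (2 ^+ j.+1 * e j)%:E)%E); last first.
  by rewrite sumEFin lee_fin.
apply: lee_sum => j _; rewrite ge0_integralZl//; last 2 first.
- exact: measurable_pdisc.
- by move=> w _; rewrite lee_fin density_ge0.
by rewrite EFinM; apply: lee_wpmul2l; rewrite ?lee_fin ?exprn_ge0.
Qed.

Lemma density20_deriv f (l : R[i]) (w : MT) : cdiff f (pt w) l -> density 2 0 (cderiv f) w = normc l ^+ 2.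
Proof. by move=> /cdiff_derivable[_ <-]; exact: density20. Qed.

Lemma scaled_peak_energy (c : R[i]) N : (0 < N)%N ->
  (\int[mu2]_(w in pdisc) (density 2 0 (cderiv (fun z => c * peak N z)) w)%:E <=
     (normc c ^+ 2 * (288 / N%:R))%:E)%E.
Proof.
move=> N0.
have md : measurable_fun (pdisc : set MT) (fun w => (density 2 0 (cderiv (peak N)) w)%:E).
  by apply: measurable_density => // z; apply: holD_deriv_cont; exact: peak_holD.
have E (w : MT) : pdisc w -> (density 2 0 (cderiv (fun z => c * peak N z)) w)%:E =
    ((normc c ^+ 2)%:E * (density 2 0 (cderiv (peak N)) w)%:E)%E.
  move=> wD; apply: (etrans (congr1 EFin (density20_deriv (cdiffZ c (peak_cdiff N wD))))).
  have /(congr1 (fun t => (normc c ^+ 2 * t)%:E)) e := density20_deriv (peak_cdiff N wD).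
  by rewrite Normc.normcM exprMn; exact: esym e.
apply: (@le_trans _ _ (\int[mu2]_(w in pdisc) ((normc c ^+ 2)%:E * (density 2 0 (cderiv (peak N)) w)%:E))%E).
  by rewrite le_eqVlt; apply/orP; left; apply/eqP; apply: eq_integral => w; rewrite inE => /E.
rewrite ge0_integralZl//; last 3 first.
- exact: measurable_pdisc.
- by move=> w _; rewrite lee_fin density_ge0.
- by rewrite lee_fin exprn_ge0 ?normc_ge0.
by rewrite (EFinM (normc c ^+ 2)); apply: lee_wpmul2l; [rewrite lee_fin exprn_ge0 ?normc_ge0|exact: peak_energy].
Qed.

Record hump := Hump { hw : R[i]; hN : nat; hc : R[i]; hdelta : R; hT : R }.

(* hw is the value that the partial sum g + hc * peak takes at 1 - 2^-hN, hdelta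
   the error of f there for which phi remains large, hT a bound for the new
   partial sum. *)
Definition good_hump phi (j : nat) (g : R[i] -> R[i]) (T : R) (q : hump) : Prop :=
  [/\ [/\ T <= normc (hw q), (0 < hN q)%N,
      8 ^+ j * normc (hw q) ^+ 2 <= (hN q)%:R & (hN q)%:R <= 2 * (8 ^+ j * normc (hw q) ^+ 2)],
     g ((1 - half (hN q))%:C)%C + hc q * peak (hN q) ((1 - half (hN q))%:C)%C = hw q,
     normc (hc q) <= 4 * normc (hw q),
     forall v, normc (v - hw q) <= hdelta q -> expR (16 ^+ j * normc (hw q) ^+ 2) - 1 <= normc (phi v) &
     [/\ 0 < hdelta q, T <= hT q, 8 * 2 ^+ (hN q) / hdelta q <= hT q &
       forall z, disc z -> normc (g z + hc q * peak (hN q) z) <= hT q]].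

Lemma half_disc N : disc ((1 - half N)%:C)%C.
Proof.
rewrite /unit_disc /mkset normc_real ger0_norm; last by rewrite subr_ge0 ihalf_le1.
by have := ihalf_gt0 (R := R) N; lra.
Qed.

(** Once w and N are fixed, the coefficient c is solved from g + c peak = w at 1 - 2^-N. As the peak
    is at least 1/2 there and |g| <= T <= |w|, this gives |c| <= 4|w|. *)
Lemma next_hump phi j g (T : R) : entire phi ->
  (forall K S : R, 1 <= K -> exists2 w, S <= normc w & expR (K * normc w ^+ 2) < normc (phi w)) ->
  1 <= T -> (forall z, disc z -> normc (g z) <= T) -> exists q, good_hump phi j g T q.
Proof.
move=> ephi Hw T1 gT.
have [|w wT phw] := Hw (16 ^+ j) T; first by rewrite exprn_ege1// ler1n.
have w1 : 1 <= normc w by exact: le_trans wT.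
pose x := 8 ^+ j * normc w ^+ 2.
have x1 : 1 <= x.
  by rewrite -[leLHS]mulr1 ler_pM// ?exprn_ege1// ler1n.
(* Rounding up x >= 1 gives x <= N <= 2x. *)
pose N := (Num.truncn x).+1.
have /andP[Nx xN] : (Num.truncn x)%:R <= x < (Num.truncn x).+1%:R by apply: truncn_itv; lra.
have Nx2 : N%:R <= 2 * x by rewrite /N -natr1; lra.
pose zN : R[i] := ((1 - half N)%:C)%C.
have zD : disc zN by exact: half_disc.
have N0 : (0 < N)%N by [].
have E2 := @peak_top R N N0; set E := peak N _ in E2.
have E0 : E != 0 by rewrite -normc_gt0; apply: lt_le_trans E2; rewrite invr_gt0.
pose c := (w - g zN) / E.
have nc : normc c <= 4 * normc w.
  rewrite /c Normc.normcM Normc.normcV ler_pdivrMr ?normc_gt0//.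
  have h1 : normc (w - g zN) <= 2 * normc w.
    by have := le_normcD w (- g zN); rewrite normcN; have := gT _ zD; lra.
  apply: le_trans h1 _; have := ler_wpM2l (normc_ge0 w) E2.
  by set a := normc w * normc E => h; rewrite -mulrA -/a; lra.
have [d d0 Hd] := cdiff_ccont (entire_cdiff w ephi) ltr01.
(* Half of [d] because continuity gives a strict inequality. The summand 8 * 2^N / (d / 2) forces
   all later targets to be so large that their humps are small at this point. *)
exists (Hump w N c (d / 2) (T + 4 * normc w + 8 * 2 ^+ N / (d / 2))); rewrite /good_hump /=.
have t0 : 0 <= 8 * 2 ^+ N / (d / 2) by rewrite !mulr_ge0 ?exprn_ge0 ?invr_ge0// ltW// divr_gt0.
split => //.
- by split => //; rewrite -/x ltW.
- by rewrite -/zN -/E /c divfK// addrC subrK.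
- move=> v vw; have {}vw : normc (v - w) < d by lra.
  have := Hd _ vw; have := normc_sub_le (phi w) (phi v); rewrite normcB; lra.
split; [by rewrite divr_gt0|lra|lra|].
move=> z zD'; apply: le_trans (le_normcD _ _) _; rewrite Normc.normcM.
have [p1 _] := peak_bound N0 zD'.
have := ler_pM (normc_ge0 c) (normc_ge0 (peak N z)) nc p1; have := gT _ zD'.
by rewrite mulr1; move: t0; set t := 8 * _ / _; lra.
Qed.

End GlidingHump.

(** * Necessity for the Dirichlet space *)

Section Necessity.
Context {R : realType}.
Local Notation MT := (measurableTypeR R * measurableTypeR R)%type.
Local Notation mu2 := (@lebesgue_measure R \x @lebesgue_measure R)%E.
Local Notation disc := (@unit_disc R).
Implicit Types (f g h phi : R[i] -> R[i]) (z : R[i]).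
Local Notation half n := ((2^-1 : R) ^+ n).

Lemma inv8_le_half j : ((8 : R) ^+ j)^-1 <= half j.
Proof.
rewrite exprVn lef_pV2 ?posrE ?exprn_gt0//.
by apply: lerXn2r; rewrite ?nnegrE ?ler_nat.
Qed.

(** The amplitude 4|w| meets the decay 2 / (N |1 - z|) of the peak, and N >= 8^j |w|^2. Away from 1
    the humps are thus O(8^-j), and smaller the larger the target |w|. *)
Lemma hump_bound phi j g (T : R) q z : 1 <= T -> good_hump phi j g T q -> disc z ->
  normc (hc q * peak (hN q) z) <= 8 / (8 ^+ j * normc (hw q) * normc (1 - z)).
Proof.
move=> T1 [[wT N0 N1 _] _ cw _ _] zD.
have w0 : 0 < normc (hw q) by lra.
have /andP[x0 _] := disc_neq1 zD.
have [_ p] := peak_bound N0 zD.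
rewrite Normc.normcM; apply: le_trans (ler_pM (normc_ge0 _) (normc_ge0 _) cw p) _.
have e0 : 0 < 8 ^+ j :> R by exact: exprn_gt0.
move: N1; set N := (hN q)%:R; set w := normc (hw q) in w0 *; set x := normc _ in x0 * => N1.
have Np : 0 < N by apply: lt_le_trans N1; rewrite mulr_gt0 ?exprn_gt0.
have -> : 8 / (8 ^+ j * w * x) = 4 * w * (2 / (8 ^+ j * w ^+ 2 * x)).
  by field; rewrite !gt_eqF.
rewrite ler_pM2l ?mulr_gt0// ler_pM2l// lef_pV2 ?posrE ?mulr_gt0 ?exprn_gt0//.
by rewrite ler_pM2r.
Qed.

(** At the j-th point the partial sum equals w_j exactly, and all later humps together move the
    value by at most delta_j, within which phi is still large. *)
Lemma gliding_hump phi : entire phi ->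
  (forall K S : R, 1 <= K -> exists2 w, S <= normc w & expR (K * normc w ^+ 2) < normc (phi w)) ->
  exists2 f, dirichlet f & exists (x : nat -> R) (N : nat -> nat), forall j,
    [/\ 1 <= x j, (N j)%:R <= 2 * (8 ^+ j * x j) &
        expR (16 ^+ j * x j) - 1 <= normc (phi (f ((1 - half (N j))%:C)%C))].
Proof.
move=> ephi Hw.
pose Inv (s : (R[i] -> R[i]) * R) := 1 <= s.2 /\ forall z, disc z -> normc (s.1 z) <= s.2.
have /boolp.choice[nx Hnx] : forall x : nat * ((R[i] -> R[i]) * R), exists q, Inv x.2 ->
    good_hump phi x.1 x.2.1 x.2.2 q.
  move=> [j [g T]].
  (* Choice needs a hump for every state; the dummy one is never reached, as [invst] shows. *)
  have [[T1 gT]|nI] := pselect (Inv (g, T)); last by exists (Hump 0 0 0 0 0).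
  by have [q Hq] := @next_hump _ phi j g T ephi Hw T1 gT; exists q.
pose step j s := (fun z => s.1 z + hc (nx (j, s)) * peak (hN (nx (j, s))) z, hT (nx (j, s))).
pose st := fix st j : (R[i] -> R[i]) * R := if j is k.+1 then step k (st k) else (fun=> 0, 1).
pose q j := nx (j, st j).
have stS j : st j.+1 = step j (st j) by [].
have invst j : Inv (st j).
  elim: j => [|j IH]; first by split => [|z _]; [exact: lexx|change (normc (0 : R[i]) <= 1); rewrite Normc.normc0 ler01].
  have [_ _ _ _ [_ T1 _ gT]] := Hnx (j, st j) IH; rewrite stS /step /Inv /=; split => //.
  by apply: le_trans T1; have [] := IH.
have gh j : good_hump phi j (st j).1 (st j).2 (q j) by exact: Hnx (j, st j) (invst j).
have T1 j : 1 <= (st j).2 by have [] := invst j.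
have w1 j : 1 <= normc (hw (q j)) by have [[wT _ _ _] _ _ _ _] := gh j; exact: le_trans (T1 j) wT.
pose u j z := hc (q j) * peak (hN (q j)) z.
have stE j z : (st j).1 z = \sum_(i < j) u i z.
  by elim: j => [|j IH]; rewrite ?big_ord0// big_ord_recr /= -IH.
have Tmono i k : (st i).2 <= (st (i + k)%N).2.
  elim: k => [|k IH]; first by rewrite addn0.
  apply: le_trans IH _; rewrite addnS stS /=.
  by have [_ _ _ _ [_ h _ _]] := gh (i + k)%N.
have ub j z : disc z -> normc (u j z) <= 8 / (8 ^+ j * normc (hw (q j)) * normc (1 - z)).
  by move=> zD; exact: hump_bound (T1 j) (gh j) zD.
have e8 j : 0 < 8 ^+ j :> R by exact: exprn_gt0.
have hu j : holD (u j).
  by move=> z zD; have [] := cdiff_derivable (cdiffZ (hc (q j)) (peak_cdiff (hN (q j)) zD)).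
have su : locally_summable u.
  move=> r r1; exists (8 / (1 - r)) => j z zr.
  have r0 : 0 < 1 - r by rewrite subr_gt0.
  have zD : disc z by rewrite /unit_disc /=; lra.
  apply: le_trans (ub j z zD) _.
  have x1 : 1 - r <= normc (1 - z) by have := normc_sub_le 1 z; rewrite Normc.normc1; lra.
  apply: (@le_trans _ _ (8 / (8 ^+ j * (1 - r)))).
    move: (w1 j) x1; set w := normc (hw _); set x := normc _ => ww x1.
    have w0 : 0 < w := lt_le_trans ltr01 ww; have x0 : 0 < x := lt_le_trans r0 x1.
    rewrite ler_pM2l// lef_pV2 ?posrE ?mulr_gt0// -mulrA ler_pM2l// -[leLHS]mul1r.
    exact: ler_pM ler01 (ltW r0) ww x1.
  rewrite invfM mulrA mulrAC ler_pM2l ?divr_gt0//; exact: inv8_le_half.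
exists (fun z => csum (u^~ z)).
  (* The energy is at most (4|w|)^2 * 288 / N with N >= 8^j |w|^2. Against the weight 2^(j+1) the
     factor 2 * 4^-j remains, bounded by 2 * 2^-j. *)
  apply: (@csum_dirichlet _ u (fun j => 16 * 288 * (8 ^+ j)^-1) (16 * 288 * 4)) => //.
    move=> j; have [[_ N0 N1 _] _ cw _ _] := gh j.
    apply: le_trans (@scaled_peak_energy _ (hc (q j)) _ N0) _; rewrite lee_fin.
    have w0 : 0 < normc (hw (q j)) by have := w1 j; lra.
    move: N1 cw; set N := (hN _)%:R; set w := normc (hw _) in w0 * => N1 cw.
    have Np : 0 < N by apply: lt_le_trans N1; rewrite mulr_gt0 ?exprn_gt0.
    apply: (@le_trans _ _ ((4 * w) ^+ 2 * (288 / (8 ^+ j * w ^+ 2)))).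
      apply: ler_pM; rewrite ?exprn_ge0 ?normc_ge0 ?divr_ge0//.
        by rewrite ler_pXn2r ?nnegrE ?normc_ge0// mulr_ge0// ltW.
      by rewrite ler_pM2l// lef_pV2 ?posrE ?mulr_gt0 ?exprn_gt0.
    rewrite le_eqVlt; apply/orP; left; apply/eqP.
    have := gt_eqF w0; have := gt_eqF (e8 j); move: (8 ^+ j) => y y0 w0'.
    by field; rewrite y0 w0'.
  move=> n; apply: (@le_trans _ _ (\sum_(0 <= j < n) 16 * 288 * 2 * half j)).
    apply: ler_sum => j _.
    have -> : 2 ^+ j.+1 * (16 * 288 * (8 ^+ j)^-1) = 16 * 288 * 2 * (2 ^+ j * (8 ^+ j)^-1) :> R.
      by rewrite exprS; ring.
    apply: ler_wpM2l; first by rewrite !mulr_ge0.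
    by rewrite -exprVn -exprMn; apply: lerXn2r; rewrite ?nnegrE; lra.
  rewrite -mulr_sumr; have := sum_half_le (R := R) 0 n; rewrite expr0; lra.
exists (fun j => normc (hw (q j)) ^+ 2), (fun j => hN (q j)) => i.
have [[_ _ _ N2] hit _ far [d0 _ T2 _]] := gh i.
split => //; first by rewrite exprn_ege1.
apply: far; set zi := ((1 - _)%:C)%C; set d := hdelta (q i) in d0 T2 *.
have ziD : disc zi by exact: half_disc.
have ni : normc (1 - zi) = half (hN (q i)).
  have -> : 1 - zi = ((half (hN (q i)))%:C)%C by rewrite /zi rmorphB /= subKr.
  by rewrite normc_real ger0_norm// ltW// ihalf_gt0.
have [A HA] := su _ ziD.
have uA j : normc (u j zi) <= A * half j by exact: HA.
have A0 : 0 <= A by have := uA 0%N; rewrite expr0 mulr1; apply: le_trans; exact: normc_ge0.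
apply: (@le_half_eps _ _ _ (4 * A)) => n.
have T3 := csum_tail uA (i.+1 + n)%N.
rewrite big_split_ord /= in T3.
have hit' : \sum_(k < i.+1) u k zi = hw (q i) by rewrite -stE stS /= -[RHS]hit.
rewrite hit' in T3.
(* A later target satisfies |w_j| >= 8 * 2^(N_i) / d, so at distance 2^-(N_i) from 1 [hump_bound]
   gives at most d * 8^-j. *)
have tail k : normc (u (i.+1 + k)%N zi) <= d * half k.+1.
  set j := (i.+1 + k)%N; apply: le_trans (ub j zi ziD) _; rewrite ni.
  have wj : 8 * 2 ^+ hN (q i) / d <= normc (hw (q j)).
    have [[wT _ _ _] _ _ _ _] := gh j; apply: le_trans wT.
    by apply: le_trans (Tmono i.+1 k); rewrite stS.
  have hh := @half_expK R (hN (q i)); have hp := ihalf_gt0 (R := R) (hN (q i)).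
  move: wj hh hp; set y := normc _; set t := half (hN _); set s := 2 ^+ hN _ => wj hh hp.
  have yt : 8 / d <= y * t.
    have -> : 8 / d = (8 * s / d) * t.
      by rewrite mulrAC -(mulrA 8) (mulrC s) hh mulr1.
    by rewrite ler_pM2r.
  have y0 : 0 < y * t by apply: lt_le_trans yt; rewrite divr_gt0.
  rewrite -mulrA invfM mulrA.
  apply: (@le_trans _ _ (d * (8 ^+ j)^-1)).
    rewrite mulrAC ler_pM2r ?invr_gt0// ler_pdivrMr//.
    by move: yt; rewrite ler_pdivrMr// mulrC.
  rewrite ler_pM2l//; apply: le_trans (inv8_le_half j) _.
  by apply: half_mono; rewrite /j addSn ltnS leq_addl.
set S := \sum_(k < n) _ in T3.
have nS : normc S <= d.
  apply: le_trans (normc_sum _ _ _) _.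
  apply: (@le_trans _ _ (\sum_(k < n) d * half k.+1)).
    by apply: ler_sum => k _; exact: tail.
  by rewrite -mulr_sumr -[leRHS]mulr1 ler_pM2l// sum_half_lt1.
set F := csum _ in T3 *.
have -> : F - hw (q i) = S + (F - (hw (q i) + S)) by ring.
apply: le_trans (le_normcD _ _) _; apply: lerD => //; apply: le_trans T3 _.
by rewrite ler_wpM2l ?mulr_ge0// half_mono// leq_addl.
Qed.

(** Growth at 1 - 2^-(N_j) gives 16^j x_j <= log(1 + 2C) + N_j log B, while N_j <= 2 * 8^j x_j.
    Dividing by 8^j x_j >= 1 bounds 2^j uniformly in j, which is absurd. *)
Lemma gauss_necessary (p alpha : R) phi : entire phi -> 0 < p ->
  superposition phi @` @dirichlet R `<=` weighted_dirichlet p alpha ->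
  (growth_order phi < 2%:E)%E \/ (growth_order phi = 2%:E /\ (growth_type phi < +oo)%E).
Proof.
move=> ephi p0 sub; apply: contrapT => nord.
have Hw (K S : R) : 1 <= K -> exists2 w, S <= normc w & expR (K * normc w ^+ 2) < normc (phi w).
  move=> K1; apply: contrapT => H; apply: nord; apply: (@gauss_order _ _ K S) => // w Sw.
  by rewrite leNgt; apply/negP => h; apply: H; exists w.
have [f df [x [N HN]]] := gliding_hump ephi Hw.
have [C [B [C0 B1 HC]]] := weighted_dirichlet_growth p0 (sub _ (ex_intro2 _ _ f df erefl)).
have B0 : 0 < B by lra.
have C1 : 0 < 1 + 2 * C by lra.
pose L := ln (1 + 2 * C) + 2 * ln B.
have l1 : 0 <= ln (1 + 2 * C) by rewrite ln_ge0//; lra.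
have l2 : 0 <= ln B by exact: ln_ge0.
have main j : 2 ^+ j <= L.
  have [x1 Nj Fj] := HN j; have e8 : 1 <= 8 ^+ j :> R by rewrite exprn_ege1// ler1n.
  have y1 : 1 <= 8 ^+ j * x j by rewrite -[leLHS]mulr1 ler_pM.
  have := le_trans Fj (HC (N j)); rewrite lerBlDr => H.
  have BN : 1 <= B ^+ N j by exact: exprn_ege1.
  have : expR (16 ^+ j * x j) <= (1 + 2 * C) * B ^+ N j.
    apply: le_trans H _; have := ler_wpM2l C0 BN; rewrite mulr1 mulrDl mul1r.
    by rewrite -!mulrA; set t := C * _; clear -BN; lra.
  have -> : (1 + 2 * C) * B ^+ N j = expR (ln (1 + 2 * C) + (N j)%:R * ln B).
    by rewrite expRD expRM_natl !lnK ?posrE.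
  rewrite ler_expR => {}H.
  have h1 : (N j)%:R * ln B <= 2 * (8 ^+ j * x j) * ln B by rewrite ler_wpM2r.
  have h2 : ln (1 + 2 * C) <= (8 ^+ j * x j) * ln (1 + 2 * C) by rewrite ler_peMl.
  have h3 : 16 ^+ j * x j = 2 ^+ j * (8 ^+ j * x j).
    by rewrite mulrA -exprMn; congr (_ ^+ _ * _); ring.
  have : 2 ^+ j * (8 ^+ j * x j) <= L * (8 ^+ j * x j).
    rewrite -h3; apply: le_trans H _.
    have -> : L * (8 ^+ j * x j) = 8 ^+ j * x j * ln (1 + 2 * C) + 2 * (8 ^+ j * x j) * ln B.
      by rewrite /L; ring.
    exact: lerD.
  by rewrite ler_pM2r//; lra.
have L0 : 0 < L by apply: lt_le_trans (main 0%N); rewrite expr0.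
have [n Hn] : exists n, half n < L^-1 by apply: ihalf_small; rewrite invr_gt0.
by move: Hn; rewrite exprVn ltf_pV2 ?posrE ?exprn_gt0// ltNge main.
Qed.

End Necessity.

(** * Lacunary series *)

Section Lacunary.
Context {R : realType}.
Local Notation MT := (measurableTypeR R * measurableTypeR R)%type.
Local Notation mu := (@lebesgue_measure R).
Local Notation mu2 := (@lebesgue_measure R \x @lebesgue_measure R)%E.
Local Notation disc := (@unit_disc R).
Implicit Types (f g h phi : R[i] -> R[i]) (z : R[i]).
Local Notation half n := ((2^-1 : R) ^+ n).

Lemma mu_oitv (a b : R) : a < b -> mu `]a, b[%classic = (b - a)%:E.
Proof. by move=> ab; have := lebesgue_measure_itv `]a, b[; rewrite /= lte_fin ab. Qed.

Definition annulus (a b : R) : set MT := [set w | a < normc (pt w) /\ normc (pt w) < b].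

Lemma measurable_annulus a b : measurable (annulus a b).
Proof.
have -> : annulus a b = [set w | ([set z | a < normc z] `&` [set z | - b < - normc z]) (pt w)].
  by apply/seteqP; split => w []; rewrite /annulus /= ltrN2.
apply: copen_measurable.
  apply: copenI; apply: copen_gt => z e e0; exists e => // w wz; apply: le_lt_trans wz.
    by rewrite ler_norml; have := normc_sub_le w z; have := normc_sub_le z w; rewrite (normcB z); lra.
  by rewrite ler_norml; have := normc_sub_le w z; have := normc_sub_le z w; rewrite (normcB z); lra.
Qed.

(** Only vertical slices over 0 <= x <= 1/2 are counted. The upper piece of such a slice is an
    interval of length t - s = (b^2 - a^2)/(t + s), at least (b - a)/2 because t + s <= 2 and a + b
    >= 1. *)
Lemma annulus_area (a b : R) : 2^-1 <= a -> a < b -> b <= 1 ->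
  (((b - a) / 4)%:E <= mu2 (annulus a b))%E.
Proof.
move=> a2 ab b1; have mA := measurable_annulus a b.
pose L : R -> \bar R := (fun=> ((b - a) / 2)%:E) \_ (`[0, 2^-1]%classic : set R).
have -> : ((b - a) / 4)%:E = (\int[mu]_x L x)%E.
  rewrite /L -integral_mkcond integral_cst//= mu_itv ?invr_ge0//.
  by rewrite -EFinM; congr EFin; field.
rewrite /product_measure1; apply: ge0_le_integral => //.
- move=> x _; rewrite /L patchE; case: ifPn => // _; rewrite lee_fin divr_ge0// subr_ge0; exact: ltW.
- by apply/measurable_restrict => //; exact: measurable_cst.
- exact: measurable_fun_xsection.
move=> x _; rewrite /L patchE; case: ifPn => [|_]; last exact: measure_ge0.
rewrite inE /= in_itv /= => /andP[x0 x2].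
have xa : x ^+ 2 <= a ^+ 2 by rewrite ler_pXn2r ?nnegrE//; lra.
have ab2 : a ^+ 2 < b ^+ 2 by rewrite ltr_pXn2r ?nnegrE//; lra.
have b2 : b ^+ 2 <= 1 by rewrite -(expr1n _ 2) ler_pXn2r ?nnegrE//; lra.
have x20 := sqr_ge0 x.
pose s := Num.sqrt (a ^+ 2 - x ^+ 2); pose t := Num.sqrt (b ^+ 2 - x ^+ 2).
have s0 : 0 <= s by exact: sqrtr_ge0.
have t0 : 0 <= t by exact: sqrtr_ge0.
have s2 : s ^+ 2 = a ^+ 2 - x ^+ 2 by rewrite sqr_sqrtr// subr_ge0.
have t2 : t ^+ 2 = b ^+ 2 - x ^+ 2 by rewrite sqr_sqrtr//; lra.
have st : s < t by rewrite -(@ltr_pXn2r _ 2)// ?nnegrE// s2 t2; lra.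
have t1 : t <= 1 by rewrite -(@ler_pXn2r _ 2)// ?nnegrE// t2 expr1n; lra.
have len : (b - a) / 2 <= t - s.
  have e : (t - s) * (t + s) = (b - a) * (b + a).
    by rewrite -!subr_sqr s2 t2; ring.
  have h1 : (t - s) * (t + s) <= (t - s) * 2 by rewrite ler_pM2l ?subr_gt0//; lra.
  have h2 : (b - a) * 1 <= (b - a) * (b + a) by rewrite ler_pM2l ?subr_gt0//; lra.
  by move: e h1 h2; clear; lra.
apply: (@le_trans _ _ (mu `]s, t[%classic)).
  by rewrite mu_oitv// lee_fin.
apply: le_measure; rewrite ?inE//; first exact: measurable_xsection.
move=> y /=; rewrite in_itv /= => /andP[sy yt]; rewrite /xsection /= inE /annulus /=.
have y0 : 0 <= y by exact: le_trans (ltW sy).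
have n2 : normc (pt (x, y)) ^+ 2 = x ^+ 2 + y ^+ 2 by rewrite normc_sqr.
have sy2 : s ^+ 2 < y ^+ 2 by rewrite ltr_pXn2r ?nnegrE.
have yt2 : y ^+ 2 < t ^+ 2 by rewrite ltr_pXn2r ?nnegrE.
rewrite s2 in sy2; rewrite t2 in yt2.
change (a < normc (pt (x, y)) /\ normc (pt (x, y)) < b); split.
  by rewrite -(@ltr_pXn2r _ 2)// ?nnegrE ?normc_ge0//; [rewrite n2; lra|lra].
by rewrite -(@ltr_pXn2r _ 2)// ?nnegrE ?normc_ge0//; [rewrite n2; lra|lra].
Qed.

(** 1 - r^n = (1 - r)(1 + ... + r^(n-1)), where each summand is at least r^(n-1); the induction
    carries the sharper bound 1 - r^n. *)
Lemma pow_slope (r : R) n : 0 <= r <= 1 -> (1 - r) * (n%:R * r ^+ n.-1) <= 1.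
Proof.
move=> /andP[r0 r1]; have H : (1 - r) * (n%:R * r ^+ n.-1) <= 1 - r ^+ n.
  elim: n => [|n IH]; first by rewrite mul0r mulr0 expr0 subrr.
  have rn : 0 <= r ^+ n <= 1 by rewrite exprn_ge0// exprn_ile1.
  have E : (1 - r) * (n.+1%:R * r ^+ n.+1.-1) = r * ((1 - r) * (n%:R * r ^+ n.-1)) + (1 - r) * r ^+ n.
    rewrite /= -natr1; case: n {IH rn} => [|n] /=; first by rewrite expr0; ring.
    by rewrite !exprS; ring.
  rewrite E exprS; have := ler_wpM2l r0 IH; move: (r ^+ n) rn => x /andP[x0 x1] h.
  have : 0 <= (1 - r) * (1 - x) by rewrite mulr_ge0// subr_ge0.
  by move: h; clear; set y := r * (_ * _); lra.
by apply: le_trans H _; rewrite gerBl exprn_ge0.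
Qed.

(** The exponent 2m - 1 splits as (m - 1) + m and [pow_slope] applies to both factors; this gains a
    factor 1/(m (1 - r)) over a single application. *)
Lemma pow_slope2 (r : R) m : (0 < m)%N -> 0 <= r < 1 ->
  (2 * m)%:R * r ^+ (2 * m).-1 <= 2 / (m%:R * (1 - r) ^+ 2).
Proof.
move=> m0 /andP[r0 r1]; have d0 : 0 < 1 - r by rewrite subr_gt0.
have mp : 0 < m%:R :> R by rewrite ltr0n.
have h1 : (1 - r) * (m%:R * r ^+ m.-1) <= 1 by apply: pow_slope; rewrite r0 ltW.
have rm : r ^+ m <= r ^+ m.-1 by apply: ler_wiXn2l; rewrite ?leq_pred// ltW.
rewrite ler_pdivlMr ?mulr_gt0 ?exprn_gt0//.
have -> : ((2 * m).-1 = m.-1 + m)%N by rewrite mul2n -addnn; case: (m) m0 => // k _; rewrite addSn.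
rewrite exprD natrM.
set A := r ^+ m.-1 in h1 rm *; set B := r ^+ m in rm *.
have A0 : 0 <= A by exact: exprn_ge0.
have B0 : 0 <= B by exact: exprn_ge0.
have -> : 2 * m%:R * (A * B) * (m%:R * (1 - r) ^+ 2) =
  2 * (((1 - r) * (m%:R * A)) * ((1 - r) * (m%:R * B))) by ring.
rewrite -[leRHS]mulr1 ler_pM2l//.
have h2 : (1 - r) * (m%:R * B) <= 1.
  by apply: le_trans h1; rewrite ler_pM2l// ler_pM2l.
rewrite -[leRHS]mulr1; apply: ler_pM => //; rewrite !mulr_ge0// ltW//.
Qed.

Lemma bernoulli_le (r : R) n : 0 <= r <= 1 -> 1 - n%:R * (1 - r) <= r ^+ n.
Proof.
move=> /andP[r0 r1]; elim: n => [|n IH]; first by rewrite mul0r subr0 expr0.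
have rn : r ^+ n <= 1 by exact: exprn_ile1.
rewrite -natr1 exprS; have : 0 <= (1 - r) * (1 - r ^+ n) by rewrite mulr_ge0// subr_ge0.
by move: IH; set x := r ^+ n; set y := n%:R; clear; nra.
Qed.

(* The gaps isolate the k-th term of the series on the k-th annulus, and the
   quadratic exponent makes any positive power of lac k beat 2^(kp). *)
Definition lac (k : nat) : nat := (2 ^ (12 * (k.+1 * k.+1)))%N.

Lemma lac_gt0 k : (0 < lac k)%N. Proof. by rewrite expn_gt0. Qed.

(** Evenness brings the later terms of the series within reach of [pow_slope2]. *)
Lemma lac_even k : exists2 m, (0 < m)%N & lac k = (2 * m)%N.
Proof.
exists (2 ^ (12 * (k.+1 * k.+1)).-1)%N; first by rewrite expn_gt0.
by rewrite /lac -expnS prednK// !muln_gt0.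
Qed.

Lemma lac_gap k : (64 * 64 : R) * 2 ^+ k.+1 * (lac k)%:R <= (lac k.+1)%:R.
Proof.
have -> : (64 * 64 : R) = 2 ^+ 12 by rewrite !exprS expr0; lra.
rewrite /lac !natrX -!exprD; apply: ler_weXn2l; first by rewrite ler1n.
lia.
Qed.

Lemma lac_mono k j : (64 * 64 : R) * 2 ^+ k.+1 * (lac k)%:R <= (lac (k.+1 + j)%N)%:R.
Proof.
elim: j => [|j IH]; first by rewrite addn0; exact: lac_gap.
apply: le_trans IH _; rewrite addnS; apply: le_trans (lac_gap _); rewrite ler_peMl//.
have : 1 <= 2 ^+ (k.+1 + j).+1 :> R by rewrite exprn_ege1// ler1n.
by set y := 2 ^+ _; lra.
Qed.

Lemma lac_sum k : 16 * 2 ^+ k * \sum_(j < k) (lac j)%:R <= (lac k)%:R :> R.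
Proof.
elim: k => [|k IH]; first by rewrite big_ord0 mulr0.
rewrite big_ord_recr /=; apply: le_trans (lac_gap k).
rewrite exprS; move: IH; set S := \sum_(_ < _) _; set n := (lac k)%:R.
have y1 : 1 <= 2 ^+ k :> R by rewrite exprn_ege1// ler1n.
have n0 : 0 <= n by [].
move: (2 ^+ k) y1 => y y1 h.
have : 0 <= (y - 1) * n by rewrite mulr_ge0// subr_ge0.
have y0 : 0 <= y by lra.
have yn : 0 <= y * n by rewrite mulr_ge0.
move=> h2; lra.
Qed.

End Lacunary.

(** * A lacunary Bloch function with large derivative on annuli *)

Section BlochCase.
Context {R : realType}.
Local Notation MT := (measurableTypeR R * measurableTypeR R)%type.
Local Notation mu2 := (@lebesgue_measure R \x @lebesgue_measure R)%E.
Local Notation disc := (@unit_disc R).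
Implicit Types (f g h phi : R[i] -> R[i]) (z : R[i]).
Local Notation half n := ((2^-1 : R) ^+ n).

Definition lac_term (k : nat) : R[i] -> R[i] := fun z => ((half k)%:C)%C * z ^+ lac k.

Lemma lac_term_deriv k z : disc z -> holD (lac_term k) /\
  normc (cderiv (lac_term k) z) = half k * ((lac k)%:R * normc z ^+ (lac k).-1).
Proof.
move=> zD; have D v := cdiffZ ((half k)%:C)%C (cdiffX (lac k) (cdiff_id v)).
split; first by move=> v _; have [] := cdiff_derivable (D v).
have [_ ->] := cdiff_derivable (D z).
have hk := ihalf_gt0 (R := R) k.
by rewrite !Normc.normcM normc_real (ger0_norm (ltW hk)) normcX normc_nat Normc.normc1 mulr1.
Qed.

Lemma lac_term_holD k : holD (lac_term k).
Proof. by have [] := @lac_term_deriv k 0 _; rewrite /unit_disc /mkset ?Normc.normc0. Qed.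

Lemma lac_term_bound k z : normc z <= 1 -> normc (lac_term k z) <= half k.
Proof.
move=> z1; have hk := ihalf_gt0 (R := R) k.
rewrite Normc.normcM normc_real (ger0_norm (ltW hk)) normcX.
by rewrite ler_piMr ?(ltW hk)// exprn_ile1// normc_ge0.
Qed.

Lemma lac_term_summable : locally_summable lac_term.
Proof.
move=> r r1; exists 1 => j z zr; rewrite mul1r; apply: lac_term_bound.
by apply: ltW; exact: le_lt_trans r1.
Qed.

(** The modulus of the derivative of [lac_term j] on the circle of radius [r]. *)
Definition lac_slope (r : R) (j : nat) : R := half j * ((lac j)%:R * r ^+ (lac j).-1).

(** Put W = 2^-k n_k. Bernoulli's inequality gives at least W/2 for the k-th term on this annulus;
    the earlier terms add up to at most W/16 because their frequencies are much smaller, the later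
    ones because their powers of r are tiny. What remains is at least W/4. *)
Lemma lac_lower (r : R) k n : 1 - (2 * (lac k)%:R)^-1 <= r <= 1 - (4 * (lac k)%:R)^-1 ->
  half k * (lac k)%:R / 4 <=
    lac_slope r k - \sum_(j < k) lac_slope r j - \sum_(j < n) lac_slope r (k.+1 + j)%N.
Proof.
move=> /andP[r1 r2]; set a := lac_slope r; set N : R := (lac k)%:R in r1 r2 *.
have N1 : 1 <= N by rewrite ler1n lac_gt0.
have N0 : 0 < N by lra.
have i4 : 0 < (4 * N)^-1 by rewrite invr_gt0 mulr_gt0.
have i2 : (2 * N)^-1 <= 2^-1 by rewrite lef_pV2 ?posrE ?mulr_gt0//; lra.
have r0 : 0 <= r by lra.
have r1' : r < 1 by lra.
have hk := ihalf_gt0 (R := R) k.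
have A1 : half k * N / 2 <= a k.
  rewrite /a /lac_slope -mulrA ler_pM2l// -/N ler_pM2l//.
  apply: (@le_trans _ _ (r ^+ lac k)); last by apply: ler_wiXn2l; rewrite ?leq_pred// ltW.
  have := @bernoulli_le R r (lac k); rewrite r0 ltW// => /(_ isT); apply: le_trans.
  have : N * (1 - r) <= N * (2 * N)^-1 by rewrite ler_pM2l//; lra.
  rewrite invfM mulrCA divff ?gt_eqF// mulr1 -/N; lra.
have A2 : \sum_(j < k) a j <= half k * N / 16.
  apply: (@le_trans _ _ (\sum_(j < k) (lac j)%:R)).
    apply: ler_sum => j _; rewrite /a /lac_slope; apply: (@le_trans _ _ (1 * ((lac j)%:R * 1))); last by rewrite mul1r mulr1.
    apply: ler_pM; rewrite ?(ltW (ihalf_gt0 _)) ?mulr_ge0 ?exprn_ge0 ?ihalf_le1//.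
    by rewrite ler_wpM2l// exprn_ile1// ltW.
  have := lac_sum (R := R) k; have := @half_expK R k; rewrite -/N.
  set S := \sum_(j < k) _; set y := 2 ^+ k; set t := half k => ty h.
  have : t * (16 * y * S) <= t * N by rewrite ler_pM2l.
  have -> : t * (16 * y * S) = 16 * S * (t * y) by ring.
  by rewrite ty; lra.
have A3 : \sum_(j < n) a (k.+1 + j)%N <= half k * N / 16.
  apply: (@le_trans _ _ (\sum_(j < n) half k * N / 16 * half j.+1)).
    apply: ler_sum => j _; rewrite /a /lac_slope; set i := (k.+1 + j)%N.
    have [m m0 im] := lac_even i.
    have mp : 0 < m%:R :> R by rewrite ltr0n.
    (* As 1 - r >= 1/(4N), [pow_slope2] bounds the left side by 2 (4N)^2 / m, and the gap gives m >=
       64 * 64 * 2^k N. *)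
    have h : (lac i)%:R * r ^+ (lac i).-1 <= half k * N / 16.
      rewrite im; apply: le_trans (pow_slope2 m0 _) _; first by rewrite r0.
      have h1 : (4 * N)^-1 ^+ 2 <= (1 - r) ^+ 2.
        by rewrite ler_pXn2r ?nnegrE ?(ltW i4)//; clear -r2 r1'; lra.
      have h2 := lac_mono (R := R) k j; rewrite -/i im natrM -/N in h2.
      have h3 := @half_expK R k; move: h2; rewrite exprS.
      have hy : 0 < 2 ^+ k :> R by exact: exprn_gt0.
      move: h3 hy hk; set y := 2 ^+ k; set t := half k => ty y0 t0 h2.
      have h4 : 64 * 64 * y * N <= m%:R by lra.
      rewrite ler_pdivrMr; last by rewrite mulr_gt0 ?exprn_gt0//; lra.
      apply: (@le_trans _ _ (t * N / 16 * ((64 * 64 * y * N) * (4 * N)^-1 ^+ 2))).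
        have -> : t * N / 16 * ((64 * 64 * y * N) * (4 * N)^-1 ^+ 2) = 16 * (t * y).
          by field; rewrite gt_eqF.
        by rewrite ty; lra.
      rewrite ler_pM2l; last by rewrite divr_gt0 ?mulr_gt0.
      apply: ler_pM => //; last by rewrite exprn_ge0// ltW.
      by rewrite !mulr_ge0// ltW.
    rewrite mulrC; apply: ler_pM; rewrite ?mulr_ge0 ?exprn_ge0 ?(ltW (ihalf_gt0 _))//.
    by apply: half_mono; rewrite /i addSn ltnS leq_addl.
  rewrite -mulr_sumr -[leRHS]mulr1 ler_pM2l ?sum_half_lt1//.
  by rewrite divr_gt0 ?mulr_gt0.
have W0 : 0 <= half k * N by rewrite mulr_ge0// ltW.
apply: le_trans (lerB (lerB A1 A2) A3).
by move: W0; move: (half k * N) => W; clear; lra.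
Qed.

(** By [pow_slope] the j-th term contributes at most 2 * 2^-j to the Bloch bound 4. Boundedness of h
    is recorded so that a small multiple of it fits into a prescribed disc. *)
Lemma lacunary_bloch : exists h, [/\ holD h, forall z, disc z -> normc (h z) <= 4,
  forall z, disc z -> (1 - normc z ^+ 2) * normc (cderiv h z) <= 4 &
  forall k z, 1 - (2 * (lac k)%:R)^-1 <= normc z <= 1 - (4 * (lac k)%:R)^-1 ->
    half k * (lac k)%:R / 4 <= normc (cderiv h z)].
Proof.
exists (fun z => csum (lac_term^~ z)); set h := (fun z : R[i] => _).
have hh : holD h by exact: csum_holD lac_term_holD lac_term_summable.
split => //.
- move=> z zD; have H j : normc (lac_term j z) <= 1 * half j.
    by rewrite mul1r; apply: lac_term_bound; exact: ltW.
  by have := csum_tail H 0; rewrite big_ord0 subr0 expr0 !mulr1.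
- move=> z zD; have [B HB] := csum_cderiv lac_term_holD lac_term_summable zD.
  have x0 := normc1B_gt0 zD; have /andP[_ x2] := normc1B_bounds zD.
  have z0 := normc_ge0 z; have z1 : normc z <= 1 by exact: ltW.
  apply: (@le_half_eps _ _ _ ((1 - normc z ^+ 2) * B)) => n.
  have := HB n; rewrite -/h; set S := \sum_(j < n) _ => Hn.
  have : normc (cderiv h z) <= normc S + B * half n.
    by have := normc_sub_le (cderiv h z) S; lra.
  rewrite -(ler_pM2l x0) => /le_trans; apply; rewrite mulrDr mulrA lerD2r.
  apply: (@le_trans _ _ (\sum_(j < n) 2 * half j)); last first.
    by have := sum_half_le (R := R) 0 n; rewrite big_mkord -mulr_sumr expr0; lra.
  apply: le_trans (ler_wpM2l (ltW x0) (normc_sum _ _ _)) _.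
  rewrite mulr_sumr; apply: ler_sum => j _; have [_ ->] := lac_term_deriv j zD.
  rewrite mulrCA [leRHS]mulrC ler_pM2l ?ihalf_gt0//.
  have := @pow_slope R (normc z) (lac j); rewrite z0 z1 => /(_ isT).
  set y := _%:R * _ => hy.
  have y0 : 0 <= y by rewrite mulr_ge0// exprn_ge0.
  by apply: (@le_trans _ _ (2 * (1 - normc z) * y)); [rewrite ler_wpM2r|rewrite -mulrA; lra].
move=> k z zr.
have N1 : 1 <= (lac k)%:R :> R by rewrite ler1n lac_gt0.
have zD : disc z.
  have : 0 < (4 * (lac k)%:R : R)^-1 by rewrite invr_gt0 mulr_gt0//; lra.
  by rewrite /unit_disc /=; lra.
have [B HB] := csum_cderiv lac_term_holD lac_term_summable zD.
have B0 : 0 <= B by have := HB 0%N; rewrite expr0 mulr1; apply: le_trans; exact: normc_ge0.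
apply: (@le_half_eps _ _ _ B) => n.
have := HB (k.+1 + n)%N; rewrite -/h big_split_ord /= big_ord_recr /=.
set S1 := \sum_(j < k) _; set S2 := \sum_(j < n) _; set v := cderiv (lac_term k) z => Hn.
have hn : half (k.+1 + n) <= half n by rewrite half_mono// leq_addl.
have Hn' : normc (cderiv h z - (S1 + v + S2)) <= B * half n.
  by apply: le_trans Hn _; rewrite ler_wpM2l.
apply: le_trans (lac_lower n zr) _; set a := lac_slope (normc z).
have nv : normc v = a k by have [] := lac_term_deriv k zD.
have n1 : normc S1 <= \sum_(j < k) a j.
  apply: le_trans (normc_sum _ _ _) _; apply: ler_sum => j _.
  by have [_ ->] := lac_term_deriv j zD.
have n2 : normc S2 <= \sum_(j < n) a (k.+1 + j)%N.
  apply: le_trans (normc_sum _ _ _) _; apply: ler_sum => j _.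
  by have [_ ->] := lac_term_deriv (k.+1 + j)%N zD.
clear Hn; clearbody S1 S2 v.
have : normc v <= normc (cderiv h z) + normc (cderiv h z - (S1 + v + S2)) + normc S1 + normc S2.
  set D := cderiv h z - (S1 + v + S2).
  have e : v = cderiv h z - D - S1 - S2 by rewrite /D; ring.
  have t (x y : R[i]) : normc (x - y) <= normc x + normc y by rewrite -(normcN y) le_normcD.
  apply: (@le_trans _ _ (normc (cderiv h z - D - S1 - S2))); first by rewrite -e.
  apply: le_trans (t _ _) _; rewrite lerD2r; apply: le_trans (t _ _) _; rewrite lerD2r; exact: t.
rewrite nv => H; rewrite !lerBlDr [leRHS]addrAC; apply: le_trans H _.
by apply: lerD n2; apply: lerD n1; rewrite lerD2l.
Qed.

End BlochCase.

(** * Necessity for the Bloch space *)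

Section BlochNecessity.
Context {R : realType}.
Local Notation MT := (measurableTypeR R * measurableTypeR R)%type.
Local Notation mu2 := (@lebesgue_measure R \x @lebesgue_measure R)%E.
Local Notation disc := (@unit_disc R).
Implicit Types (f g h phi : R[i] -> R[i]) (z : R[i]).
Local Notation half n := ((2^-1 : R) ^+ n).

Lemma nonconstant_deriv phi : entire phi -> ~ is_constant phi -> exists w, cderiv phi w != 0.
Proof.
move=> ephi nc; apply: contrapT => H; apply: nc; exists (phi 0) => w.
have d0 v : cderiv phi v = 0 by apply/eqP; apply/negP => /negP h; apply: H; exists v.
have := @cdiff_MVI _ phi (cderiv phi) 0 w 0.
rewrite add0r mulr0 mul0r => H'.
apply/eqP; rewrite -subr_eq0 -normc_eq0 eq_le normc_ge0 andbT; apply: H' => t _.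
  exact: entire_cdiff.
by rewrite d0 Normc.normc0.
Qed.

Lemma entire_deriv_cont phi w : entire phi -> ccont (cderiv phi) w.
Proof.
move=> ephi.
have [|l Hl] := @holo_deriv _ (complex.Re w - 1) (complex.Re w + 1) (complex.Im w - 1)
  (complex.Im w + 1) w phi (cderiv phi) _ (fun z _ => entire_cdiff z ephi).
  by split; lra.
exact: cdiff_ccont Hl.
Qed.

Lemma integral_layer (p alpha V : R) h (A : set MT) : 0 < p -> 0 <= V -> measurable A ->
  A `<=` pdisc -> (forall z, disc z -> ccont h z) -> (forall w, A w -> V <= density p alpha h w) ->
  (V%:E * mu2 A <= \int[mu2]_(w in pdisc) (density p alpha h w)%:E)%E.
Proof.
move=> p0 V0 mA AD ch HV.
have md : measurable_fun (pdisc : set MT) (fun w => (density p alpha h w)%:E) by exact: measurable_density.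
apply: (@le_trans _ _ (\int[mu2]_(w in A) (density p alpha h w)%:E)%E); last first.
  apply: ge0_subset_integral => //; first exact: measurable_pdisc.
  by move=> w _; rewrite lee_fin density_ge0.
rewrite -integral_cst//; apply: ge0_le_integral => //.
- by apply: measurable_funS AD md; exact: measurable_pdisc.
Qed.

Lemma lac_powR (s p : R) k : 0 < p -> 0 < s -> p + 1 <= 12 * s * k.+1%:R ->
  2 ^+ k <= (lac k)%:R `^ s * half k `^ p.
Proof.
move=> p0 s0 Hk; have L0 : 0 < ln 2 :> R by rewrite ln_gt0// ltr1n.
have N0 : 0 < (lac k)%:R :> R by rewrite ltr0n lac_gt0.
have hk := ihalf_gt0 (R := R) k.
have lnN : ln ((lac k)%:R : R) = 12 * (k.+1%:R * k.+1%:R) * ln 2.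
  by rewrite /lac natrX lnXn// -[LHS]mulr_natl !natrM.
have lnh : ln (half k) = - (k%:R * ln 2).
  by rewrite exprVn lnV ?posrE ?exprn_gt0// lnXn// (mulr_natl (ln 2) k).
rewrite /powR !gt_eqF// -expRD lnN lnh.
have -> : (2 : R) ^+ k = expR (k%:R * ln 2) by rewrite expRM_natl lnK// posrE.
rewrite ler_expR.
have -> : s * (12 * (k.+1%:R * k.+1%:R) * ln 2) + p * - (k%:R * ln 2) =
  ((12 * s * k.+1%:R) * k.+1%:R - p * k%:R) * ln 2 by ring.
rewrite ler_pM2r//.
have h1 : (p + 1) * k.+1%:R <= 12 * s * k.+1%:R * k.+1%:R by rewrite ler_wpM2r.
by move: h1; rewrite -!natr1; clear -p0; nra.
Qed.

Lemma normc_half_near (a b : R[i]) : normc (b - a) < normc a / 2 -> normc a / 2 <= normc b.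
Proof. by have := normc_sub_le a b; rewrite normcB; lra. Qed.

(** On this annulus the weight is at least of order N^-alpha, |F'|^p at least of order (2^-k N)^p,
    and the area at least 1/(16 N). *)
Lemma annulus_layer (p alpha kap T : R) F k : 0 < p -> 0 < kap -> holD F ->
  (\int[mu2]_(w in pdisc) (density p alpha (cderiv F) w)%:E <= T%:E)%E ->
  (forall z, 1 - (2 * (lac k)%:R)^-1 <= normc z <= 1 - (4 * (lac k)%:R)^-1 ->
    kap * (half k * (lac k)%:R) <= normc (cderiv F z)) ->
  4 `^ (- `|alpha|) * kap `^ p / 16 * ((lac k)%:R `^ (p - 1 - alpha) * half k `^ p) <= T.
Proof.
move=> p0 kap0 hF IT HF.
have N1 : 1 <= (lac k)%:R :> R by rewrite ler1n lac_gt0.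
move: HF; set N : R := (lac k)%:R in N1 * => HF; have N0 : 0 < N by lra.
have hk := ihalf_gt0 (R := R) k.
have i0 : 0 < N^-1 by rewrite invr_gt0.
have i1 : N^-1 <= 1 by rewrite invf_le1.
pose a := 1 - N^-1 / 2; pose b := 1 - N^-1 / 4.
have aE : 1 - (2 * N)^-1 = a by rewrite /a invfM mulrC.
have bE : 1 - (4 * N)^-1 = b by rewrite /b invfM mulrC.
rewrite aE bE in HF.
pose V := 4 `^ (- `|alpha|) * N^-1 `^ alpha * (kap * (half k * N)) `^ p.
have V0 : 0 <= V by rewrite !mulr_ge0 ?powR_ge0.
have AD : annulus a b `<=` pdisc.
  by move=> w [_ wb]; apply: lt_trans wb _; rewrite /b; lra.
have HV (w : MT) : annulus a b w -> V <= density p alpha (cderiv F) w.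
  move=> Aw; have wD := AD _ Aw; have [wa wb] := Aw.
  have /andP[x1 x2] := normc1B_bounds wD.
  apply: ler_pM; [by rewrite mulr_ge0 ?powR_ge0|exact: powR_ge0| |].
    apply: powR_comparable => //.
    by move: wa wb x1 x2; rewrite /a /b; set n := normc (pt w); set x := 1 - n ^+ 2; clear -i0; lra.
  apply: ge0_ler_powR; rewrite ?nnegrE ?normc_ge0 ?(ltW p0)//.
    by rewrite !mulr_ge0// ltW.
  by apply: HF; rewrite (ltW wa) (ltW wb).
have H1 := integral_layer p0 V0 (measurable_annulus a b) AD (fun z zD => holD_deriv_cont hF zD) HV.
have a2 : 2^-1 <= a by rewrite /a; lra.
have ab : a < b by rewrite /a /b; lra.
have b1 : b <= 1 by rewrite /b; lra.
have H2 := annulus_area a2 ab b1.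
rewrite -lee_fin; apply: le_trans IT; apply: le_trans H1; apply: le_trans (lee_wpmul2l _ H2); last by rewrite lee_fin.
rewrite -EFinM lee_fin /V /a /b.
rewrite !powRM ?mulr_ge0 ?(ltW kap0) ?(ltW hk) ?(ltW N0)//.
have -> : N^-1 `^ alpha = N `^ (- alpha) by rewrite -powR_inv1 ?(ltW N0)// -powRrM mulN1r.
have -> : N `^ (p - 1 - alpha) = N `^ (- alpha) * N `^ p * N^-1.
  rewrite -(powR_inv1 (ltW N0)) -!powRD ?(gt_eqF N0) ?implybT//.
  by congr (_ `^ _); ring.
by rewrite le_eqVlt; apply/orP; left; apply/eqP; field; rewrite gt_eqF.
Qed.

Lemma bloch_necessary (p alpha : R) phi : entire phi -> 0 < p -> alpha < p - 1 ->
  superposition phi @` @bloch R `<=` weighted_dirichlet p alpha -> is_constant phi.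
Proof.
move=> ephi p0 ap sub; apply: contrapT => nc.
have [w0 dw0] := nonconstant_deriv ephi nc.
set c := normc (cderiv phi w0); have c0 : 0 < c by rewrite normc_gt0.
have c20 : 0 < c / 2 by rewrite divr_gt0.
have [d d0 Hd] := entire_deriv_cont w0 ephi c20.
have low v : normc (v - w0) < d -> c / 2 <= normc (cderiv phi v).
  by move=> /Hd; exact: normc_half_near.
have [h [hh h4 hB hL]] := @lacunary_bloch R.
(* As |h| <= 4, the values of [f] stay within d/2 of [w0], in the region where |phi'| >= c/2. *)
pose s := d / 8; have s0 : 0 < s by rewrite divr_gt0.
pose f z := w0 + (s%:C)%C * h z.
have df z : disc z -> cdiff f z ((s%:C)%C * cderiv h z).
  move=> zD; apply: cdiff_eq (cdiffD (cdiff_cst w0 z) (cdiffZ _ (holD_cdiff hh zD))).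
  by rewrite add0r.
have hf : holD f by move=> z /df/cdiff_derivable[].
have fE z : disc z -> normc (cderiv f z) = s * normc (cderiv h z).
  move=> /df/cdiff_derivable[_ ->].
  by rewrite Normc.normcM normc_real (ger0_norm (ltW s0)).
have fw z : disc z -> normc (f z - w0) < d.
  move=> zD; rewrite /f addrAC subrr add0r Normc.normcM normc_real (ger0_norm (ltW s0)).
  have := ler_wpM2l (ltW s0) (h4 z zD); rewrite /s; lra.
have bf : bloch f.
  split => //; apply: (@le_lt_trans _ _ (s * 4)%:E); last by rewrite ltry.
  apply: ge_ereal_sup => _ [z zD <-]; rewrite lee_fin fE// mulrCA.
  by rewrite ler_pM2l//; exact: hB.
have /dirichletP[hF] := sub _ (ex_intro2 _ _ f bf erefl).
set F := superposition phi f in hF *; set I := (\int[_]_(_ in _) _)%E => Ioo.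
have I0 : (0 <= I)%E by apply: integral_ge0 => w _; rewrite lee_fin density_ge0.
have [T IT] : exists T, I = T%:E by case: (I) I0 Ioo => // t _ _; exists t.
have FE z : disc z -> c / 2 * (s * normc (cderiv h z)) <= normc (cderiv F z).
  move=> zD.
  have e : normc (cderiv F z) = normc (cderiv phi (f z)) * normc (cderiv f z) :=
    etrans (congr1 _ (superposition_deriv ephi hf zD)) (Normc.normcM _ _).
  have e' := congr1 (fun t => c / 2 * t) (fE z zD).
  apply: (@le_trans _ _ (c / 2 * normc (cderiv f z))).
    by rewrite le_eqVlt; apply/orP; left; apply/eqP; exact: esym e'.
  apply: (@le_trans _ _ (normc (cderiv phi (f z)) * normc (cderiv f z))).
    by apply: ler_wpM2r; [exact: normc_ge0|exact/low/fw].
  by rewrite le_eqVlt; apply/orP; left; apply/eqP; exact: esym e.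
pose kap := c * s / 8; have kap0 : 0 < kap by rewrite divr_gt0 ?mulr_gt0.
pose C0 := 4 `^ (- `|alpha|) * kap `^ p / 16.
have C00 : 0 < C0 by rewrite divr_gt0 ?mulr_gt0 ?powR_gt0.
pose q := p - 1 - alpha; have q0 : 0 < q by rewrite /q; lra.
have layer k : C0 * ((lac k)%:R `^ q * half k `^ p) <= T.
  have IT' : (I <= T%:E)%E by rewrite IT.
  apply: (@annulus_layer p alpha kap T F k p0 kap0 hF IT').
  move=> z zr; have := hL k z zr.
  have zD : disc z.
    have : 0 < (4 * (lac k)%:R : R)^-1 by rewrite invr_gt0 mulr_gt0// ltr0n lac_gt0.
    by move: zr => /andP[_]; rewrite /unit_disc /mkset; move: (normc z) => n; lra.
  move=> H; apply: le_trans (FE _ zD).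
  have cs : 0 <= c / 2 * s by rewrite mulr_ge0 ?(ltW s0) ?(ltW c20).
  rewrite [leRHS]mulrA; apply: le_trans (ler_wpM2l cs H).
  by rewrite /kap le_eqVlt; apply/orP; left; apply/eqP; field.
(* [lac_powR] asks for p + 1 <= 12 q (k + 1), true from [k0] on; the k-th layer is then at least
   [C0] 2^k, which no finite [T] bounds. *)
have [k0 Hk0] : exists k0 : nat, (p + 1) / (12 * q) < k0%:R.
  exists (Num.truncn ((p + 1) / (12 * q))).+1.
  have x0 : 0 <= (p + 1) / (12 * q) by rewrite divr_ge0 ?mulr_ge0 ?(ltW q0)//; lra.
  by have /andP[] := truncn_itv x0.
have grow m : C0 * 2 ^+ m <= T.
  apply: le_trans (layer (k0 + m)%N); rewrite ler_pM2l//.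
  apply: (@le_trans _ _ (2 ^+ (k0 + m))).
    by apply: ler_weXn2l; rewrite ?ler1n// leq_addl.
  apply: lac_powR => //; move: Hk0; rewrite ltr_pdivrMr ?mulr_gt0// mulrC => H.
  apply: le_trans (ltW H) _; rewrite ler_pM2l ?mulr_gt0// ler_nat -addnS leq_addr//.
have T0 : 0 < T by apply: lt_le_trans (grow 0%N); rewrite expr0 mulr1.
have [n Hn] : exists n, half n < C0 / T by apply: ihalf_small; rewrite divr_gt0.
move: Hn; rewrite ltNge => /negP; apply; rewrite ler_pdivrMr// exprVn.
by rewrite mulrC ler_pdivlMr ?exprn_gt0.
Qed.

Lemma constant_sufficient (p alpha : R) phi (A : set (R[i] -> R[i])) : 0 < p -> is_constant phi ->
  superposition phi @` A `<=` weighted_dirichlet p alpha.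
Proof.
move=> p0 [c Hc] _ [f _ <-]; apply/dirichletP.
have D z : cdiff (superposition phi f) z 0.
  by apply: cdiff_ext (cdiff_cst c z) => w; rewrite /superposition /= Hc.
split; first by move=> z _; have [] := cdiff_derivable (D z).
rewrite integral0_eq ?ltry// => w _; have [_ E] := cdiff_derivable (D (pt w)).
by rewrite /density E Normc.normc0 powR0 ?mulr0// gt_eqF.
Qed.

End BlochNecessity.

Theorem theorem9 (R : realType) (phi : R[i] -> R[i]) (p alpha : R)
    (hphi : entire phi) (hp : 0 < p) (halpha : -1 < alpha)
    (hlo : p - 2 < alpha) (hhi : alpha < p - 1) :
  ((superposition phi @` @bloch R `<=` weighted_dirichlet p alpha)
     <-> is_constant phi) /\
  (p <= 2 -> p / 2 - 1 < alpha ->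
     ((superposition phi @` @dirichlet R `<=` weighted_dirichlet p alpha)
        <-> ((growth_order phi < 2%:E)%E \/
             (growth_order phi = 2%:E /\ (growth_type phi < +oo)%E)))) /\
  (2 < p ->
     ((superposition phi @` @dirichlet R `<=` weighted_dirichlet p alpha)
        <-> ((growth_order phi < 2%:E)%E \/
             (growth_order phi = 2%:E /\ (growth_type phi < +oo)%E)))).
Proof.
split; first by split; [exact: bloch_necessary|exact: constant_sufficient].
split=> [p2 ha|p2].
  split; first exact: gauss_necessary.
  by move=> /(order_gauss hphi); apply: gauss_sufficient.
split; first exact: gauss_necessary.
move=> /(order_gauss hphi); apply: gauss_sufficient => //.
by rewrite ltNge (ltW p2).
Qed.
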